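(* Let $\mathcal{A}\subset R_d$ and $\mathcal{B}\subset R_e$ be elements of $\mathcal{M}(Q)$, and let $r$ be the integer defined by $$\operatorname{codim}(\mathcal{A}*\mathcal{B})=\operatorname{codim}\mathcal{A}+\operatorname{codim}\mathcal{B}-\langle e,d\rangle+r.$$ Then there is a tuple $(A,B,\zeta)\in\mathcal{A}\times\mathcal{B}\times\bigoplus_{\alpha: i\to j}\mathrm{Hom}_k(k^{d_i},k^{e_j})$ such that 1. $A$ is a smooth point of $\mathcal{A}$, $B$ is a smooth point of $\mathcal{B}$, and $z=\begin{pmatrix}B&\zeta\\0&A\end{pmatrix}$ is a smooth point of $\mathcal{A}*\mathcal{B}$; 2. the morphism $m:G_{d+e}\times p^{-1}(\mathcal{A}\times\mathcal{B})\to\mathcal{A}*\mathcal{B}$, $(g,y)\mapsto g\cdot y$, is smooth at the point $(1,z)$; 3. $\dim\mathrm{Hom}_{kQ}(B,A)=\mathrm{hom}(\mathcal{B},\mathcal{A})$; and for which $$r=\dim\{f\in\mathrm{Hom}_{kQ}(B,A)\,:\, f\zeta\in T_A\mathcal{A},\ \zeta f\in T_B\mathcal{B}\}.$$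
   Context: $k$ is an algebraically closed field of characteristic $0$, and $Q$ is a finite quiver without oriented cycles with vertex set $I$; $t\alpha$ and $h\alpha$ denote the tail and head of an arrow $\alpha$. $\mathbf{N}I$ is the set of vectors with nonnegative integer coordinates in the free abelian group on symbols $\sigma_i$ ($i\in I$). The Euler form is $\langle d,e\rangle=\sum_{i\in I}d_ie_i-\sum_{i\to j}d_ie_j$ (second sum over all arrows). For $d\in\mathbf{N}I$, $R_d=\bigoplus_{\alpha:i\to j}\mathrm{Hom}_k(k^{d_i},k^{d_j})$ is the affine variety of representations of $Q$ of dimension vector $d$ (points are identified with representations), acted on by $G_d=\prod_{i\in I}\mathrm{GL}_{d_i}(k)$ via $(g_i)_i(M_\alpha)_\alpha=(g_{h\alpha}M_\alpha g_{t\alpha}^{-1})_\alpha$. For $\mathcal{A}\subset R_d$, $\mathcal{B}\subset R_e$, the set $\mathcal{A}*\mathcal{B}\subset R_{d+e}$ consists of all $X\in R_{d+e}$ for which there is an exact sequence $0\to N\to X\to M\to 0$ with $M\in\mathcal{A}$, $N\in\mathcal{B}$. $\mathcal{M}(Q)$ is the set of all irreducible, closed, $G_d$-stable subvarieties of the $R_d$, $d\in\mathbf{N}I$. For $\mathcal{A}\subset R_d$ in $\mathcal{M}(Q)$, $\operatorname{codim}\mathcal{A}:=\dim R_d-\dim\mathcal{A}$; and $\mathrm{hom}(\mathcal{B},\mathcal{A}):=\min\{\dim_k\mathrm{Hom}_{kQ}(B,A): A\in\mathcal{A},B\in\mathcal{B}\}$. $Z_{d,e}\subset R_{d+e}$ is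 the closed subvariety of representations of the block form $\left(\begin{pmatrix}N_\alpha&\zeta_\alpha\\0&M_\alpha\end{pmatrix}\right)_\alpha$ with $M\in R_d$, $N\in R_e$ and $\zeta_\alpha\in\mathrm{Hom}_k(k^{d_{t\alpha}},k^{e_{h\alpha}})$, and $p:Z_{d,e}\to R_d\times R_e$ is the projection to $(M,N)$; thus $p^{-1}(\mathcal{A}\times\mathcal{B})$ is the set of such block representations with $M\in\mathcal{A}$, $N\in\mathcal{B}$. $\begin{pmatrix}B&\zeta\\0&A\end{pmatrix}$ denotes the corresponding point of $Z_{d,e}$. The Zariski tangent spaces $T_A\mathcal{A}$ and $T_B\mathcal{B}$ are viewed as subspaces of the vector spaces $R_d$ and $R_e$. For $f=(f_i)_{i\in I}\in\mathrm{Hom}_{kQ}(B,A)$, with $f_i:k^{e_i}\to k^{d_i}$, we write $f\zeta=(f_{h\alpha}\zeta_\alpha)_\alpha\in R_d$ and $\zeta f=(\zeta_\alpha f_{t\alpha})_\alpha\in R_e$. *)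

(* Defs.v *)
From mathcomp Require Import all_boot all_order all_algebra.
From mathcomp Require Import boolp classical_sets.
From mathcomp Require Import mpoly.

Set Implicit Arguments.
Unset Strict Implicit.
Unset Printing Implicit Defensive.

Import GRing.Theory VectorInternalTheory.

Local Open Scope classical_set_scope.
Local Open Scope ring_scope.

Definition nat_max (S : set nat) : nat :=
  xget 0%N [set n | S n /\ forall m, S m -> (m <= n)%N].

Definition nat_min (S : set nat) : nat :=
  xget 0%N [set n | S n /\ forall m, S m -> (n <= m)%N].

(* A finite-dimensional vector space V is regarded as an affine variety.
   Polynomial functions on V are polynomials in the coordinates [v2r].        *)
Section AffineVarieties.
Variable k : fieldType.

(* Meaningful for a linear subspace P of V. *)
Definition vdim (V : vectType k) (P : set V) : nat :=
  \dim (xget 0%VS [set U : {vspace V} | forall v, P v <-> v \in U]).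

Section OneSpace.
Variable V : vectType k.

Definition polyfun := {mpoly k[dim V]}.

Definition peval (p : polyfun) (x : V) : k := p.@[fun i => v2r x ord0 i].

(* The differential of p at x, applied to v. *)
Definition pdiff (p : polyfun) (x v : V) : k :=
  \sum_(i < dim V) v2r v ord0 i * peval p^`M(i) x.

Definition zclosed (X : set V) : Prop :=
  exists S : set polyfun, X = [set x | forall p, S p -> peval p x = 0].

Definition zclosed_in (X Z : set V) : Prop :=
  exists2 F, zclosed F & Z = X `&` F.

Definition irreducible (X : set V) : Prop :=
  X !=set0 /\
  forall F1 F2, zclosed F1 -> zclosed F2 ->
    X `<=` F1 `|` F2 -> X `<=` F1 \/ X `<=` F2.

Definition chain (P : set (set V)) (n : nat) : Prop :=
  exists2 Z : nat -> set V,
    forall i, (i <= n)%N -> P (Z i) & forall i, (i < n)%N -> Z i `<` Z i.+1.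

Definition krull_dim (X : set V) : nat :=
  nat_max (chain [set Z | zclosed_in X Z /\ irreducible Z]).

(* Restricting to the chains of sets through x gives the Krull dimension of
   the local ring of X at x.                                                  *)
Definition local_dim (X : set V) (x : V) : nat :=
  nat_max (chain [set Z | [/\ zclosed_in X Z, irreducible Z & Z x]]).

Definition codim (X : set V) : int :=
  (krull_dim [set: V])%:Z - (krull_dim X)%:Z.

Definition tangent (X : set V) (x : V) : set V :=
  [set v | forall p, (forall y, X y -> peval p y = 0) -> pdiff p x v = 0].

Definition smooth_point (X : set V) (x : V) : Prop :=
  X x /\ vdim (tangent X x) = local_dim X x.

End OneSpace.

(* Smoothness at x of a morphism phi : X -> Y, for X locally closed in V and Y
   closed in W, following Bosch-Luetkebohmert-Raynaud, Neron Models, 2.2,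
   Definition 3: near x, the Y-scheme X is embedded in Y x V by
   x |-> (phi x, x), and it is required that the ideal of the image be generated
   locally at (phi x, x) by sections g_1, ..., g_c whose relative differentials
   over Y are linearly independent at (phi x, x).  The coordinate ring of Y x V
   consists of the polynomial functions on W x V, restricted to Y x V.        *)
Definition smooth_at (V W : vectType k) (X : set V) (Y : set W) (phi : V -> W)
    (x : V) : Prop :=
  let vanishes_on_graph (p : polyfun (W * V)%type) :=
    forall x', X x' -> peval p (phi x', x') = 0 in
  X x /\
  exists c (g : 'I_c -> polyfun (W * V)%type),
    [/\ forall i, vanishes_on_graph (g i),
        forall f, vanishes_on_graph f ->
          exists h (q : 'I_c -> polyfun (W * V)%type),
            peval h (phi x, x) != 0 /\
            forall y v, Y y ->
              peval h (y, v) * peval f (y, v) =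
              \sum_(i < c) peval (q i) (y, v) * peval (g i) (y, v)
      & forall a : 'I_c -> k,
          (forall v : V,
             \sum_(i < c) a i * pdiff (g i) (phi x, x) (0, v) = 0) ->
          forall i, a i = 0].

(* Families of matrices indexed by a finite type, as the affine space of their
   entries.                                                                   *)
Section MatrixFamilies.
Variables (J : finType) (m n : J -> nat).

Definition mxfam := {ffun {j : J & ('I_(m j) * 'I_(n j))%type} -> k^o}.

Definition mxf (x : mxfam) (j : J) : 'M[k]_(m j, n j) :=
  \matrix_(r, s) x (Tagged (fun j => ('I_(m j) * 'I_(n j))%type) (r, s)).

Definition mxfam_of (F : forall j, 'M[k]_(m j, n j)) : mxfam :=
  [ffun u => F (tag u) (tagged u).1 (tagged u).2].

End MatrixFamilies.

End AffineVarieties.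

Record quiver := Quiver {
  vertex : finType;
  arrow : finType;
  tl : arrow -> vertex;
  hd : arrow -> vertex
}.

Definition acyclic (Q : quiver) : Prop :=
  forall (a : arrow Q) (s : seq (arrow Q)),
    path [rel b c | hd b == tl c] a s -> hd (last a s) != tl a.

Section Representations.
Variables (k : fieldType) (Q : quiver).

Definition dimvec := vertex Q -> nat.

Definition dadd (d e : dimvec) : dimvec := fun i => (d i + e i)%N.

Definition euler (d e : dimvec) : int :=
  (\sum_(i : vertex Q) d i * e i)%N%:Z
    - (\sum_(a : arrow Q) d (tl a) * e (hd a))%N%:Z.

(* Linear maps act on column vectors. *)
Definition rep (d : dimvec) := @mxfam k (arrow Q) (d \o @hd Q) (d \o @tl Q).

Definition arrow_maps (d e : dimvec) :=
  @mxfam k (arrow Q) (e \o @hd Q) (d \o @tl Q).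

Definition vertex_maps (d e : dimvec) := @mxfam k (vertex Q) e d.

Definition HomQ (d e : dimvec) (M : rep d) (N : rep e) : set (vertex_maps d e) :=
  [set f | forall a : arrow Q,
    mxf f (hd a) *m mxf M a = mxf N a *m mxf f (tl a)].

Definition homQ (d e : dimvec) (A : set (rep d)) (B : set (rep e)) : nat :=
  nat_min [set n | exists M N, [/\ A M, B N & n = vdim (HomQ M N)]].

Definition gl (d : dimvec) : set (vertex_maps d d) :=
  [set g | forall i, mxf g i \in unitmx].

Definition gl1 (d : dimvec) : vertex_maps d d := mxfam_of (fun i => 1%:M).

Definition gl_act (d : dimvec) (g : vertex_maps d d) (M : rep d) : rep d :=
  mxfam_of (fun a : arrow Q =>
    mxf g (hd a) *m mxf M a *m invmx (mxf g (tl a))).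

Definition in_MQ (d : dimvec) (A : set (rep d)) : Prop :=
  [/\ zclosed A, irreducible A & forall g M, @gl d g -> A M -> A (gl_act g M)].

Definition short_exact (e n d : dimvec) (N : rep e) (X : rep n) (M : rep d)
    (f : vertex_maps e n) (g : vertex_maps n d) : Prop :=
  [/\ HomQ N X f, HomQ X M g,
      forall i (u : 'cV_(e i)), mxf f i *m u = 0 -> u = 0,
      forall i (w : 'cV_(d i)), exists v, mxf g i *m v = w
    & forall i (v : 'cV_(n i)),
        mxf g i *m v = 0 <-> exists u, v = mxf f i *m u].

(* The sum of the dimension vectors is written e + d, so that k^(e i + d i) is
   k^(e i) followed by k^(d i), as in the block form of [extension] below.    *)
Definition star (d e : dimvec) (A : set (rep d)) (B : set (rep e)) :
    set (rep (dadd e d)) :=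
  [set X | exists M N f g, [/\ A M, B N & short_exact N X M f g]].

Definition extension (d e : dimvec) (N : rep e) (zeta : arrow_maps d e)
    (M : rep d) : rep (dadd e d) :=
  mxfam_of (fun a : arrow Q => block_mx (mxf N a) (mxf zeta a) 0 (mxf M a)).

Definition extensions (d e : dimvec) (A : set (rep d)) (B : set (rep e)) :
    set (rep (dadd e d)) :=
  [set y | exists M N zeta, [/\ A M, B N & y = extension N zeta M]].

Definition post (d e : dimvec) (f : vertex_maps e d) (zeta : arrow_maps d e) :
    rep d :=
  mxfam_of (fun a : arrow Q => mxf f (hd a) *m mxf zeta a).

Definition pre (d e : dimvec) (zeta : arrow_maps d e) (f : vertex_maps e d) :
    rep e :=
  mxfam_of (fun a : arrow Q => mxf zeta a *m mxf f (tl a)).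

End Representations.

Arguments gl k {Q} d.
Arguments gl1 k {Q} d.

(* Main.v *)
From HB Require Import structures.
Require Import Defs.
From mathcomp Require Import all_boot all_order all_algebra.
From mathcomp Require Import boolp classical_sets ring zify mpoly.

Set Implicit Arguments.
Unset Strict Implicit.
Unset Printing Implicit Defensive.

Import GRing.Theory VectorInternalTheory.

Local Open Scope classical_set_scope.
Local Open Scope ring_scope.

(** The theorem is a tangent space computation at a generic point of the orbit
    map m(g, y) = g y, from the product of the group with the set E of block
    matrices over the two given sets, onto the star; its image is the star
    because an extension is a block matrix in a suitable basis ([starE]).

    Let z be the block matrix of (A, zeta, B).  If m is smooth at (1, z), then
    its differential there is onto the tangent space of the star
    ([smooth_at_tangent]).  As the two given sets are stable under the groups,
    the infinitesimal action of the block triangular matrices does not leave the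
    tangent space of E ([orbit_tangent]), so the tangent space of the star is
    the sum of that of E and of the image of the lower left blocks f under
    f |-> [f, z] = ((- zeta f, 0), (f B - A f, f zeta)) ([tangent_star]).  Such an
    image is tangent to E exactly when f is a morphism B -> A with f zeta and
    zeta f tangent to the two sets.  Counting dimensions
    ([dim_extension_tangent]) gives the formula for r, provided that tangent
    spaces have the Krull dimension of the sets that they belong to.

    It remains to find one point with all the generic properties: smoothness of
    the three points, smoothness of m at (1, z), and minimality of dim Hom(B, A).
    The minimality is the nonvanishing of a minor ([generic_hom]).  The others
    come from one elementary device, triangular sets.  Let P be a prime ideal of
    k[x_0, ..., x_(n-1)].  Reading the variables in order, x_j is transcendental
    or algebraic modulo P over the previous ones; in the second case choose in P
    a polynomial g_j of least degree in x_j with leading coefficient outside P.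
    In characteristic 0 the derivative of g_j in x_j is outside P.  At a zero of
    P where these leading coefficients and derivatives do not vanish:
    - pseudo-division by the g_j shows that they generate P locally, which gives
      the tangent space, of dimension the number of transcendental variables
      ([nondegenerate_tangent_basis]), and, for the ideal of a graph with the
      coordinates of the target first, smoothness of the projection to the target
      ([nondegenerate_locally_generated], [generic_smoothness]);
    - zeros lift from the first variables to the next ones, which gives the
      Nullstellensatz and shows that images are open in their closure
      ([zeros_lift], [image_open_in_closure]);
    - going down produces a chain of primes of the expected length
      ([nondegenerate_chain]).
    No longer chain exists, since the number of transcendental variables
    strictly increases with the irreducible set ([tdim_lt]): it does not depend
    on the coordinates, being the dimension of a tangent space.  Hence generic
    points are smooth and the tangent dimension is the Krull dimension
    ([generic_smooth_point]).

    The generic point (g, y) found on the graph of m is moved to (1, y) by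
    translation by g, and irreducibility of the parameter space reconciles the
    conditions on y with those on A and B ([generic_point]). *)

(** * Prime ideals of polynomials in one variable *)

Record prime_ideal (R : comNzRingType) (P : set R) : Prop := PrimeIdeal {
  prime0 : P 0;
  primeD : forall a b, P a -> P b -> P (a + b);
  primeM : forall a b, P b -> P (a * b);
  prime1 : ~ P 1;
  primeP : forall a b, P (a * b) -> P a \/ P b }.

Section PrimeIdealTheory.
Variables (R : comNzRingType) (P : set R).
Hypothesis pP : prime_ideal P.

Lemma primeN a : P a -> P (- a).
Proof. by rewrite -mulN1r; apply: primeM. Qed.

Lemma primeB a b : P a -> P b -> P (a - b).
Proof. by move=> Pa /primeN; apply: primeD. Qed.

Lemma prime_sum (I : Type) (s : seq I) (Q : pred I) (F : I -> R) :
  (forall i, Q i -> P (F i)) -> P (\sum_(i <- s | Q i) F i).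
Proof. by move=> PF; apply: (big_ind P) => //; [apply: prime0 | apply: primeD]. Qed.

Lemma primeX a n : P (a ^+ n) -> P a.
Proof.
elim: n => [/(prime1 pP)//|n IHn]; rewrite exprS => /(primeP pP)[] //.
Qed.

Lemma primeDl a b : P a -> P (a + b) -> P b.
Proof. by move=> Pa /primeB/(_ Pa); rewrite addrC addKr. Qed.

Lemma primeM_notin a b : ~ P a -> ~ P b -> ~ P (a * b).
Proof. by move=> Pa Pb /(primeP pP)[]. Qed.

End PrimeIdealTheory.

(** Zorn's lemma on the ideals containing J and disjoint from S: a maximal one is
    prime, because adding an outside element makes it meet S. *)
Lemma prime_avoiding (R : comNzRingType) (J S : set R) :
    J 0 -> (forall a b, J a -> J b -> J (a + b)) ->
    (forall a b, J b -> J (a * b)) ->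
    S 1 -> (forall a b, S a -> S b -> S (a * b)) ->
    (forall a, J a -> ~ S a) ->
  exists Q : set R, [/\ prime_ideal Q, J `<=` Q & forall a, Q a -> ~ S a].
Proof.
move=> J0 JD JM S1 SM JS.
pose idl (A : set R) := [/\ J `<=` A, forall a b, A a -> A b -> A (a + b),
  forall a b, A b -> A (a * b) & forall a, A a -> ~ S a].
have [F Fp totF|A [PA maxA]] := @Zorn_bigcup R (fun A => A = set0 \/ idl A).
  have [[X0 [FX0 [a0 X0a0]]]|noX] :=
    pselect (exists X, F X /\ exists a, X a); last first.
    left; rewrite -subset0 => a [X FX Xa]; apply: noX.
    by exists X; split=> //; exists a.
  have idlX X a : F X -> X a -> idl X.
    by move=> FX Xa; case: (Fp _ FX) => // X00; rewrite X00 in Xa.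
  right; split.
  - move=> a Ja; exists X0 => //; case: (idlX _ _ FX0 X0a0) => JX _ _ _.
    exact: JX.
  - move=> a b [X FX Xa] [Y FY Yb].
    have [_ DX _ _] := idlX _ _ FX Xa; have [_ DY _ _] := idlX _ _ FY Yb.
    case: (totF _ _ FX FY) => [XY|YX].
      by exists Y => //; apply: DY => //; apply: XY.
    by exists X => //; apply: DX => //; apply: YX.
  - move=> a b [X FX Xb]; exists X => //.
    by have [_ _ MX _] := idlX _ _ FX Xb; apply: MX.
  - move=> a [X FX Xa]; have [_ _ _ SX] := idlX _ _ FX Xa; exact: SX.
have [A0|[JA AD AM AS]] := PA.
  case: (maxA J); last by right; split.
  rewrite A0; split; first exact: sub0set.
  by move=> /(_ 0 J0).
exists A; split=> //.
have A0 := JA 0 J0.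
have key a : ~ A a -> exists c d, A c /\ S (c + d * a).
  move=> nAa; apply: contrapT => no.
  apply: (maxA [set x | exists c d, A c /\ x = c + d * a]); last first.
    right; split.
    - by move=> x /JA Ax; exists x, 0; rewrite mul0r addr0.
    - move=> _ _ [c [d [Ac ->]]] [c' [d' [Ac' ->]]].
      exists (c + c'), (d + d'); split; first exact: AD.
      by rewrite mulrDl addrACA.
    - move=> x _ [c [d [Ac ->]]]; exists (x * c), (x * d).
      by split; [apply: AM | rewrite mulrDr mulrA].
    - by move=> _ [c [d [Ac ->]]] Sx; apply: no; exists c, d.
  split; first by move=> x Ax; exists x, 0; rewrite mul0r addr0.
  by move=> sA; apply: nAa; apply: sA; exists 0, 1; rewrite add0r mul1r.
split=> //.
- by move=> A1; apply: (AS _ A1).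
- move=> a b Aab; apply: contrapT => /not_orP[/key [c [d [Ac Sc]]]].
  move=> /key [c' [d' [Ac' Sc']]].
  apply: (AS _ _ (SM _ _ Sc Sc')).
  rewrite mulrDl; apply: (AD); first by rewrite mulrC; apply: (AM).
  rewrite mulrDr; apply: (AD); first exact: (AM).
  have -> : d * a * (d' * b) = d * d' * (a * b) by rewrite mulrACA.
  exact: (AM).
Qed.

Section OneVariable.
Variable R : idomainType.
Implicit Type P : set {poly R}.

Definition contraction P : set R := [set a | P a%:P].

Definition algebraic P := exists p, P p /\ ~ contraction P (lead_coef p).

(** A lift to R[X] of the minimal polynomial of the class of X over the fraction
    field of R modulo the contraction of P.  The last condition says that
    polynomials of smaller degree vanish at that class only if their coefficients
    do. *)
Definition minimal_pol P g :=
  [/\ P g, ~ contraction P (lead_coef g)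
    & forall r, P r -> (size r < size g)%N -> forall i, contraction P r`_i].

Lemma contraction_prime P : prime_ideal P -> prime_ideal (contraction P).
Proof.
move=> pP; split; rewrite /contraction /=.
- exact: (prime0 pP).
- by move=> a b; rewrite polyCD; apply: (primeD pP).
- by move=> a b; rewrite polyCM; apply: (primeM pP).
- exact: (prime1 pP).
- by move=> a b; rewrite polyCM; apply: (primeP pP).
Qed.

Section Fixed.
Variable P : set {poly R}.
Hypothesis pP : prime_ideal P.

Lemma mem_coefs (p : {poly R}) : (forall i, contraction P p`_i) -> P p.
Proof.
move=> Pp; rewrite -[p]coefK poly_def; apply: (prime_sum pP) => // i _.
by rewrite -mul_polyC mulrC; apply: (primeM pP) => //; apply: Pp.
Qed.

(** The top coefficient can be removed without leaving P, so the property of the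
    leading coefficients descends to all coefficients. *)
Lemma coefs_below n :
    (forall p, P p -> (size p < n)%N -> contraction P (lead_coef p)) ->
  forall p, P p -> (size p < n)%N -> forall i, contraction P p`_i.
Proof.
move=> Pn p; have [m] := ubnP (size p); elim: m p => // m IHm p ltpm Pp ltpn i.
have Pl := Pn p Pp ltpn.
have pcP := contraction_prime pP.
have [->|p0] := eqVneq p 0; first by rewrite coef0; apply: (prime0 pcP).
pose p' := p - lead_coef p *: 'X^((size p).-1).
have Pp' : P p'.
  apply: (primeB pP) => //; rewrite -mul_polyC mulrC; exact: (primeM pP).
have ltp' : (size p' < size p)%N.
  rewrite -[size p]prednK ?size_poly_gt0 // ltnS; apply/leq_sizeP => j lej.
  rewrite coefB coefZ coefXn; have [->|neqj] := eqVneq j (size p).-1.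
    by rewrite mulr1 subrr.
  rewrite mulr0 subr0 nth_default // -[size p]prednK ?size_poly_gt0 //.
  by rewrite ltn_neqAle eq_sym neqj.
have Pi := IHm p' (leq_trans ltp' ltpm) Pp' (ltn_trans ltp' ltpn) i.
have -> : p`_i = p'`_i + (i == (size p).-1)%:R * lead_coef p.
  by rewrite coefB coefZ coefXn mulrC subrK.
by apply: (primeD pcP) => //; apply: (primeM pcP).
Qed.

Lemma transcendental_coef : ~ algebraic P ->
  forall p, P p -> forall i, contraction P p`_i.
Proof.
move=> nalg p Pp; apply: (@coefs_below (size p).+1) => // q Pq _.
by apply: contrapT => nq; apply: nalg; exists q.
Qed.

Lemma minimal_pol_exists : algebraic P -> exists g, minimal_pol P g.
Proof.
move=> [p [Pp np]].
pose Q n := `[< exists g, [/\ P g, ~ contraction P (lead_coef g) & size g = n] >].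
have exQ : exists n, Q n by exists (size p); apply/asboolP; exists p.
case: (ex_minnP exQ) => n /asboolP[g [Pg ng sg]] minn.
exists g; split=> //; apply: coefs_below => q Pq ltq.
apply: contrapT => nq; have := minn (size q).
have Qq : Q (size q) by apply/asboolP; exists q.
by move=> /(_ Qq); rewrite leqNgt -sg ltq.
Qed.

Lemma minimal_pol_neq0 g : minimal_pol P g -> g != 0.
Proof.
case=> _ ng _; apply/eqP => g0; apply: ng; rewrite g0 lead_coef0.
by apply: (prime0 (contraction_prime pP)) => //; apply: contraction_prime.
Qed.

Lemma minimal_pol_size g : minimal_pol P g -> (1 < size g)%N.
Proof.
move=> [Pg ng _]; rewrite ltnNge; apply/negP => /size1_polyC gC.
by apply: ng; rewrite gC lead_coefC /contraction /= -gC.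
Qed.

Lemma pseudo_division (g f : {poly R}) : g != 0 ->
  exists m (q r : {poly R}), lead_coef g ^+ m *: f = q * g + r /\ (size r < size g)%N.
Proof.
move=> g0; exists (scalp f g), (f %/ g), (f %% g).
by rewrite Pdiv.Idomain.divp_eq Pdiv.Idomain.ltn_modp.
Qed.

(** The remainder lies in P and has degree less than g, so minimality of g applies
    to it. *)
Lemma pseudo_division_mem g f : minimal_pol P g -> P f ->
  exists m (q r : {poly R}), lead_coef g ^+ m *: f = q * g + r /\
    forall i, contraction P r`_i.
Proof.
move=> mg Pf; have [m [q [r [eqr ltr]]]] := pseudo_division f (minimal_pol_neq0 mg).
have [Pg _ minr] := mg.
exists m, q, r; split=> //; apply: minr => //.
apply: (@primeDl _ _ pP (q * g)); first exact: (primeM pP).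
by rewrite -eqr -mul_polyC; apply: (primeM pP).
Qed.

(** Separability: the derivative has smaller degree than g, and its leading
    coefficient is an integer times that of g. *)
Lemma minimal_pol_deriv (g : {poly R}) : (forall n, ~ contraction P n.+1%:R) ->
  minimal_pol P g -> ~ P g^`().
Proof.
move=> charP mg Pg'; have lt1g := minimal_pol_size mg.
have [Pg ng minr] := mg.
have /minr : P g^`() by [].
have g0 := minimal_pol_neq0 mg.
move=> /(_ (lt_size_deriv g0)) /(_ (size g).-2); rewrite coef_deriv.
have -> : (size g).-2.+1 = (size g).-1 by case: (size g) lt1g => [|[]].
rewrite -/(lead_coef g) -mulr_natl.
have pcP := contraction_prime pP.
move=> /(primeP pcP)[] //.
by case: (size g) lt1g => [|[|n]] //= _ /charP.
Qed.

Lemma contraction_notin_scale a f : ~ contraction P a -> ~ P f ->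
  forall m, ~ P (a ^+ m *: f).
Proof.
move=> na nf m; rewrite -mul_polyC; apply: (primeM_notin pP) => //.
by rewrite polyC_exp => /(primeX pP).
Qed.

End Fixed.

Definition extension_ideal (q : set R) : set {poly R} :=
  [set p : {poly R} | forall i, q p`_i].

(** Gauss's lemma: multiply the first coefficients outside q. *)
Lemma extension_ideal_prime q : prime_ideal q -> prime_ideal (extension_ideal q).
Proof.
move=> pq; split.
- by move=> i; rewrite coef0; apply: (prime0 pq).
- by move=> a b qa qb i; rewrite coefD; apply: (primeD pq).
- by move=> a b qb i; rewrite coefM; apply: (prime_sum pq) => // j _; apply: (primeM pq).
- by move=> /(_ 0%N); rewrite coef1; apply: (prime1 pq).
- move=> a b qab; apply: contrapT => /not_orP[].
  rewrite /extension_ideal /= => /existsNP exi /existsNP exj.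
  have exi' : exists i, `[< ~ q a`_i >] by case: exi => i; exists i; apply/asboolP.
  have exj' : exists i, `[< ~ q b`_i >] by case: exj => i; exists i; apply/asboolP.
  case: (ex_minnP exi') => i /asboolP nai mini.
  case: (ex_minnP exj') => j /asboolP nbj minj.
  have := qab (i + j)%N; rewrite coefM.
  have lti : (i < (i + j).+1)%N by rewrite ltnS leq_addr.
  rewrite (bigD1 (Ordinal lti)) //= addKn addrC => qs.
  apply: (primeM_notin pq nai nbj); apply: (primeDl pq _ qs).
  apply: (prime_sum pq) => // l /eqP/val_eqP/= nel.
  have [ltli|leil] := ltnP l i.
    rewrite mulrC; apply: (primeM pq) => //; apply: contrapT => nal.
    have /mini : `[< ~ q a`_l >] by apply/asboolP.
    by rewrite leqNgt ltli.
  have ltil : (i < l)%N by rewrite ltn_neqAle eq_sym nel.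
  have ltj : (i + j - l < j)%N.
    by rewrite ltn_subLR ?ltn_add2r // -ltnS.
  apply: (primeM pq) => //; apply: contrapT => nbl.
  have /minj : `[< ~ q b`_(i + j - l) >] by apply/asboolP.
  by rewrite leqNgt ltj.
Qed.

(** Above the denominators of g, R[X]/P is free over R modulo the contraction of P,
    with the powers of X below the degree of g as a basis.  Freeness makes the
    ideal generated by q and P avoid the products of an element outside M and one
    outside q: this is what the two pseudo-divisions check. *)
Lemma going_down P g (q : set R) (M : set {poly R}) :
    prime_ideal P -> prime_ideal q -> prime_ideal M -> P `<=` M ->
    contraction P `<=` q -> q `<=` contraction M ->
    minimal_pol P g -> ~ contraction M (lead_coef g) ->
  exists Q, [/\ prime_ideal Q, P `<=` Q, Q `<=` M & contraction Q = q].
Proof.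
move=> pP pq pM PM Pq qM mg ngM; have [Pg ng minr] := mg.
have g0 := minimal_pol_neq0 pP mg.
have pE := extension_ideal_prime pq.
pose J := [set p | exists u v, [/\ extension_ideal q u, P v & p = u + v]].
pose S := [set p | exists s a, [/\ ~ M s, ~ q a & p = a *: s]].
have EM : extension_ideal q `<=` M.
  by move=> p qp; apply: mem_coefs => // i; apply: qM; apply: qp.
have [|||||p|Q [pQ JQ QS]] := @prime_avoiding {poly R} J S.
- by exists 0, 0; split; rewrite ?addr0//; [apply: (prime0 pE) | apply: (prime0 pP)].
- move=> _ _ [u [v [qu Pv ->]]] [u' [v' [qu' Pv' ->]]].
  exists (u + u'), (v + v'); split; last exact: addrACA.
    exact: (primeD pE).
  exact: (primeD pP).
- move=> a _ [u [v [qu Pv ->]]].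
  exists (a * u), (a * v); split; last exact: mulrDr.
    exact: (primeM pE).
  exact: (primeM pP).
- by exists 1, 1; split; rewrite ?scale1r//; [apply: (prime1 pM) | apply: (prime1 pq)].
- move=> _ _ [s [a [Ms qa ->]]] [s' [a' [Ms' qa' ->]]].
  exists (s * s'), (a * a'); split; [exact: (primeM_notin pM) | exact: (primeM_notin pq)|].
  by rewrite -!mul_polyC polyCM mulrACA.
- move=> [u [v [qu Pv eqp]]] [s [a [nMs nqa eqp']]].
  have [m [c [r [eqr ltr]]]] := pseudo_division s g0.
  have [m' [c' [r' [eqr' Pr']]]] := pseudo_division_mem pP mg Pv.
  set l := lead_coef g in eqr eqr' ngM ng.
  have nql : ~ q l by move=> /qM.
  (* Both ways of writing a * s show that l^m' * a * r is a multiple of g modulo q;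
     as its degree is less than that of g, it is zero modulo q. *)
  have key : extension_ideal q ((l ^+ m' * a) *: r -
     ((l ^+ m)%:P * c' - (l ^+ m' * a)%:P * c) * g).
    have -> : (l ^+ m' * a) *: r -
      ((l ^+ m)%:P * c' - (l ^+ m' * a)%:P * c) * g =
      (l ^+ m * l ^+ m')%:P * u + (l ^+ m)%:P * r'.
      have -> : r = l ^+ m *: s - c * g by rewrite eqr addrAC subrr add0r.
      have -> : r' = l ^+ m' *: v - c' * g by rewrite eqr' addrAC subrr add0r.
      have := eqp'; rewrite eqp => /(canRL (addrK _)) ->.
      rewrite -!mul_polyC !polyCM.
      move: (l ^+ m)%:P (l ^+ m')%:P a%:P => A B D; ring.
    apply: (primeD pE) => //; apply: (primeM pE) => //.
    by move=> i; apply: Pq; apply: Pr'.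
  move: key; set w := _ - _ * c => key.
  have qw : extension_ideal q w.
    (* The last coefficient of w outside q would give, times l, a coefficient of
       w * g outside q, in a degree where r has none. *)
    apply: contrapT => /existsNP exi.
    pose B i := `[< ~ q w`_i >].
    have exB : exists i, B i by case: exi => i ni; exists i; apply/asboolP.
    have ubB i : B i -> (i <= size w)%N.
      move=> /asboolP nwi; rewrite leqNgt; apply/negP => lti; apply: nwi.
      by rewrite nth_default ?(ltnW lti) //; apply: (prime0 pq).
    case: (ex_maxnP exB ubB) => i /asboolP nwi maxi.
    have := key (i + (size g).-1)%N.
    rewrite coefB coefZ [r`__]nth_default ?mulr0 ?sub0r; last first.
      rewrite (leq_trans _ (leq_addl _ _)) // -ltnS prednK //.
      by rewrite size_poly_gt0.
    move=> /(primeN pq); rewrite opprK coefM.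
    have lti : (i < (i + (size g).-1).+1)%N by rewrite ltnS leq_addr.
    rewrite (bigD1 (Ordinal lti)) //= addKn addrC => qs.
    apply: (primeM_notin pq nwi nql); apply: (primeDl pq _ qs).
    apply: (prime_sum pq) => // j /eqP/val_eqP/= nej.
    have [ltij|leji] := ltnP i j.
      rewrite mulrC; apply: (primeM pq) => //; apply: contrapT => nj.
      have /maxi : B j by apply/asboolP.
      by rewrite leqNgt ltij.
    have ltji : (j < i)%N by rewrite ltn_neqAle nej.
    rewrite [g`__]nth_default ?mulr0; first exact: (prime0 pq).
    have le n : (0 < n)%N -> (n <= i + n.-1 - j)%N.
      case: n => // n _; rewrite /= addnC -addnBA ?(ltnW ltji) //.
      by rewrite -addn1 leq_add2l subn_gt0.
    by apply: le; rewrite size_poly_gt0.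
  have qr : extension_ideal q r.
    move=> i.
    have : extension_ideal q ((l ^+ m' * a) *: r).
      apply: (primeDl pE (a := - (w * g))); last by rewrite addrC.
      by apply: (primeN pE) => //; rewrite mulrC; apply: (primeM pE).
    move=> /(_ i); rewrite coefZ => /(primeP pq)[] //.
    by move=> /(primeP pq)[] // /(primeX pq).
  have : M (l ^+ m *: s).
    by rewrite eqr; apply: (primeD pM) => //; [apply: (primeM pM) => //; apply: PM | apply: EM].
  exact: contraction_notin_scale.
- have PQ : P `<=` Q.
    by move=> v Pv; apply: JQ; exists 0, v; split; rewrite ?add0r//; apply: (prime0 pE).
  exists Q; split=> //.
  + move=> s Qs; apply: contrapT => nMs; apply: (QS _ Qs).
    by exists s, 1; split; rewrite ?scale1r//; apply: (prime1 pq).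
  + apply/seteqP; split=> a.
      move=> Qa; apply: contrapT => nqa; apply: (QS _ Qa).
      by exists 1, a; split; [apply: (prime1 pM) | | rewrite -mul_polyC mulr1].
    move=> qa; apply: JQ; exists a%:P, 0; split; rewrite ?addr0//; last exact: (prime0 pP).
    by move=> i; rewrite coefC; case: eqP => // _; apply: (prime0 pq).
Qed.

End OneVariable.

(** * Iterated polynomial rings and tangent vectors *)

Section Tower.
Variable k : fieldType.

(** Polynomials in n variables, built one variable at a time, so that an induction
    on the number of variables is an application of the one-variable theory over
    an integral domain. *)
Fixpoint tow (n : nat) : idomainType := if n is m.+1 then {poly (tow m)} else k.

Section Hom.
Variables (R : comNzRingType) (i : {rmorphism k -> R}) (x : nat -> R).

Fixpoint towhom (n : nat) : {rmorphism tow n -> R} :=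
  match n with
  | 0 => i
  | m.+1 => @horner_morph (tow m) R (towhom m) (x m) (fun a => mulrC _ _)
  end.

Lemma towhomE n (p : {poly (tow n)}) : towhom n.+1 p = (map_poly (towhom n) p).[x n].
Proof. by []. Qed.

Lemma towhomC n (a : tow n) : towhom n.+1 (a%:P : {poly (tow n)}) = towhom n a.
Proof. by rewrite towhomE map_polyC hornerC. Qed.

Lemma towhomX n : towhom n.+1 ('X : {poly (tow n)}) = x n.
Proof. by rewrite towhomE map_polyX hornerX. Qed.

Lemma towhom_cons n (p : {poly (tow n)}) (a : tow n) :
  towhom n.+1 (p * 'X + a%:P : {poly (tow n)}) = towhom n.+1 p * x n + towhom n a.
Proof. by rewrite towhomE rmorphD rmorphM /= map_polyX map_polyC hornerMXaddC. Qed.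

End Hom.

Lemma towhom_morph (R R' : comNzRingType) (f : {rmorphism R -> R'})
    (i : {rmorphism k -> R}) (i' : {rmorphism k -> R'})
    (x : nat -> R) (x' : nat -> R') n :
    (forall a, f (i a) = i' a) -> (forall j, (j < n)%N -> f (x j) = x' j) ->
  forall p : tow n, f (towhom i x n p) = towhom i' x' n p.
Proof.
move=> fi; elim: n => [|n IHn] fx p; first exact: fi.
elim/poly_ind: p => [|p c IHp]; first by rewrite !rmorph0.
rewrite !towhom_cons rmorphD rmorphM /= IHp fx // IHn // => j ltj.
by apply: fx; apply: ltnW.
Qed.

Fixpoint towC n : {rmorphism k -> tow n} :=
  match n with
  | 0 => (idfun : {rmorphism k -> k})
  | m.+1 => ((@polyC (tow m)) \o (towC m) : {rmorphism k -> {poly (tow m)}})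
  end.

Fixpoint var n (i : nat) : tow n :=
  match n with
  | 0 => 0
  | m.+1 => (if i == m then 'X else (var m i)%:P : {poly (tow m)})
  end.

Lemma towhom_towC (R : comNzRingType) (i : {rmorphism k -> R}) x n a :
  towhom i x n (towC n a) = i a.
Proof. by elim: n => //= n IHn; rewrite [LHS]towhomC. Qed.

Lemma towhom_var (R : comNzRingType) (i : {rmorphism k -> R}) x n j :
  (j < n)%N -> towhom i x n (var n j) = x j.
Proof.
elim: n => // n IHn; rewrite ltnS leq_eqVlt /=.
case: eqP => [-> _|_ /= ltjn]; first exact: towhomX.
by rewrite -IHn // [LHS]towhomC.
Qed.

(** Points have infinitely many coordinates, of which polynomials in n variables
    use the first n; this spares casts between dimensions. *)
Definition point := nat -> k.
Definition ev (x : point) n : {rmorphism tow n -> k} :=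
  towhom (idfun : {rmorphism k -> k}) x n.
(** The restriction of a polynomial to the line through x in the direction v; its
    coefficient of degree 1 is the directional derivative. *)
Definition jet (x v : point) n : {rmorphism tow n -> {poly k}} :=
  towhom (@polyC k : {rmorphism k -> {poly k}}) (fun i => (x i)%:P + v i *: 'X) n.

Arguments towhom : simpl never.
Arguments ev : simpl never.
Arguments jet : simpl never.

Lemma ev_ext x y n (p : tow n) : (forall j, (j < n)%N -> x j = y j) ->
  ev x n p = ev y n p.
Proof.
by move=> xy; apply: (@towhom_morph k k (idfun : {rmorphism k -> k})).
Qed.

Lemma evC x n (a : tow n) : ev x n.+1 (a%:P : {poly (tow n)}) = ev x n a.
Proof. exact: towhomC. Qed.

Lemma jetC x v n (a : tow n) : jet x v n.+1 (a%:P : {poly (tow n)}) = jet x v n a.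
Proof. exact: towhomC. Qed.

Lemma jet0 x v n (p : tow n) : (jet x v n p)`_0 = ev x n p.
Proof.
rewrite -horner_coef0; apply: (towhom_morph (f := horner_eval 0)) => [a|j _].
  by rewrite /= /horner_eval hornerC.
by rewrite /= /horner_eval hornerD hornerZ hornerX hornerC mulr0 addr0.
Qed.

Lemma jet_horner x v n (p : tow n) t :
  (jet x v n p).[t] = ev (fun i => x i + t * v i) n p.
Proof.
apply: (towhom_morph (f := horner_eval t)) => [a|j _].
  by rewrite /= /horner_eval hornerC.
by rewrite /= /horner_eval hornerD hornerZ hornerX hornerC mulrC.
Qed.

Lemma jet_ext x y v w n (p : tow n) : (forall j, (j < n)%N -> x j = y j) ->
  (forall j, (j < n)%N -> v j = w j) -> jet x v n p = jet y w n p.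
Proof.
move=> xy vw; apply: (towhom_morph (f := (idfun : {rmorphism {poly k} -> {poly k}}))) => //= j ltj.
by rewrite xy ?vw.
Qed.

Lemma coef1M (F G : {poly k}) : (F * G)`_1 = F`_0 * G`_1 + F`_1 * G`_0.
Proof. by rewrite coefM big_ord_recl big_ord1. Qed.

Lemma jet_cons1 x v n (p : {poly (tow n)}) (a : tow n) :
  (jet x v n.+1 (p * 'X + a%:P : {poly (tow n)}))`_1 =
  ev x n.+1 p * v n + (jet x v n.+1 p)`_1 * x n + (jet x v n a)`_1.
Proof.
rewrite -[ev x n.+1 p](jet0 x v) [jet _ _ _ _]towhom_cons -/(jet x v n.+1 p) -/(jet x v n a).
move: (jet x v n.+1 p) (jet x v n a) => F G.
by rewrite coefD coef1M !coefD !coefZ !coefX !coefC /= !mulr0 addr0 mulr1 add0r.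
Qed.

(** The second part isolates the dependence on the last coordinate of v: its factor
    is the partial derivative in the last variable. *)
Lemma jet_linear_aux x n :
  (forall p : tow n, exists w : point, forall v,
     (jet x v n p)`_1 = \sum_(i < n) w i * v i) /\
  (forall p : {poly (tow n)}, exists w : point, forall v,
     (jet x v n.+1 p)`_1 = \sum_(i < n) w i * v i + ev x n.+1 (p^`() : {poly (tow n)}) * v n).
Proof.
have step m : (forall p : tow m, exists w : point, forall v,
     (jet x v m p)`_1 = \sum_(i < m) w i * v i) ->
   forall p : {poly (tow m)}, exists w : point, forall v,
     (jet x v m.+1 p)`_1 = \sum_(i < m) w i * v i + ev x m.+1 (p^`() : {poly (tow m)}) * v m.
  move=> IH p; elim/poly_ind: p => [|p c [w IHp]].
    exists (fun=> 0) => v; rewrite !raddf0 coef0 mul0r addr0 big1 // => i _.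
    by rewrite mul0r.
  have [w' IHc] := IH c.
  exists (fun i => x m * w i + w' i) => v.
  rewrite jet_cons1 IHp IHc derivMXaddC addrC.
  have -> : ev x m.+1 (p + p^`() * 'X : {poly (tow m)}) =
      ev x m.+1 p + ev x m.+1 (p^`() : {poly (tow m)}) * x m.
    by rewrite (rmorphD (ev x m.+1)) (rmorphM (ev x m.+1)); congr (_ + _ * _); exact: towhomX.
  have -> : \sum_(i < m) (x m * w i + w' i) * v i =
    x m * (\sum_(i < m) w i * v i) + \sum_(i < m) w' i * v i.
    by rewrite mulr_sumr -big_split /=; apply: eq_bigr => i _; rewrite mulrDl mulrA.
  by ring.
have all m : forall p : tow m, exists w : point, forall v,
    (jet x v m p)`_1 = \sum_(i < m) w i * v i.
  elim: m => [|m IHm] p.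
    by exists (fun=> 0) => v; rewrite big_ord0 [jet _ _ _ _]/= coefC.
  have [w wP] := step m IHm p.
  exists (fun i => if (i < m)%N then w i else ev x m.+1 ((p : {poly (tow m)})^`() : {poly (tow m)})) => v.
  rewrite wP big_ord_recr /= ltnn; congr (_ + _).
  by apply: eq_bigr => i _; rewrite ltn_ord.
by split; [exact: all | apply: step; exact: all].
Qed.

Lemma jet_linear x n (p : tow n) : exists w : point, forall v,
  (jet x v n p)`_1 = \sum_(i < n) w i * v i.
Proof. by case: (jet_linear_aux x n). Qed.

Lemma jet_linearS x n (p : {poly (tow n)}) : exists w : point, forall v,
  (jet x v n.+1 p)`_1 = \sum_(i < n) w i * v i + ev x n.+1 (p^`() : {poly (tow n)}) * v n.
Proof. by case: (jet_linear_aux x n). Qed.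

(** The number of variables that are transcendental modulo P over the previous ones,
    hence the dimension of the zero set of P. *)
Fixpoint tdim n : set (tow n) -> nat :=
  match n with
  | 0 => fun _ => 0
  | m.+1 => fun P : set {poly (tow m)} => (tdim (contraction P) + ~~ `[< algebraic P >])%N
  end.

Definition minpol (R : idomainType) (P : set {poly R}) : {poly R} :=
  xget 0 [set g | minimal_pol P g].

Lemma minpolP (R : idomainType) (P : set {poly R}) : prime_ideal P ->
  algebraic P -> minimal_pol P (minpol P).
Proof.
move=> pP /(minimal_pol_exists pP)[g mg]; rewrite /minpol.
by case: xgetP => [h -> //|no]; case: (no g).
Qed.

(** The initials and separants of the triangular set of P do not vanish at x. *)
Fixpoint nondegenerate n : set (tow n) -> point -> Prop :=
  match n with
  | 0 => fun _ _ => True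
  | m.+1 => fun P x => nondegenerate (contraction (P : set {poly (tow m)})) x /\
      (algebraic P -> ev x m (lead_coef (minpol P)) != 0 /\
                      ev x m.+1 ((minpol P)^`() : {poly (tow m)}) != 0)
  end.

Definition zeros n (P : set (tow n)) : set point := [set x | forall p, P p -> ev x n p = 0].

Definition tangent_vec n (P : set (tow n)) (x v : point) :=
  forall p, P p -> (jet x v n p)`_1 = 0.

Lemma zerosC n (P : set {poly (tow n)}) x :
  zeros (P : set (tow n.+1)) x -> zeros (contraction P) x.
Proof. by move=> Px p Pp; rewrite -evC; apply: Px. Qed.

(** The tangent space of P at x has the d points E i as a basis; only their first n
    coordinates matter. *)
Definition tangent_basis n (P : set (tow n)) (x : point) (d : nat) :=
  exists E : nat -> point,
    (forall c : point, (forall j, (j < n)%N -> \sum_(i < d) c i * E i j = 0) ->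
       forall i, (i < d)%N -> c i = 0) /\
    forall v, tangent_vec P x v <->
      exists c : point, forall j, (j < n)%N -> v j = \sum_(i < d) c i * E i j.

(** Divisibility by the square of the variable: with coefficients of degree 0 and 1
    both zero, tangency becomes an ideal condition. *)
Definition order2 (F : {poly k}) := F`_0 = 0 /\ F`_1 = 0.

Lemma order2D (F G : {poly k}) : order2 F -> order2 G -> order2 (F + G).
Proof. by move=> [F0 F1] [G0 G1]; split; rewrite coefD ?F0 ?G0 ?F1 ?G1 addr0. Qed.

Lemma order2M (F G : {poly k}) : order2 G -> order2 (F * G).
Proof.
by move=> [G0 G1]; split; rewrite ?coef1M ?coef0M G0 ?G1 ?mulr0 ?addr0.
Qed.

Lemma order2_cancel (F G : {poly k}) : F`_0 != 0 -> order2 (F * G) -> order2 G.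
Proof.
move=> F0 []; rewrite coef1M coef0M => /eqP; rewrite mulf_eq0 (negbTE F0) /= => /eqP G0.
rewrite G0 mulr0 addr0 => /eqP; rewrite mulf_eq0 (negbTE F0) /= => /eqP G1.
by split.
Qed.

Lemma tangent_vec_order2 n (P : set (tow n)) x v : zeros P x ->
  tangent_vec P x v <-> forall p, P p -> order2 (jet x v n p).
Proof.
move=> Px; split=> [tv p Pp|tv p /tv[]//]; split; last exact: tv.
by rewrite jet0 Px.
Qed.

Lemma order2_coefs x v n (r : {poly (tow n)}) :
  (forall i, order2 (jet x v n r`_i)) -> order2 (jet x v n.+1 r).
Proof.
move=> sr; rewrite -[r]coefK poly_def rmorph_sum /=.
apply: (big_ind order2); [by split; rewrite coef0 | exact: order2D |].
move=> i _; rewrite -mul_polyC rmorphM mulrC; apply: order2M.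
by rewrite jetC.
Qed.

(** At a nondegenerate zero one equation, that of g, cuts out the tangent space of P
    in the tangent space of its contraction; the other elements of P follow by
    pseudo-division. *)
Lemma tangent_vec_step n (P : set {poly (tow n)}) g x v :
    prime_ideal P -> zeros (P : set (tow n.+1)) x -> minimal_pol P g ->
    ev x n (lead_coef g) != 0 ->
  tangent_vec (P : set (tow n.+1)) x v <->
  tangent_vec (contraction P) x v /\ (jet x v n.+1 g)`_1 = 0.
Proof.
move=> pP Px mg lg; have [Pg ng _] := mg; split.
  by move=> tv; split=> [p Pp|]; [rewrite -jetC; apply: tv | apply: tv].
move=> [tv tg]; apply/tangent_vec_order2 => // f Pf.
have [m [q [r [eqr Pr]]]] := pseudo_division_mem pP mg Pf.
apply: (@order2_cancel (jet x v n.+1 ((lead_coef g ^+ m)%:P : {poly (tow n)}))).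
  by rewrite jet0 evC rmorphXn expf_neq0.
rewrite -rmorphM mul_polyC eqr rmorphD rmorphM; apply: order2D.
  by apply: order2M; split=> //; rewrite jet0 Px.
apply: order2_coefs => i; have /tangent_vec_order2 := tv; apply; first exact: zerosC.
exact: Pr.
Qed.

Lemma tangent_vec_step_trans n (P : set {poly (tow n)}) x v :
    prime_ideal P -> zeros (P : set (tow n.+1)) x -> ~ algebraic P ->
  tangent_vec (P : set (tow n.+1)) x v <-> tangent_vec (contraction P) x v.
Proof.
move=> pP Px nalg; split; first by move=> tv p Pp; rewrite -jetC; apply: tv.
move=> tv; apply/tangent_vec_order2 => // f Pf.
apply: order2_coefs => i; have /tangent_vec_order2 := tv; apply; first exact: zerosC.
exact: transcendental_coef.
Qed.

(** A transcendental variable adds a free coordinate; for an algebraic one, the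
    separant determines the last coordinate of a tangent vector from the others. *)
Lemma nondegenerate_tangent_basis n (P : set (tow n)) x :
  prime_ideal P -> zeros P x -> nondegenerate P x -> tangent_basis P x (tdim P).
Proof.
elim: n P => [|n IHn] P pP Px gx.
  exists (fun _ _ => 0); split=> [c _ //|v]; split=> [_|_ p Pp]; first by exists (fun=> 0).
  by rewrite [jet _ _ _ _]/= coefC.
have pcP : prime_ideal (contraction (P : set {poly (tow n)})) by exact: contraction_prime.
have [E [fE EP]] := IHn _ pcP (zerosC Px) gx.1.
set d := tdim _ in fE EP.
rewrite /= -/d; case: asboolP => [algP|nalg]; last first.
  rewrite addn1.
  pose E1 i j := if (i < d)%N then (if (j < n)%N then E i j else 0) else (j == n)%:R : k.
  have E1lt (c : point) j : (j < n)%N ->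
      \sum_(i < d.+1) c i * E1 i j = \sum_(i < d) c i * E i j.
    move=> ltj; rewrite big_ord_recr /= {2}/E1 ltnn ltn_eqF // mulr0 addr0.
    by apply: eq_bigr => i _; rewrite /E1 ltn_ord ltj.
  have E1eq (c : point) : \sum_(i < d.+1) c i * E1 i n = c d.
    rewrite big_ord_recr /= {2}/E1 ltnn eqxx mulr1 big1 ?add0r // => i _.
    by rewrite /E1 ltn_ord ltnn mulr0.
  exists E1; split=> [c c0 i|v].
    rewrite ltnS leq_eqVlt => /orP[/eqP->|]; first by rewrite -E1eq c0.
    by apply: fE => j ltj; rewrite -E1lt // c0 // ltnW.
  rewrite tangent_vec_step_trans // EP; split=> -[c cP].
    pose c' i := if (i < d)%N then c i else v n; exists c' => j.
    rewrite ltnS leq_eqVlt => /orP[/eqP->|ltj]; first by rewrite (E1eq c') /c' ltnn.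
    by rewrite (E1lt c') // cP //; apply: eq_bigr => i _; rewrite /c' ltn_ord.
  by exists c => j ltj; rewrite cP ?E1lt // ltnW.
have mg := minpolP pP algP; have [lg g'] := gx.2 algP.
set g := minpol _ in mg lg g'.
have [w wP] := jet_linearS x g.
rewrite addn0; set g1 := ev x _ _ in g' wP.
pose last (v : point) := - (\sum_(l < n) w l * v l) / g1.
pose E1 i j := if (j < n)%N then E i j else last (E i).
have lastP (v : point) : (jet x v n.+1 g)`_1 = 0 <-> v n = last v.
  rewrite wP /last; split=> [/(canRL (addrK _))|->].
    by rewrite sub0r => ->; rewrite opprK mulrAC mulfV ?mul1r.
  by rewrite mulrCA mulfV // mulr1 subrr.
have last_sum (c : point) v : (forall j, (j < n)%N -> v j = \sum_(i < d) c i * E i j) ->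
    last v = \sum_(i < d) c i * E1 i n.
  move=> vE; rewrite /last /E1 ltnn /last.
  under eq_bigr => l _ do rewrite vE //.
  under [RHS]eq_bigr => i _ do rewrite mulrA mulrN.
  rewrite -mulr_suml sumrN; congr (- _ / _).
  under eq_bigr => l _ do rewrite mulr_sumr.
  rewrite exchange_big /=; apply: eq_bigr => i _; rewrite mulr_sumr.
  by apply: eq_bigr => l _; rewrite mulrCA.
exists E1; split=> [c c0|v].
  apply: fE => j ltj; rewrite -[RHS](c0 j (ltnW ltj)).
  by apply: eq_bigr => i _; rewrite /E1 ltj.
rewrite (tangent_vec_step _ pP Px mg lg) EP lastP; split=> [[[c cP] vn]|[c cP]].
  exists c => j; rewrite ltnS leq_eqVlt => /orP[/eqP->|ltj].
    by rewrite vn (last_sum _ _ cP).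
  by rewrite cP // /E1 ltj.
have cP' j : (j < n)%N -> v j = \sum_(i < d) c i * E i j.
  by move=> ltj; rewrite (cP _ (ltnW ltj)); apply: eq_bigr => i _; rewrite /E1 ltj.
by split; [exists c | rewrite (last_sum _ _ cP') cP].
Qed.

End Tower.

(** * Nondegenerate zeros of a prime ideal *)

Section ClosedField.
Variable k : closedFieldType.
Hypothesis char0 : [pchar k] =i pred0.

Lemma tow_char0 n (P : set (tow k n)) : prime_ideal P -> forall m, ~ P m.+1%:R.
Proof.
move=> pP m Pm; apply: (prime1 pP).
have m0 : m.+1%:R != 0 :> k by rewrite ((pcharf0P k).1 char0).
rewrite -[1](rmorph1 (towC k n)) -(mulVf m0) rmorphM rmorph_nat.
exact: (primeM pP).
Qed.

Lemma nondegenerate_open n (P : set (tow k n)) : prime_ideal P ->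
  exists h, ~ P h /\ forall x, ev x n h != 0 -> nondegenerate P x.
Proof.
elim: n P => [|n IHn] P pP; first by exists 1; split; first exact: (prime1 pP).
have pcP : prime_ideal (contraction (P : set {poly (tow k n)})) by exact: contraction_prime.
have [h [nh hP]] := IHn _ pcP.
have [algP|nalg] := pselect (algebraic (P : set {poly (tow k n)})); last first.
  by exists (h%:P : {poly (tow k n)}); split=> // x; rewrite evC => /hP.
have mg := minpolP pP algP; have [_ ng _] := mg.
exists ((h * lead_coef (minpol (P : set {poly (tow k n)})))%:P *
  (minpol (P : set {poly (tow k n)}))^`() : {poly (tow k n)}).
split.
  apply: (primeM_notin pP); first exact: (primeM_notin pcP).
  by apply: minimal_pol_deriv => //; apply: tow_char0.
move=> x; rewrite (rmorphM (ev x n.+1)) mulf_eq0 negb_or evC => /andP[].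
by rewrite (rmorphM (ev x n)) mulf_eq0 negb_or => /andP[/hP gx lg] g'.
Qed.

(** Over an algebraically closed field g splits, and each of its linear factors
    divides h. *)
Lemma dvdp_exp_of_roots (g h : {poly k}) (n : nat) : g != 0 -> (size g <= n)%N ->
  (forall c, root g c -> root h c) -> g %| h ^+ n.
Proof.
move=> g0 sg gh; have [r gr] := closed_field_poly_normal g.
have lg : lead_coef g != 0 by rewrite lead_coef_eq0.
rewrite gr dvdpZl //.
have rh : all (root h) r.
  apply/allP => c cr; apply: gh; rewrite gr rootZ //.
  by rewrite root_prod_XsubC.
have sr : (size r <= n)%N.
  by move: sg; rewrite gr size_scale // size_prod_XsubC; apply: ltnW.
rewrite -(subnK sr) exprD; apply: dvdp_mull.
elim: r rh {gr sr} => [|c r IHr] /=; first by rewrite big_nil dvd1p.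
by move=> /andP[hc /IHr rh]; rewrite big_cons exprS dvdp_mul // dvdp_XsubCl.
Qed.

(** If X is algebraic, a point above e where h does not vanish is a root of g that
    is not a root of h.  It exists as soon as g does not divide a power of h after
    evaluation, which is ensured by one nonzero coefficient of the remainder of
    that power by g. *)
Lemma lift_avoiding (R : idomainType) (P : set {poly R}) (h : {poly R}) :
    prime_ideal P -> ~ P h ->
  exists h', ~ contraction P h' /\
    forall (e : {rmorphism R -> k}), (forall a, contraction P a -> e a = 0) ->
      e h' != 0 ->
      exists c, (forall p, P p -> (map_poly e p).[c] = 0) /\
                (map_poly e h).[c] != 0.
Proof.
move=> pP nh; have [algP|nalg] := pselect (algebraic P); last first.
  have /existsNP [i hi] : ~ forall i, contraction P h`_i.
    by move=> /(mem_coefs pP).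
  exists h`_i; split=> // e eP ei.
  have h0 : map_poly e h != 0.
    by apply: contraNneq ei => /polyP/(_ i); rewrite coef_map coef0 => ->.
  have /closed_nonrootP[c hc] := h0; exists c; split=> // p Pp.
  rewrite [map_poly e p](_ : _ = 0) ?horner0 //.
  apply/polyP => j; rewrite coef_map coef0 /= eP //.
  exact: transcendental_coef.
have [g mg] := minimal_pol_exists pP algP; have [Pg ng minr] := mg.
have g0 := minimal_pol_neq0 pP mg.
have pcP := contraction_prime pP.
have [m [q [r [eqr ltr]]]] := pseudo_division (h ^+ size g) g0.
have nr : ~ P r.
  move=> Pr; apply: (@contraction_notin_scale _ _ pP _ (h ^+ size g) ng _ m).
    by move=> /(primeX pP)/nh.
  by rewrite eqr; apply: (primeD pP) => //; apply: (primeM pP).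
have /existsNP [i ri] : ~ forall i, contraction P r`_i by move=> /(mem_coefs pP).
exists (lead_coef g * r`_i); split; first exact: (primeM_notin pcP).
move=> e eP; rewrite rmorphM mulf_eq0 negb_or => /andP[eg er].
have sg : size (map_poly e g) = size g by rewrite size_map_poly_id0.
have [c [gc hc]] : exists c, root (map_poly e g) c /\ ~~ root (map_poly e h) c.
  apply: contrapT => no.
  have eg0 : map_poly e g != 0 by rewrite -size_poly_eq0 sg size_poly_eq0.
  have /(dvdp_exp_of_roots eg0 (eq_leq sg)) : forall c, root (map_poly e g) c -> root (map_poly e h) c.
    by move=> c gc; apply: contrapT => /negP hc; apply: no; exists c.
  rewrite -(rmorphXn (map_poly e)) => dv.
  have /dvdp_leq : map_poly e g %| map_poly e r.
    have := congr1 (map_poly e) eqr; rewrite rmorphD rmorphM /= => /esym.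
    rewrite -mul_polyC rmorphM => /(canRL (addKr _)) ->.
    by rewrite addrC dvdp_sub ?dvdp_mull.
  rewrite sg => /(_ _)/leq_trans/(_ (size_poly _ _)); rewrite leqNgt ltr => le.
  suff : false by [].
  apply: le; apply: contraNneq er => /polyP/(_ i).
  by rewrite coef_map coef0 => ->.
exists c; split=> // p Pp.
have [m' [q' [r' [eqr' Pr']]]] := pseudo_division_mem pP mg Pp.
have := congr1 (fun f => (map_poly e f).[c]) eqr'.
rewrite -mul_polyC rmorphM rmorphD rmorphM /= map_polyC /= hornerD !hornerM hornerC.
rewrite (rootP gc) mulr0 add0r.
have -> : map_poly e r' = 0.
  by apply/polyP => j; rewrite coef_map coef0 /= eP.
rewrite horner0 rmorphXn => /eqP; rewrite mulf_eq0 expf_eq0 (negbTE eg) andbF.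
by move=> /eqP.
Qed.

Definition set_coord (x : point k) n c : point k := fun i => if i == n then c else x i.

Lemma ev_set_coord x n c (p : {poly (tow k n)}) :
  ev (set_coord x n c) n.+1 p = (map_poly (ev x n) p).[c].
Proof.
rewrite [LHS]towhomE /set_coord eqxx; congr (_.[_]); apply: eq_map_poly => a.
by apply: ev_ext => j ltj; rewrite ltn_eqF.
Qed.

Lemma zeros_lift_step n (P : set {poly (tow k n)}) (h : {poly (tow k n)}) :
    prime_ideal P -> ~ P h ->
  exists h', ~ contraction P h' /\
    forall x, zeros (contraction P) x -> ev x n h' != 0 ->
      exists y, [/\ forall i, (i < n)%N -> y i = x i, zeros (P : set (tow k n.+1)) y
                 & ev y n.+1 h != 0].
Proof.
move=> pP nh; have [h' [nh' h'P]] := lift_avoiding pP nh.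
exists h'; split=> // x xP xh'; have [c [cP ch]] := h'P (ev x n) xP xh'.
exists (set_coord x n c); split.
- by move=> i lti; rewrite /set_coord ltn_eqF.
- by move=> p Pp; rewrite ev_set_coord cP.
- by rewrite ev_set_coord.
Qed.

(** Lift the empty point one variable at a time. *)
Lemma nullstellensatz n (P : set (tow k n)) h : prime_ideal P -> ~ P h ->
  exists x, zeros P x /\ ev x n h != 0.
Proof.
elim: n P h => [|n IHn] P h pP nh.
  exists (fun=> 0); split=> [a Pa|].
    have [-> //|a0] := eqVneq (a : k) 0; case: (prime1 pP).
    by rewrite -[1](mulVf (a0 : (a : k) != 0)); apply: (primeM pP).
  by apply/eqP => h0; apply: nh; rewrite [h](h0 : h = 0); apply: (prime0 pP).
have [h' [nh' h'P]] := zeros_lift_step pP nh.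
have [x [xP xh']] := IHn _ _ (contraction_prime pP) nh'.
by have [y [_ yP yh]] := h'P x xP xh'; exists y.
Qed.

Section Family.
Variable P : forall n, set (tow k n).
Arguments P : clear implicits.
Hypothesis pP : forall n, prime_ideal (P n).
Hypothesis coh : forall n, contraction (P n.+1 : set {poly (tow k n)}) = P n.

(** Chevalley's theorem on images, for a projection forgetting the last m variables. *)
Lemma zeros_lift w m (h : tow k (m + w)) : ~ P _ h ->
  exists h', ~ P w h' /\
    forall x, zeros (P w) x -> ev x w h' != 0 ->
      exists y, [/\ forall i, (i < w)%N -> y i = x i, zeros (P (m + w)) y
                 & ev y (m + w) h != 0].
Proof.
elim: m h => [|m IHm] h nh; first by exists h; split=> // x xP xh; exists x.
have [h1 [nh1 h1P]] := zeros_lift_step (pP (m + w).+1) nh.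
rewrite coh in nh1 h1P; have [h2 [nh2 h2P]] := IHm _ nh1.
exists h2; split=> // x xP xh2; have [y [yx yP yh1]] := h2P x xP xh2.
have [z [zy zP zh]] := h1P y yP yh1; exists z; split=> // i lti.
by rewrite zy ?yx // (leq_trans lti) // leq_addl.
Qed.

(** The equations of P relative to the first w variables: near x they generate P over
    the zeros of the ideal of the first w variables, and their differentials in
    the last m variables are independent. *)
Definition locally_generated w m x :=
  exists c (g : 'I_c -> tow k (m + w)),
  [/\ forall i, P _ (g i),
      forall f, P (m + w) f -> exists h (q : 'I_c -> tow k (m + w)),
        ev x (m + w) h != 0 /\ forall y, zeros (P w) y ->
          ev y (m + w) h * ev y (m + w) f = \sum_(i < c) ev y (m + w) (q i) * ev y (m + w) (g i)
    & forall a : 'I_c -> k,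
        (forall v, (forall i, (i < w)%N -> v i = 0) ->
          \sum_(i < c) a i * (jet x v (m + w) (g i))`_1 = 0) ->
        forall i, a i = 0].

(** The triangular set itself, without its members in the first w variables.  The
    Jacobian matrix in the last m variables is triangular, with the separants on
    the diagonal. *)
Lemma nondegenerate_locally_generated w m x :
  nondegenerate (P (m + w)) x -> locally_generated w m x.
Proof.
elim: m => [|m IHm] gx.
  exists 0%N, (fun=> 0); split=> [[]//|f Pf|a _ []//].
  exists 1, (fun=> 0); rewrite rmorph1 oner_neq0; split=> // y yP.
  by rewrite big_ord0 (yP _ Pf) mulr0.
have [gx1 gx2] := gx; rewrite coh in gx1.
have [c [g [Pg gen indep]]] := IHm gx1.
set n := (m + w)%N in gx gx1 gx2 g Pg gen indep.
have coefs_gen (f : {poly (tow k n)}) : (forall i, P n f`_i) ->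
    exists (H : tow k n) (q : 'I_c -> tow k n.+1), ev x n H != 0 /\
      forall y, zeros (P w) y -> ev y n H * ev y n.+1 f =
        \sum_(j < c) ev y n.+1 (q j) * ev y n (g j).
  move=> Pfi.
  have /choice [hq hqP] : forall i, exists hq : tow k n * ('I_c -> tow k n),
      ev x n hq.1 != 0 /\ forall y, zeros (P w) y ->
      ev y n hq.1 * ev y n f`_i = \sum_(j < c) ev y n (hq.2 j) * ev y n (g j).
    by move=> i; have [h [q hqP]] := gen _ (Pfi i); exists (h, q).
  pose N := size f.
  pose H' (i : 'I_N) := \prod_(j < N | j != i) (hq j).1.
  exists (\prod_(i < N) (hq i).1),
    (fun j => \sum_(i < N) (H' i * (hq i).2 j) *: 'X^i : {poly (tow k n)}).
  split; first by rewrite rmorph_prod; apply/prodf_neq0 => i _; case: (hqP i).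
  move=> y yP.
  have evf (u : 'I_N -> tow k n) : ev y n.+1 (\sum_(i < N) u i *: 'X^i : {poly (tow k n)}) =
      \sum_(i < N) ev y n (u i) * y n ^+ i.
    rewrite (rmorph_sum (ev y n.+1)); apply: eq_bigr => i _.
    rewrite -mul_polyC (rmorphM (ev y n.+1)) evC (rmorphXn (ev y n.+1)).
    by congr (_ * _ ^+ _); apply: towhomX.
  have -> : ev y n.+1 f = \sum_(i < N) ev y n f`_i * y n ^+ i.
    by rewrite -evf -poly_def coefK.
  have -> : ev y n (\prod_(i < N) (hq i).1) * (\sum_(i < N) ev y n f`_i * y n ^+ i) =
     \sum_(i < N) \sum_(j < c) (ev y n (H' i) * ev y n ((hq i).2 j) * y n ^+ i) * ev y n (g j).
    rewrite mulr_sumr; apply: eq_bigr => i _; have [_ hqi] := hqP i.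
    rewrite (bigD1 i) //= -/(H' i) rmorphM mulrACA hqi // mulr_suml.
    by apply: eq_bigr => j _; ring.
  rewrite exchange_big /=; apply: eq_bigr => j _; rewrite evf mulr_suml.
  by apply: eq_bigr => i _; rewrite rmorphM.
have [algP|nalg] := pselect (algebraic (P n.+1 : set {poly (tow k n)})); last first.
  exists c, (fun i => (g i)%:P : {poly (tow k n)}); split.
  - by move=> i; have := Pg i; rewrite -coh.
  - move=> f Pf; have [|H [q [Hx Hq]]] := coefs_gen f.
      by move=> i; rewrite -coh; apply: (transcendental_coef (pP n.+1) nalg).
    exists (H%:P : {poly (tow k n)}), q; rewrite evC; split=> // y yP.
    by rewrite evC Hq //; apply: eq_bigr => j _; rewrite evC.
  - move=> a aP; apply: indep => v v0; rewrite -[RHS](aP v v0).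
    by apply: eq_bigr => i _; rewrite jetC.
have mg := minpolP (pP n.+1) algP; have [lg g'] := gx2 algP.
set G := minpol _ in mg lg g'; have [PG nG _] := mg.
pose gg i := if unlift ord_max i is Some j then (g j)%:P else G : {poly (tow k n)}.
have widenE (i : 'I_c) : widen_ord (leqnSn c) i = lift ord_max i.
  by apply: val_inj; rewrite /= [RHS]lift_max.
have ggmax : gg ord_max = G by rewrite /gg unlift_none.
have gglift i : gg (lift ord_max i) = (g i)%:P by rewrite /gg liftK.
exists c.+1, gg; split.
- by move=> i; rewrite /gg; case: (unlift _ i) => [j|//]; have := Pg j; rewrite -coh.
- move=> f Pf; have [m' [q [r [eqr Pr]]]] := pseudo_division_mem (pP n.+1) mg Pf.
  have [|H [qs [Hx Hq]]] := coefs_gen r; first by move=> i; rewrite -coh.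
  exists ((H * lead_coef G ^+ m')%:P : {poly (tow k n)}).
  pose qq i := if unlift ord_max i is Some j then qs j else H%:P * q : {poly (tow k n)}.
  have qqmax : qq ord_max = H%:P * q by rewrite /qq unlift_none.
  have qqlift i : qq (lift ord_max i) = qs i by rewrite /qq liftK.
  exists qq.
  split; first by rewrite evC rmorphM rmorphXn mulf_neq0 // expf_neq0.
  move=> y yP; rewrite big_ord_recr ggmax qqmax evC rmorphM.
  have -> : ev y n H * ev y n (lead_coef G ^+ m') * ev y n.+1 f =
     ev y n H * ev y n.+1 (q * G + r : {poly (tow k n)}).
    by rewrite -eqr -mul_polyC (rmorphM (ev y n.+1)) evC mulrA.
  rewrite (rmorphD (ev y n.+1)) mulrDr Hq // [LHS]addrC; congr (_ + _).
    by apply: eq_bigr => i _; rewrite widenE qqlift gglift evC.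
  by rewrite !(rmorphM (ev y n.+1)) evC mulrA.
- move=> a aP.
  have sumE v : \sum_(i < c.+1) a i * (jet x v n.+1 (gg i))`_1 =
      \sum_(i < c) a (lift ord_max i) * (jet x v n (g i))`_1 + a ord_max * (jet x v n.+1 G)`_1.
    rewrite big_ord_recr ggmax; congr (_ + _); apply: eq_bigr => i _.
    by rewrite widenE gglift jetC.
  have amax : a ord_max = 0.
    pose v i : k := (i == n)%:R.
    have vlt i : (i < n)%N -> v i = 0 by move=> lti; rewrite /v ltn_eqF.
    have := aP v; rewrite sumE big1 ?add0r => [|i _]; last first.
      have [w' ->] := jet_linear x (g i); rewrite big1 ?mulr0 // => j _.
      by rewrite vlt ?mulr0.
    have [w' ->] := jet_linearS x G; rewrite big1 ?add0r => [|j _]; last first.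
      by rewrite vlt ?mulr0.
    rewrite {2}/v eqxx mulr1 => /(_ _)/eqP; rewrite mulf_eq0 (negbTE g') orbF => a0.
    by apply/eqP/a0 => i lti; apply: vlt; rewrite (leq_trans lti) // leq_addl.
  move=> i; case: (unliftP ord_max i) => [j ->|-> //].
  apply: (indep (fun j => a (lift ord_max j))) => v v0.
  by rewrite -[RHS](aP v v0) sumE amax mul0r addr0.
Qed.
End Family.

(** Going down, applied from the top of the chain. *)
Lemma lift_chain (R : idomainType) (P : set {poly R}) g m (Q : nat -> set R) (M : set {poly R}) :
    prime_ideal P -> prime_ideal M -> P `<=` M -> minimal_pol P g ->
    ~ contraction M (lead_coef g) -> Q 0%N `<=` contraction M ->
    (forall i, (i <= m)%N -> prime_ideal (Q i) /\ contraction P `<=` Q i) ->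
    (forall i, (i < m)%N -> Q i.+1 `<=` Q i) ->
  exists Q' : nat -> set {poly R},
    (forall i, (i <= m)%N -> [/\ prime_ideal (Q' i), P `<=` Q' i, Q' i `<=` M
       & contraction (Q' i) = Q i]) /\
    (forall i, (i < m)%N -> Q' i.+1 `<=` Q' i).
Proof.
move=> pP; elim: m Q M => [|m IHm] Q M pM PM mg nM QM pQ decQ.
  have [pQ0 PQ0] := pQ 0%N isT.
  have [Q0 [? ? ? ?]] := going_down pP pQ0 pM PM PQ0 QM mg nM.
  by exists (fun=> Q0); split=> // i; rewrite leqn0 => /eqP ->.
have [pQ0 PQ0] := pQ 0%N isT.
have [Q0 [pQ' PQ' Q'M cQ']] := going_down pP pQ0 pM PM PQ0 QM mg nM.
have [||i lti|i lti|Q' [Q'P decQ']] := IHm (Q \o S) Q0 pQ' PQ' mg.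
- by move=> Q0l; apply: nM; apply: Q'M.
- by rewrite cQ' /=; apply: decQ.
- exact: pQ.
- exact: decQ.
exists (fun i => if i is j.+1 then Q' j else Q0); split=> [[|i] lei|[|i] lti] //.
- by have [? ? sub ?] := Q'P i lei; split=> //; apply: (subset_trans sub).
- by case: (Q'P 0%N isT).
- exact: decQ'.
Qed.

Definition maximal_ideal n x : set (tow k n) := [set p | ev x n p = 0].

Arguments maximal_ideal : clear implicits.

Lemma maximal_ideal_prime n x : prime_ideal (maximal_ideal n x).
Proof.
rewrite /maximal_ideal; split=> /= [|a b|a b||a b].
- exact: rmorph0.
- by rewrite rmorphD => -> ->; rewrite addr0.
- by rewrite rmorphM => ->; rewrite mulr0.
- by rewrite rmorph1; apply/eqP; rewrite oner_eq0.
- by rewrite rmorphM => /eqP; rewrite mulf_eq0 => /orP[/eqP|/eqP]; [left|right].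
Qed.

(** Over a transcendental variable the primes extend, and the maximal ideal of x adds
    one more step at the top; over an algebraic variable the chain lifts by going
    down.  The indices decrease with the ideals, so that they increase with the
    zero sets. *)
Lemma nondegenerate_chain n (P : set (tow k n)) x : prime_ideal P -> zeros P x -> nondegenerate P x ->
  exists Q : nat -> set (tow k n),
    (forall i, (i <= tdim P)%N ->
      [/\ prime_ideal (Q i), P `<=` Q i & Q i `<=` maximal_ideal n x]) /\
    (forall i, (i < tdim P)%N -> Q i.+1 `<=` Q i /\ ~ Q i `<=` Q i.+1).
Proof.
elim: n P => [|n IHn] P pP Px gx.
  by exists (fun=> P); split=> // i _; split.
have pcP : prime_ideal (contraction (P : set {poly (tow k n)})) by exact: contraction_prime.
have [Q [QP decQ]] := IHn _ pcP (zerosC Px) gx.1.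
have pM := maximal_ideal_prime n.+1 x.
have cM : contraction (maximal_ideal n.+1 x : set {poly (tow k n)}) = maximal_ideal n x.
  by apply/seteqP; split=> a; rewrite /contraction /maximal_ideal /= evC.
set d := tdim (contraction (P : set {poly (tow k n)})) in QP decQ.
have -> : tdim P = (d + ~~ `[< algebraic (P : set {poly (tow k n)}) >])%N by [].
case: asboolP => [algP|nalg].
  rewrite addn0; have mg := minpolP pP algP; have [lg _] := gx.2 algP.
  have [||i lei|i lti|Q' [Q'P decQ']] := @lift_chain _ _ _ d Q _ pP pM Px mg.
  - by rewrite cM; apply/eqP.
  - by rewrite cM; case: (QP 0%N isT).
  - by case: (QP i lei).
  - by case: (decQ i lti).
  exists Q'; split=> [i /Q'P[]//|i lti]; split; first exact: decQ'.
  move=> sub; have [_ nsub] := decQ i lti; apply: nsub.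
  have [_ _ _ <-] := Q'P i (ltnW lti); have [_ _ _ <-] := Q'P i.+1 lti.
  by move=> a; apply: sub.
rewrite addn1.
pose Q' i : set {poly (tow k n)} := if i is j.+1 then extension_ideal (Q j) else maximal_ideal n.+1 x.
exists Q'; split=> [[|i] lei|[|i] lti].
- by split.
- have [pQ PQ QM] := QP i lei; split; first exact: extension_ideal_prime.
    by move=> f Pf j; apply: PQ; apply: transcendental_coef.
  move=> f Qf; apply: (mem_coefs pM) => j; rewrite cM; apply: QM; exact: Qf.
- have [pQ PQ QM] := QP 0%N isT; split.
    by move=> f Qf; apply: (mem_coefs pM) => j; rewrite cM; apply: QM; exact: Qf.
  move=> /(_ ('X - (towC k n (x n))%:P)) /= sub.
  have /sub /(_ 1%N) : (maximal_ideal n.+1 x : set {poly (tow k n)}) ('X - (towC k n (x n))%:P).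
    rewrite /maximal_ideal /= (rmorphB (ev x n.+1)) evC [ev x n _]towhom_towC.
    by rewrite [ev x n.+1 _]towhomX subrr.
  by rewrite coefB coefX coefC subr0; apply: (prime1 pQ).
- have [sub nsub] := decQ i lti; split; first by move=> f Qf j; apply: sub.
  move=> sub'; apply: nsub => a Qa.
  have [pQ _ _] := QP i (ltnW lti).
  have /sub' /(_ 0%N) : extension_ideal (Q i) a%:P.
    by move=> j; rewrite coefC; case: eqP => // _; apply: (prime0 pQ).
  by rewrite coefC.
Qed.

End ClosedField.

(** * The dimension of an irreducible set of points *)

Section Vanishing.
Variable k : closedFieldType.
Hypothesis char0 : [pchar k] =i pred0.
Notation tow := (tow k).
Notation point := (point k).

Definition vanish (X : set point) n : set (tow n) := [set p | forall x, X x -> ev x n p = 0].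
Arguments vanish : clear implicits.

Lemma vanish_contraction X n : contraction (vanish X n.+1 : set {poly (tow n)}) = vanish X n.
Proof.
by apply/seteqP; split=> p Pp x Xx; have := Pp x Xx; rewrite evC.
Qed.

Definition tow_subst N (s : nat -> tow N) n : {rmorphism tow n -> tow N} :=
  towhom (towC k N) s n.
Arguments tow_subst : clear implicits.

Definition pmap N (s : nat -> tow N) (x : point) : point := fun i => ev x N (s i).

Lemma ev_tow_subst N (s : nat -> tow N) n x (p : tow n) :
  ev x N (tow_subst N s n p) = ev (pmap s x) n p.
Proof.
apply: (towhom_morph (f := ev x N)) => // a; exact: towhom_towC.
Qed.

Lemma vanish_image N (s : nat -> tow N) (X : set point) n p :
  vanish (pmap s @` X) n p <-> vanish X N (tow_subst N s n p).
Proof.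
split=> [Pp x Xx|Pp _ [x Xx <-]]; last by rewrite -ev_tow_subst; apply: Pp.
by rewrite ev_tow_subst; apply: Pp; exists x.
Qed.

Lemma vanish_image_prime N (s : nat -> tow N) (X : set point) n :
  prime_ideal (vanish X N) -> prime_ideal (vanish (pmap s @` X) n).
Proof.
move=> pX; split.
- by apply/vanish_image; rewrite rmorph0; apply: (prime0 pX).
- move=> a b /vanish_image Pa /vanish_image Pb; apply/vanish_image.
  by rewrite rmorphD; apply: (primeD pX).
- move=> a b /vanish_image Pb; apply/vanish_image.
  by rewrite rmorphM; apply: (primeM pX).
- by move=> /vanish_image; rewrite rmorph1; apply: (prime1 pX).
- move=> a b /vanish_image; rewrite rmorphM => /(primeP pX)[] Pa; [left|right];
  exact/vanish_image.
Qed.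

Lemma vanish_zeros (X : set point) n x : X x -> zeros (vanish X n) x.
Proof. by move=> Xx p; apply. Qed.

Lemma not_vanish (X : set point) n p : ~ vanish X n p -> exists x, X x /\ ev x n p != 0.
Proof.
move=> /existsNP[x /not_implyP[Xx /eqP px]]; by exists x.
Qed.

Section Invariance.
Variables (X : set point) (N m : nat) (s : nat -> tow N).
Hypothesis pX : prime_ideal (vanish X N).

(** The coordinates s_0, ..., s_(m-1) followed by the given ones. *)
Definition prepend i : tow N := if (i < m)%N then s i else var k N (i - m).

Let shift n : {rmorphism tow n -> tow (N + m)} :=
  towhom (towC k (N + m)) (fun j => var k (N + m) (m + j)) n.

Lemma prepend_shift x j : (j < N)%N -> pmap prepend x (m + j) = x j.
Proof.
move=> ltj; rewrite /pmap /prepend ltnNge leq_addr /= addKn.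
exact: towhom_var.
Qed.

Lemma prepend_lt x i : (i < m)%N -> pmap prepend x i = ev x N (s i).
Proof. by move=> lti; rewrite /pmap /prepend lti. Qed.

Lemma ev_shift y n (p : tow n) : (n <= N)%N ->
  ev y (N + m) (shift n p) = ev (fun j => y (m + j)%N) n p.
Proof.
move=> len; apply: (towhom_morph (f := ev y (N + m))) => [a|j ltj].
  exact: towhom_towC.
by apply: towhom_var; rewrite addnC ltn_add2r (leq_trans ltj).
Qed.

Lemma jet_shift y v n (p : tow n) : (n <= N)%N ->
  jet y v (N + m) (shift n p) = jet (fun j => y (m + j)%N) (fun j => v (m + j)%N) n p.
Proof.
move=> len; apply: (towhom_morph (f := jet y v (N + m))) => [a|j ltj].
  exact: towhom_towC.
by apply: towhom_var; rewrite addnC ltn_add2r (leq_trans ltj).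
Qed.

Let P := vanish (pmap prepend @` X) (N + m).

Lemma prepend_tangent x v : X x -> tangent_vec P (pmap prepend x) v ->
  tangent_vec (vanish X N) x (fun j => v (m + j)%N).
Proof.
move=> Xx tv p Pp; rewrite -(@jet_ext _ (fun j => pmap prepend x (m + j)%N) _
  (fun j => v (m + j)%N)) ?jet_shift //; last by move=> j ltj; rewrite prepend_shift.
rewrite -jet_shift //; apply: tv; apply/vanish_image => y Xy.
rewrite ev_tow_subst ev_shift // (@ev_ext _ _ y); first exact: Pp.
by move=> j ltj; rewrite prepend_shift.
Qed.

(** The relations that express the s_i in the other coordinates determine the first m
    components of a tangent vector. *)
Lemma prepend_tangent0 x v : X x -> tangent_vec P (pmap prepend x) v ->
  (forall j, (j < N)%N -> v (m + j)%N = 0) -> forall i, (i < N + m)%N -> v i = 0.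
Proof.
move=> Xx tv v0 i lti; have [ltim|leim] := ltnP i m; last first.
  by rewrite -(subnKC leim) v0 // ltn_subLR // addnC.
have /tv : P (var k (N + m) i - shift N (s i)).
  apply/vanish_image => y Xy; rewrite ev_tow_subst (rmorphB (ev _ _)) ev_shift //.
  rewrite [X in X - _]towhom_var // prepend_lt // (@ev_ext _ _ y) ?subrr //.
  by move=> j ltj; rewrite prepend_shift.
rewrite (rmorphB (jet _ _ _)) jet_shift // [X in X - _]towhom_var //.
have [w wP] := jet_linear (fun j => pmap prepend x (m + j)%N) (s i).
rewrite coefB wP big1 => [|j _]; last by rewrite v0 ?mulr0.
by rewrite coefD coefZ coefX coefC subr0 /= add0r mulr1.
Qed.

(** Both numbers are dimensions of tangent spaces at a common nondegenerate zero, and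
    forgetting the first m components is injective on tangent vectors. *)
Lemma prepend_tdim : (tdim P <= tdim (vanish X N))%N.
Proof.
have pP : prime_ideal P by exact: vanish_image_prime.
have [h [nh hP]] := nondegenerate_open char0 pP; have [h' [nh' hP']] := nondegenerate_open char0 pX.
have nh1 : ~ vanish X N (tow_subst N prepend _ h) by move=> /vanish_image.
have [x [Xx]] := not_vanish (primeM_notin pX nh1 nh').
rewrite (rmorphM (ev x N)) mulf_eq0 negb_or ev_tow_subst => /andP[/hP gy /hP' gx].
have Py : zeros P (pmap prepend x) by apply: vanish_zeros; exists x.
have [E [indE tE]] := nondegenerate_tangent_basis pP Py gy.
have [E' [_ tE']] := nondegenerate_tangent_basis pX (vanish_zeros Xx) gx.
set d := tdim P in indE tE *; set d' := tdim _ in tE' *.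
have tEi (i : 'I_d) : tangent_vec P (pmap prepend x) (E i).
  apply/tE; exists (fun l => (l == i :> nat)%:R) => j _.
  rewrite (bigD1 i) //= eqxx mul1r big1 ?addr0 // => l.
  by rewrite -val_eqE /= => /negbTE ->; rewrite mul0r.
have /choice[c cP] : forall i : 'I_d, exists c : point, forall j, (j < N)%N ->
    E i (m + j)%N = \sum_(l < d') c l * E' l j.
  by move=> i; apply/tE'; apply: prepend_tangent.
pose A : 'M[k]_(d, d') := \matrix_(i, l) c i l.
suff /eqP <- : row_free A by apply: rank_leq_col.
apply: inj_row_free => a aA0; apply/rowP => i; rewrite [RHS]mxE.
pose a' l : k := oapp (a 0) 0 (insub l).
have a'E (l : 'I_d) : a' l = a 0 l by rewrite /a' valK.
rewrite -a'E; apply: indE => // j ltj.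
pose v j := \sum_(l < d) a' l * E l j.
rewrite -/(v j); apply: (@prepend_tangent0 x) => //; first by apply/tE; exists a'.
move=> j' ltj'; rewrite /v.
under eq_bigr => l _ do rewrite cP // a'E mulr_sumr.
rewrite exchange_big /= big1 // => l _.
have /rowP/(_ l) := aA0; rewrite !mxE => aAl.
under eq_bigr => i' _ do rewrite mulrA.
by rewrite -mulr_suml -[X in X * _](_ : 0 = _) ?mul0r // -[LHS]aAl;
  apply: eq_bigr => i' _; rewrite mxE.
Qed.

End Invariance.

(** The transcendental variables are algebraically independent on X. *)
Lemma transcendence_basis (X : set point) N : prime_ideal (vanish X N) ->
  exists b : nat -> nat, (forall i, (i < tdim (vanish X N))%N -> (b i < N)%N) /\
    forall p : tow (tdim (vanish X N)),
      (forall x, X x -> ev (x \o b) _ p = 0) -> p = 0.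
Proof.
elim: N => [|n IHn] pX.
  exists id; split=> // p p0; apply: contrapT => /eqP pn0; apply: (prime1 pX).
  move=> x Xx; have : (p : k) = 0 by exact: (p0 x Xx).
  by move/eqP; rewrite (negbTE (pn0 : (p : k) != 0)).
have cX := vanish_contraction X n.
have pX' : prime_ideal (vanish X n) by rewrite -cX; apply: contraction_prime.
have [b [bn ind]] := IHn pX'.
have -> : tdim (vanish X n.+1) =
    (tdim (vanish X n) + ~~ `[< algebraic (vanish X n.+1 : set {poly (tow n)}) >])%N.
  by rewrite -cX.
move: (tdim (vanish X n)) b bn ind => d b bn ind.
case: asboolP => [_|nalg].
  by rewrite addn0; exists b; split=> // i /bn; apply: ltnW.
rewrite addn1; pose b' i := if i == d then n else b i.
exists b'; split=> [i|p p0].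
  by rewrite ltnS leq_eqVlt /b'; case: eqP => //= _ /bn; apply: ltnW.
pose sg := tow_subst n (fun i => var k n (b i)) d.
have sgE x (q : tow d) : ev x n (sg q) = ev (x \o b) d q.
  rewrite /sg ev_tow_subst; apply: ev_ext => i lti; rewrite /pmap /=.
  by apply: towhom_var; apply: bn.
have Pp : vanish X n.+1 (map_poly sg (p : {poly (tow d)})).
  move=> x Xx; rewrite -[RHS](p0 x Xx) ![LHS]towhomE ![RHS]towhomE.
  rewrite -map_poly_comp /= {2}/b' eqxx; congr (_.[_]).
  apply: eq_map_poly => q; rewrite [LHS]sgE; apply: ev_ext => i lti.
  by rewrite /= /b' ltn_eqF.
apply/polyP => i; rewrite coef0; apply: ind => x Xx.
have := transcendental_coef pX nalg Pp i.
by rewrite cX => /(_ x Xx); rewrite coef_map sgE.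
Qed.

Lemma tdim_zero n (P : set (tow n)) : prime_ideal P -> (forall p, P p -> p = 0) ->
  tdim P = n.
Proof.
elim: n P => // n IHn P pP P0 /=; rewrite IHn.
- case: asboolP => [[p [/P0 -> np]]|_]; last by rewrite addn1.
  by case: np; rewrite lead_coef0; apply: (prime0 (contraction_prime pP)).
- exact: contraction_prime.
- by move=> a /P0 /eqP; rewrite polyC_eq0 => /eqP.
Qed.

(** Let b be a transcendence basis on X.  On X' the coordinates in b followed by f
    are independent: otherwise f satisfies over b an equation of least degree,
    whose constant term is not zero because f is not zero on X', but vanishes on X
    where f does, against the independence of b. *)
Lemma tdim_lt (X X' : set point) N (f : tow N) :
    prime_ideal (vanish X N) -> prime_ideal (vanish X' N) ->
    vanish X' N `<=` vanish X N -> vanish X N f -> ~ vanish X' N f ->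
  (tdim (vanish X N) < tdim (vanish X' N))%N.
Proof.
move=> pX pX' sub Xf nX'f.
have [b [bN ind]] := transcendence_basis pX.
set d := tdim (vanish X N) in bN ind *.
pose s i := if i == d then f else var k N (b i).
apply: leq_trans (prepend_tdim d.+1 s pX').
pose t := prepend d.+1 s.
pose Q n := vanish (pmap t @` X') n.
have pQ n : prime_ideal (Q n) by exact: vanish_image_prime.
have cQ n : contraction (Q n.+1 : set {poly (tow n)}) = Q n by exact: vanish_contraction.
have tE x i : (i < d)%N -> pmap t x i = x (b i).
  move=> lti; rewrite (@prepend_lt N d.+1 s x i (ltnW lti)) /s ltn_eqF //.
  by apply: towhom_var; apply: bN.
have td x : pmap t x d = ev x N f by rewrite prepend_lt // /s eqxx.
have QX n p : Q n p -> forall x, X x -> ev (pmap t x) n p = 0.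
  by move=> /vanish_image Qp x Xx; rewrite -ev_tow_subst; apply: sub.
have Qd0 p : Q d p -> p = 0.
  move=> /QX Qp; apply: ind => x Xx; rewrite -[RHS](Qp x Xx).
  by apply: ev_ext => i lti; rewrite tE.
have dQ : tdim (Q d.+1) = d.+1.
  have -> : tdim (Q d.+1) =
    (tdim (Q d) + ~~ `[< algebraic (Q d.+1 : set {poly (tow d)}) >])%N by rewrite -(cQ d).
  rewrite (tdim_zero (pQ d) Qd0); case: asboolP => [algQ|]; last by rewrite addn1.
  have [g mg] := @minimal_pol_exists (tow d) _ (pQ d.+1) algQ; have [Qg ng minr] := mg.
  have lt1g := minimal_pol_size mg.
  (* On X, where f vanishes, the equation reduces to its constant term. *)
  have g00 : g`_0 = 0.
    apply: ind => x Xx; rewrite -[RHS](QX _ _ Qg x Xx) [RHS]towhomE td Xf //.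
    rewrite horner_coef0 coef_map; apply: ev_ext => i lti.
    by rewrite tE.
  have gE : g = (drop_poly 1 g) * 'X.
    rewrite -[LHS](poly_take_drop 1 g) expr1 [take_poly 1 g](_ : _ = 0) ?add0r //.
    by apply/polyP => -[|i]; rewrite coef_take_poly coef0 //= g00.
  have Qg1 : Q d.+1 (drop_poly 1 g).
    have := Qg; rewrite {1}gE => /(primeP (pQ d.+1))[] // /vanish_image QX'.
    case: nX'f => x /QX'; rewrite ev_tow_subst [ev _ _ _]towhomX td //.
  case: ng; rewrite /lead_coef.
  have -> : g`_(size g).-1 = (drop_poly 1 g)`_(size g).-2.
    by rewrite coef_drop_poly addn1; case: (size g) lt1g => [|[]].
  by apply: minr => //; rewrite size_drop_poly; case: (size g) lt1g => [|[]] //= n _; rewrite subn1.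
have mono n : (tdim (Q d.+1) <= tdim (Q (n + d.+1)))%N.
  elim: n => // n IHn; apply: (leq_trans IHn); rewrite /= cQ; exact: leq_addr.
by rewrite -[X in (X <= _)%N]dQ; apply: mono.
Qed.

End Vanishing.

(** * Polynomial functions and coordinate systems *)

(** Polynomials are generated as a ring by constants and variables. *)
Lemma mpoly_gen_ind (R : comNzRingType) n (P : {mpoly R[n]} -> Prop) :
    (forall c, P c%:MP) -> (forall i, P 'X_i) ->
    (forall p q, P p -> P q -> P (p + q)) -> (forall p q, P p -> P q -> P (p * q)) ->
  forall p, P p.
Proof.
move=> PC PX PD PM p; rewrite [p]mpolyE; apply: (big_ind P) => [||m _].
- by rewrite -(mpolyC0 n R).
- exact: PD.
rewrite -mul_mpolyC; apply: (PM _ _ (PC _)); rewrite mpolyXE_id.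
apply: (big_ind P) => [||i _]; first by rewrite -(mpolyC1 n R).
  exact: PM.
by elim: (m i) => [|j IHj]; rewrite ?expr0 ?exprS -?(mpolyC1 n R) //; apply: PM.
Qed.

Lemma nat_maxE (S : set nat) d : S d -> (forall m, S m -> (m <= d)%N) -> nat_max S = d.
Proof.
move=> Sd maxd; rewrite /nat_max; case: xgetP => [n _ [Sn maxn]|/(_ d)[]//].
by apply/eqP; rewrite eqn_leq maxd // maxn.
Qed.

Section PolynomialFunctions.
Variable k : closedFieldType.

Lemma poly_fun_inj (F G : {poly k}) : (forall t, F.[t] = G.[t]) -> F = G.
Proof.
move=> FG; apply/eqP; rewrite -subr_eq0; apply/eqP; apply: contrapT => /eqP.
move=> /closed_nonrootP[t]; rewrite rootE hornerD hornerN FG subrr.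
by rewrite eqxx.
Qed.

Lemma ev_mmap n (y : nat -> k) (f : 'I_n -> k) N (s : 'I_n -> tow k N) (p : {mpoly k[n]}) :
  (forall i, ev y N (s i) = f i) -> ev y N (mmap (towC k N) s p) = p.@[f].
Proof.
move=> sf; elim/mpoly_gen_ind: p => [c|i|p q IHp IHq|p q IHp IHq].
- by rewrite mmapC mevalC; apply: towhom_towC.
- by rewrite mmapX mmap1U mevalXU.
- by rewrite mmapD mevalD rmorphD IHp IHq.
- by rewrite rmorphM mevalM rmorphM IHp IHq.
Qed.

Section OneSpace.
Variable V : vectType k.
Implicit Types (x v : V) (p q : polyfun V) (X : set V).

Lemma pevalD p q x : peval (p + q) x = peval p x + peval q x.
Proof. exact: mevalD. Qed.
Lemma pevalM p q x : peval (p * q) x = peval p x * peval q x.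
Proof. exact: mevalM. Qed.
Lemma pevalC c x : peval (c%:MP : polyfun V) x = c.
Proof. exact: mevalC. Qed.
Lemma pevalX i x : peval ('X_i : polyfun V) x = v2r x 0 i.
Proof. exact: mevalXU. Qed.

Definition line_pol p x v : {poly k} :=
  mmap (@polyC k) (fun i => (v2r x 0 i)%:P + v2r v 0 i *: 'X) p.

Lemma line_pol_horner p x v t : (line_pol p x v).[t] = peval p (x + t *: v).
Proof.
elim/mpoly_gen_ind: p => [c|i|p q IHp IHq|p q IHp IHq]; rewrite /line_pol.
- by rewrite mmapC hornerC pevalC.
- rewrite mmapX mmap1U pevalX hornerD hornerZ hornerX hornerC linearD linearZ.
  by rewrite !mxE mulrC.
- by rewrite mmapD hornerD pevalD -IHp -IHq.
- by rewrite rmorphM hornerM pevalM -IHp -IHq.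
Qed.

Lemma line_pol0 p x v : (line_pol p x v)`_0 = peval p x.
Proof. by rewrite -horner_coef0 line_pol_horner scale0r addr0. Qed.

Lemma line_pol1 p x v : (line_pol p x v)`_1 = pdiff p x v.
Proof.
elim/mpoly_gen_ind: p => [c|i|p q IHp IHq|p q IHp IHq]; rewrite /pdiff.
- rewrite /line_pol mmapC coefC big1 // => i _; rewrite mderivC.
  by rewrite -(mpolyC0 _ k) pevalC mulr0.
- rewrite /line_pol mmapX mmap1U coefD coefC coefZ coefX mulr1 add0r.
  rewrite (bigD1 i) //= big1 ?addr0 => [|j ji]; rewrite mderivX mnm1E.
    have -> : (U_(i) - U_(i) = 0)%MM by apply/mnmP => j; rewrite mnmBE subnn mnm0E.
    by rewrite eqxx scale1r mpolyX0 -(mpolyC1 _ k) pevalC mulr1.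
  by rewrite eq_sym (negbTE ji) scale0r -(mpolyC0 _ k) pevalC mulr0.
- rewrite {1}/line_pol mmapD coefD [X in X + _]IHp [X in _ + X]IHq -big_split /=.
  by apply: eq_bigr => i _; rewrite mderivD pevalD mulrDr.
- rewrite {1}/line_pol rmorphM coef1M -/(line_pol p x v) -/(line_pol q x v) !line_pol0.
  rewrite IHp IHq mulr_sumr mulr_suml -big_split /=; apply: eq_bigr => i _.
  by rewrite mderivM pevalD !pevalM; ring.
Qed.

(** The differential only depends on the polynomial function, so it can be read on
    any polynomial expression of its restriction to a line. *)
Lemma pdiffE p x v (F : {poly k}) :
  (forall t, peval p (x + t *: v) = F.[t]) -> pdiff p x v = F`_1.
Proof.
move=> pF; rewrite -line_pol1.
suff -> : line_pol p x v = F by [].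
by apply: poly_fun_inj => t; rewrite line_pol_horner pF.
Qed.

Definition ideal_of X : set (polyfun V) := [set p | forall y, X y -> peval p y = 0].

Definition vprime X := (X !=set0) /\
  forall p q, ideal_of X (p * q) -> ideal_of X p \/ ideal_of X q.

Lemma zclosed1 p : zclosed [set x : V | peval p x = 0].
Proof.
exists [set p]; apply/seteqP; split=> x /=; first by move=> px _ ->.
by apply.
Qed.

Lemma irreducible_vprime X : irreducible X <-> vprime X.
Proof.
split=> [[X0 irX]|[X0 prX]]; split=> //.
  move=> p q Xpq; apply: (irX _ _ (zclosed1 p) (zclosed1 q)) => x Xx.
  have /eqP := Xpq x Xx; rewrite pevalM mulf_eq0.
  by move=> /orP[/eqP|/eqP]; [left|right].
move=> F1 F2 [S1 ->] [S2 ->] sub.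
have [|/existsNP[x /not_implyP[Xx /existsNP[p /not_implyP[S1p px]]]]] :=
  pselect (X `<=` [set x | forall p, S1 p -> peval p x = 0]); first by left.
right=> y Xy q S2q.
have /prX [/(_ x Xx)//|] : ideal_of X (p * q); last by apply.
move=> z Xz; rewrite pevalM; have [Fz|Fz] := sub z Xz.
  by rewrite Fz ?mul0r.
by rewrite [peval q z]Fz ?mulr0.
Qed.

Lemma vdimE (P : set V) (U : {vspace V}) : (forall v, P v <-> v \in U) -> vdim P = \dim U.
Proof.
move=> PU; rewrite /vdim; case: xgetP => [U' _ U'P|/(_ U)[]//].
congr (\dim _); apply/vspaceP => v; apply/idP/idP => [/U'P/PU|/PU/U'P] //.
Qed.

(** Linear coordinates, together with polynomials that compute them.  The choice is
    left open because on a product those of one factor followed by those of the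
    other will be used. *)
Record coord_system (N : nat) := CoordSystem {
  cpol : nat -> polyfun V;
  cinv : (nat -> k) -> V;
  cfun := fun x i => peval (cpol i) x;
  cpol_inj : forall x y, (forall i, (i < N)%N -> cfun x i = cfun y i) -> x = y;
  cfunK : forall y i, (i < N)%N -> cfun (cinv y) i = y i;
  cfun_lin : forall x v t i, cfun (x + t *: v) i = cfun x i + t * cfun v i
}.

Section Coordinates.
Variables (N : nat) (C : coord_system N).

Lemma cfun_sum (I : finType) (c : I -> k) (e : I -> V) j :
  cfun C (\sum_i c i *: e i) j = \sum_i c i * cfun C (e i) j.
Proof.
have c0 : cfun C 0 j = 0.
  have := cfun_lin C 0 0 1 j; rewrite scaler0 addr0 mul1r => /esym/eqP.
  by rewrite -subr_eq0 addrK => /eqP.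
elim/big_rec2: _ => // i y z _ <-.
by rewrite addrC cfun_lin addrC.
Qed.

(** The inverse of [of_tow]: the standard coordinates are linear combinations of the
    given ones, with coefficients read on the dual basis. *)
Definition ctow (p : polyfun V) : tow k N :=
  mmap (towC k N)
    (fun j => \sum_(i < N) towC k N (v2r (cinv C (fun l => (l == i :> nat)%:R)) 0 j) * var k N i) p.

Lemma ctowE x p : ev (cfun C x) N (ctow p) = peval p x.
Proof.
apply: ev_mmap => j; rewrite rmorph_sum.
have {2}-> : x = \sum_(i < N) cfun C x i *: cinv C (fun l => (l == i :> nat)%:R).
  apply: (@cpol_inj _ C) => l ltl; rewrite cfun_sum (bigD1 (Ordinal ltl)) //=.
  rewrite cfunK // eqxx mulr1 big1 ?addr0 // => i; rewrite -val_eqE /= eq_sym => /negbTE il.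
  by rewrite cfunK // il mulr0.
rewrite linear_sum summxE; apply: eq_bigr => i _; rewrite linearZ mxE rmorphM mulrC.
by congr (_ * _); [apply: towhom_var | apply: towhom_towC].
Qed.

Definition of_tow n : {rmorphism tow k n -> polyfun V} :=
  towhom (@mpolyC _ k : {rmorphism k -> polyfun V}) (cpol C) n.

Lemma peval_of_tow n (p : tow k n) x : peval (of_tow n p) x = ev (cfun C x) n p.
Proof.
rewrite /peval; apply: (towhom_morph (f := meval (fun i => v2r x ord0 i))) => // a.
exact: mevalC.
Qed.

Lemma pdiff_of_tow n (p : tow k n) x v :
  pdiff (of_tow n p) x v = (jet (cfun C x) (cfun C v) n p)`_1.
Proof.
apply: pdiffE => t; rewrite peval_of_tow jet_horner; apply: ev_ext => j _.
exact: cfun_lin.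
Qed.

Lemma pdiff_ctow (p : polyfun V) x v :
  pdiff p x v = (jet (cfun C x) (cfun C v) N (ctow p))`_1.
Proof.
apply: pdiffE => t; rewrite -ctowE jet_horner; apply: ev_ext => j _.
exact: cfun_lin.
Qed.

Definition cvanish X n := @vanish k (cfun C @` X) n.
Arguments cvanish : clear implicits.

Lemma cvanishE X n (p : tow k n) : cvanish X n p <-> ideal_of X (of_tow n p).
Proof.
split=> [Xp y Xy|Xp _ [y Xy <-]]; last by rewrite -peval_of_tow; apply: Xp.
by rewrite peval_of_tow; apply: Xp; exists y.
Qed.

Lemma cvanish_ctow X p : cvanish X N (ctow p) <-> ideal_of X p.
Proof.
split=> [Xp y Xy|Xp _ [y Xy <-]]; last by rewrite ctowE; apply: Xp.
by rewrite -ctowE; apply: Xp; exists y.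
Qed.

Lemma cvanish_prime X n : irreducible X -> prime_ideal (cvanish X n).
Proof.
move=> /irreducible_vprime[[x Xx] prX]; split.
- by move=> y _; rewrite rmorph0.
- by move=> a b Xa Xb y Xy; rewrite rmorphD Xa ?Xb ?addr0.
- by move=> a b Xb y Xy; rewrite rmorphM Xb ?mulr0.
- move=> X1; have := X1 (cfun C x) (ex_intro2 _ _ x Xx erefl); rewrite rmorph1.
  by apply/eqP; rewrite oner_eq0.
- move=> a b /cvanishE; rewrite rmorphM => /prX[/cvanishE|/cvanishE]; by [left|right].
Qed.

Lemma tangent_cvanish X x v : tangent X x v <-> tangent_vec (cvanish X N) (cfun C x) (cfun C v).
Proof.
split=> [tv p /cvanishE Xp|tv p Xp]; first by rewrite -pdiff_of_tow; apply: tv.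
by rewrite pdiff_ctow; apply: tv; apply/cvanish_ctow.
Qed.

(** Transport of the basis by the coordinates. *)
Lemma vdim_tangent_basis X x d : tangent_basis (cvanish X N) (cfun C x) d ->
  vdim (tangent X x) = d.
Proof.
move=> [E [indE tE]]; pose e : d.-tuple V := [tuple cinv C (E i) | i < d].
have eE (i : 'I_d) j : (j < N)%N -> cfun C e`_i j = E i j.
  by move=> ltj; rewrite -tnth_nth tnth_mktuple cfunK.
have fe : free e.
  apply/freeP => c c0 i; pose c' l : k := oapp c 0 (insub l).
  have c'E (l : 'I_d) : c' l = c l by rewrite /c' valK.
  rewrite -c'E; apply: indE => // j ltj.
  have := congr1 (fun v => cfun C v j) c0; rewrite cfun_sum.
  have -> : cfun C 0 j = 0 by have := @cfun_sum 'I_0 (fun=> 0) (fun=> 0) j; rewrite !big_ord0.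
  by move=> cE; rewrite -[RHS]cE; apply: eq_bigr => l _; rewrite c'E eE.
rewrite (@vdimE _ <<e>>%VS) => [|v].
  by have /eqP -> := fe; rewrite size_tuple.
rewrite tangent_cvanish tE; split=> [[c cP]|/coord_span vE].
  have -> : v = \sum_(i < d) c i *: e`_i.
    apply: (@cpol_inj _ C) => j ltj; rewrite cfun_sum cP //.
    by apply: eq_bigr => i _; rewrite eE.
  by apply: memv_suml => i _; apply/memvZ/memv_span/mem_nth; rewrite size_tuple.
pose c' l : k := oapp (fun i => coord e i v) 0 (insub l); exists c' => j ltj.
rewrite {1}vE cfun_sum; apply: eq_bigr => i _.
by rewrite /c' valK eE.
Qed.

End Coordinates.

Definition std_cpol i : polyfun V := if insub i is Some j then 'X_j else 0.
Definition std_cinv (y : nat -> k) : V := r2v (\row_i y i).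
Lemma std_cpolE x i (lti : (i < dim V)%N) : peval (std_cpol i) x = v2r x 0 (Ordinal lti).
Proof. by rewrite /std_cpol insubT pevalX. Qed.

Lemma std_cpol_ord x (i : 'I_(dim V)) : peval (std_cpol i) x = v2r x 0 i.
Proof. by rewrite /std_cpol valK pevalX. Qed.

Lemma std_cpol_ge x i : (dim V <= i)%N -> peval (std_cpol i) x = 0.
Proof. by move=> lei; rewrite /std_cpol insubF ?ltnNge ?lei // -(mpolyC0 _ k) pevalC. Qed.

Lemma std_cpol_inj x y :
  (forall i, (i < dim V)%N -> peval (std_cpol i) x = peval (std_cpol i) y) -> x = y.
Proof.
by move=> xy; apply: v2r_inj; apply/rowP => i; rewrite -!std_cpol_ord xy.
Qed.

Lemma std_cinvK y i : (i < dim V)%N -> peval (std_cpol i) (std_cinv y) = y i.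
Proof. by move=> lti; rewrite std_cpolE r2vK mxE. Qed.

Lemma std_cpol_lin x v t i :
  peval (std_cpol i) (x + t *: v) = peval (std_cpol i) x + t * peval (std_cpol i) v.
Proof.
have [lti|lei] := ltnP i (dim V); last by rewrite !std_cpol_ge // mulr0 addr0.
by rewrite !std_cpolE linearD linearZ !mxE.
Qed.

Definition std_coords : coord_system (dim V) :=
  CoordSystem std_cpol_inj std_cinvK std_cpol_lin.

End OneSpace.
End PolynomialFunctions.
Arguments cvanish {k V N} C X n.
Arguments std_coords {k} V.
Arguments std_cpol {k} V i.
Arguments std_cinv {k} V y.

(** * Generic smooth points *)

Section GenericPoints.
Variable k : closedFieldType.
Hypothesis char0 : [pchar k] =i pred0.

Definition generically (V : vectType k) (X : set V) (P : V -> Prop) :=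
  exists h : polyfun V, ~ ideal_of X h /\ forall x, X x -> peval h x != 0 -> P x.

Definition closure_of (V : vectType k) (X : set V) : set V :=
  [set x | forall p, ideal_of X p -> peval p x = 0].

Definition open_in_closure (V : vectType k) (X : set V) :=
  exists h : polyfun V, ~ ideal_of X h /\
    forall x, closure_of X x -> peval h x != 0 -> X x.

Section OneSpace.
Variable V : vectType k.
Implicit Types (X Z : set V).
Let N := dim V.
Let C := std_coords V.

Let dimn X := tdim (cvanish C X N).

Lemma not_ideal X h : ~ ideal_of X h -> exists x, X x /\ peval h x != 0.
Proof. by move=> /existsNP[x /not_implyP[Xx /eqP hx]]; exists x. Qed.

Lemma ideal_prime_notin X p q : irreducible X -> ~ ideal_of X p -> ~ ideal_of X q ->
  ~ ideal_of X (p * q).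
Proof. by move=> /irreducible_vprime[_ prX] np nq /prX[]. Qed.

Lemma tdim_lt_closed X Z Z' : zclosed_in X Z -> zclosed_in X Z' ->
  irreducible Z -> irreducible Z' -> Z `<` Z' -> (dimn Z < dimn Z')%N.
Proof.
move=> [F [S ->] eqZ] [F' _ eqZ'] irZ irZ' [sub nsub].
have [z [Z'z nZz]] : exists z, Z' z /\ ~ Z z.
  by move: nsub => /existsNP[z /not_implyP]; exists z.
have Xz : X z by move: Z'z; rewrite eqZ' => -[].
have [p [Sp pz]] : exists p, S p /\ peval p z <> 0.
  apply: contrapT => no; apply: nZz; rewrite eqZ; split=> // p Sp.
  by apply: contrapT => pz; apply: no; exists p.
apply: (@tdim_lt _ char0 _ _ _ (ctow C p)).
- exact: cvanish_prime.
- exact: cvanish_prime.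
- move=> q Z'q _ [y Zy <-]; apply: Z'q; exists y => //; exact: sub.
- apply/cvanish_ctow => y; rewrite eqZ => -[_]; exact.
- by move=> /cvanish_ctow/(_ z Z'z).
Qed.

(** The dimension increases by at least one at each step of the chain. *)
Lemma chain_bound X (Z : nat -> set V) n : irreducible X ->
  (forall i, (i <= n)%N -> zclosed_in X (Z i) /\ irreducible (Z i)) ->
  (forall i, (i < n)%N -> Z i `<` Z i.+1) -> (n <= dimn X)%N.
Proof.
move=> irX Zi ltZ; have leni i : (i <= n)%N -> (i <= dimn (Z i))%N.
  elim: i => // i IHi lti; apply: (leq_ltn_trans (IHi (ltnW lti))).
  have [? ?] := Zi i (ltnW lti); have [? ?] := Zi i.+1 lti.
  by apply: (@tdim_lt_closed X) => //; apply: ltZ.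
apply: (leq_trans (leni n (leqnn n))).
have [cl ir] := Zi n (leqnn n).
have subZ : Z n `<=` X by case: cl => F _ -> x [].
have [subX|nsub] := pselect (X `<=` Z n).
  by rewrite (_ : X = Z n) //; apply/seteqP.
apply/ltnW/(@tdim_lt_closed X) => //; exists setT; rewrite ?setIT //.
by exists set0; apply/seteqP; split=> // x _ p [].
Qed.

(** The zero sets of a chain of primes.  By the Nullstellensatz, applied away from the
    zeros of h0, the functions vanishing on such a zero set are those of the prime;
    therefore the sets are irreducible and distinct. *)
Lemma closed_chain_exists X h0 x : irreducible X ->
    (forall y, closure_of X y -> peval h0 y != 0 -> X y) ->
    X x -> peval h0 x != 0 -> nondegenerate (cvanish C X N) (cfun C x) ->
  exists2 Z : nat -> set V,
    forall i, (i <= dimn X)%N -> [/\ zclosed_in X (Z i), irreducible (Z i) & Z i x]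
    & forall i, (i < dimn X)%N -> Z i `<` Z i.+1.
Proof.
move=> irX oX Xx h0x gx; set P := cvanish C X N in gx.
have pP : prime_ideal P by exact: cvanish_prime.
have Px : zeros P (cfun C x) by apply: vanish_zeros; exists x.
have [Q [QP decQ]] := nondegenerate_chain pP Px gx.
pose Z i : set V := [set y | X y /\ zeros (Q i) (cfun C y)].
have ZQ i (f : tow k N) : (i <= dimn X)%N -> (forall y, Z i y -> ev (cfun C y) N f = 0) -> Q i f.
  move=> lei Zf; apply: contrapT => nQf; have [pQ PQ Qx] := QP i lei.
  have nQ0 : ~ Q i (ctow C h0).
    by move=> /Qx; rewrite /maximal_ideal /= ctowE; apply/eqP.
  have [y [Qy]] := nullstellensatz pQ (primeM_notin pQ nQf nQ0).
  have yE p : ev y N p = ev (cfun C (cinv C y)) N p.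
    by apply: ev_ext => j ltj; rewrite cfunK.
  rewrite rmorphM mulf_eq0 negb_or !yE ctowE => /andP[fy h0y].
  move/negP: fy; apply; apply/eqP/Zf; split.
    apply: oX => // p Xp; rewrite -(ctowE C) -yE; apply: Qy; apply: PQ.
    exact/cvanish_ctow.
  by move=> p Qp; rewrite -yE; apply: Qy.
have Zx i : (i <= dimn X)%N -> Z i x.
  by move=> lei; split=> // p; have [_ _ Qx] := QP i lei; apply: Qx.
exists Z => i lei.
  have [pQ PQ Qx] := QP i lei; split; last exact: Zx.
  - exists [set y | forall p, (exists2 q, Q i q & p = of_tow C N q) -> peval p y = 0].
      by exists [set p | exists2 q, Q i q & p = of_tow C N q].
    apply/seteqP; split=> y [Xy Zy]; split=> //.
      by move=> _ [q Qq ->]; rewrite peval_of_tow; apply: Zy.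
    by move=> q Qq; rewrite -peval_of_tow; apply: Zy; exists q.
  - apply/irreducible_vprime; split; first by exists x; apply: Zx.
    move=> p q Zpq.
    have : Q i (ctow C p * ctow C q).
      by apply: ZQ => // y Zy; rewrite rmorphM !ctowE -pevalM; apply: Zpq.
    by move=> /(primeP pQ)[] Qp; [left|right] => y [Xy Zy]; rewrite -(ctowE C); apply: Zy.
have [sub nsub] := decQ i lei; split.
  by move=> y [Xy Zy]; split=> // p Qp; apply: Zy; apply: sub.
move=> subZ; apply: nsub => f Qf; apply: ZQ => // y Zy.
by have [_] := subZ y Zy; apply.
Qed.

(** At a nondegenerate point, the tangent dimension, the length of the chains through
    the point and that of all chains are the number of transcendental variables. *)
Theorem generic_smooth_point X : irreducible X -> open_in_closure X ->
  generically X (fun x => smooth_point X x /\ vdim (tangent X x) = krull_dim X).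
Proof.
move=> irX [h0 [nh0 oX]].
have pP : prime_ideal (cvanish C X N) by exact: cvanish_prime.
have [h [nh hP]] := nondegenerate_open char0 pP.
have nhX : ~ ideal_of X (h0 * of_tow C N h).
  by apply: ideal_prime_notin => // /cvanishE.
exists (h0 * of_tow C N h); split=> // x Xx.
have chain_at y : X y -> peval (h0 * of_tow C N h) y != 0 ->
    exists2 Z : nat -> set V,
    forall i, (i <= dimn X)%N -> [/\ zclosed_in X (Z i), irreducible (Z i) & Z i y]
    & forall i, (i < dimn X)%N -> Z i `<` Z i.+1.
  move=> Xy; rewrite pevalM mulf_eq0 negb_or peval_of_tow => /andP[h0y /hP gy].
  exact: (closed_chain_exists irX oX Xy h0y gy).
move=> hx; have dimT : vdim (tangent X x) = dimn X.
  apply: (vdim_tangent_basis (C := C)).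
  move: hx; rewrite pevalM mulf_eq0 negb_or peval_of_tow => /andP[_ /hP gx].
  by apply: nondegenerate_tangent_basis => //; apply: vanish_zeros; exists x.
rewrite /smooth_point dimT; split; first split=> //.
  symmetry; apply: nat_maxE.
    by have [Z ? ?] := chain_at x Xx hx; exists Z.
  by move=> m [Z Zi ltZ]; apply: (chain_bound irX _ ltZ) => i /Zi[].
symmetry; apply: nat_maxE.
  have [Z Zi ltZ] := chain_at x Xx hx; exists Z => // i /Zi[? ? _]; by split.
by move=> m [Z Zi ltZ]; apply: (chain_bound irX _ ltZ) => i /Zi[].
Qed.

Lemma zclosed_open_in_closure X : zclosed X -> X !=set0 -> open_in_closure X.
Proof.
move=> [S ->] [x0 Xx0]; exists 1; split.
  move=> /(_ x0 Xx0); rewrite -(mpolyC1 _ k) pevalC; apply/eqP; exact: oner_neq0.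
by move=> x clx _ p Sp; apply: clx => y; apply.
Qed.

End OneSpace.

Section LinearMaps.
Variables (U V : vectType k).

Definition regular (f : U -> k) := exists q : polyfun U, forall x, peval q x = f x.

Definition regular_map (phi : U -> V) :=
  forall i, regular (fun x => v2r (phi x) 0 i).

Lemma regular_comp phi (p : polyfun V) : regular_map phi -> regular (fun x => peval p (phi x)).
Proof.
move=> /choice[q qP]; exists (mmap (@mpolyC _ k) q p) => x.
elim/mpoly_gen_ind: p => [c|i|p1 p2 IH1 IH2|p1 p2 IH1 IH2].
- by rewrite mmapC !pevalC.
- by rewrite mmapX mmap1U pevalX qP.
- by rewrite mmapD !pevalD IH1 IH2.
- by rewrite rmorphM /= !pevalM IH1 IH2.
Qed.

Lemma linear_regular (l : {linear U -> k^o}) : regular l.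
Proof.
exists (\sum_i (l (r2v (delta_mx 0 i)) : k)%:MP * 'X_i) => x.
rewrite /peval rmorph_sum -[in RHS](v2rK x) [in RHS](row_sum_delta (v2r x)) !linear_sum /=.
apply: eq_bigr => i _; rewrite rmorphM /= mevalC mevalXU !linearZ /=.
exact: mulrC.
Qed.

End LinearMaps.

Lemma linear_regular_map (U V : vectType k) (L : {linear U -> V}) : regular_map L.
Proof.
move=> i.
pose l x : k^o := v2r (L x) 0 i.
have ll : linear l by move=> a x y; rewrite /l !linearP !mxE.
pose lM := GRing.isLinear.Build _ _ _ _ l ll.
pose lL : {linear U -> k^o} := HB.pack l lM.
exact: (linear_regular lL).
Qed.

Lemma peval_linear (U V : vectType k) (L : {linear U -> V}) (b : V) (p : polyfun V) :
  exists q : polyfun U, (forall x, peval q x = peval p (L x + b)) /\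
    forall x v, pdiff q x v = pdiff p (L x + b) (L v).
Proof.
have Lr : regular_map (fun x : U => L x + b).
  move=> i; have [q qP] := linear_regular_map L i.
  exists (q + (v2r b 0 i)%:MP) => x; rewrite pevalD pevalC qP.
  by rewrite linearD mxE.
have [q qP] := regular_comp p Lr; exists q; split=> // x v.
rewrite -(line_pol1 p); apply: pdiffE => t; rewrite line_pol_horner qP.
by rewrite linearD linearZ addrAC.
Qed.

End GenericPoints.

(** * Graphs: generic smoothness and images *)

Section Morphisms.
Variable k : closedFieldType.
Hypothesis char0 : [pchar k] =i pred0.

Section ProductCoordinates.
Variables W V : vectType k.
Local Notation WV := (W * V)%type.

Definition pullback (U U' : vectType k) (L : {linear U -> U'}) (p : polyfun U') : polyfun U :=
  sval (cid (regular_comp p (linear_regular_map L))).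

Lemma pullbackE (U U' : vectType k) (L : {linear U -> U'}) (p : polyfun U') x :
  peval (pullback L p) x = peval p (L x).
Proof. exact: (svalP (cid (regular_comp p (linear_regular_map L)))). Qed.

(** The coordinates of W come first, so that polynomials in the first variables are
    functions on the target of a graph. *)
Definition pair_cpol i : polyfun WV :=
  if (i < dim W)%N then pullback (fst : {linear WV -> W}) (std_cpol W i)
  else pullback (snd : {linear WV -> V}) (std_cpol V (i - dim W)).

Definition pair_cinv (y : nat -> k) : WV :=
  (std_cinv W y, std_cinv V (fun j => y (dim W + j)%N)).

Lemma pair_cpol_lt i z : (i < dim W)%N -> peval (pair_cpol i) z = peval (std_cpol W i) z.1.
Proof. by move=> lti; rewrite /pair_cpol lti pullbackE. Qed.

Lemma pair_cpol_ge i z : peval (pair_cpol (dim W + i)) z = peval (std_cpol V i) z.2.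
Proof. by rewrite /pair_cpol ltnNge leq_addr /= pullbackE addKn. Qed.

Lemma pair_cpol_inj x y :
  (forall i, (i < dim V + dim W)%N -> peval (pair_cpol i) x = peval (pair_cpol i) y) -> x = y.
Proof.
case: x y => [w v] [w' v'] xy; congr (_, _); apply: std_cpol_inj => i lti.
  have := xy i; rewrite !pair_cpol_lt //=; apply.
  by rewrite (leq_trans lti) // leq_addl.
have := xy (dim W + i)%N; rewrite !pair_cpol_ge /=; apply.
by rewrite addnC ltn_add2r.
Qed.

Lemma pair_cinvK y i : (i < dim V + dim W)%N -> peval (pair_cpol i) (pair_cinv y) = y i.
Proof.
have [lti _|lei lti] := ltnP i (dim W); first by rewrite pair_cpol_lt // std_cinvK.
rewrite -(subnKC lei) pair_cpol_ge std_cinvK //.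
by rewrite ltn_subLR // addnC.
Qed.

Lemma pair_cpol_lin x v t i :
  peval (pair_cpol i) (x + t *: v) = peval (pair_cpol i) x + t * peval (pair_cpol i) v.
Proof.
have [lti|lei] := ltnP i (dim W); first by rewrite !pair_cpol_lt // std_cpol_lin.
by rewrite -(subnKC lei) !pair_cpol_ge std_cpol_lin.
Qed.

Definition pair_coords : coord_system WV (dim V + dim W) :=
  CoordSystem pair_cpol_inj pair_cinvK pair_cpol_lin.

Section Graph.
Variables (X : set V) (phi : V -> W).

Definition graph : set WV := [set z | exists2 x, X x & z = (phi x, x)].

Hypothesis irX : irreducible graph.

Let n := dim V.
Let w := dim W.
Let N := (n + w)%N.
Let C := pair_coords.
Let P m := cvanish C graph m.
Arguments P : clear implicits.

Let pP m : prime_ideal (P m).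
Proof. exact: cvanish_prime. Qed.

Let coh m : contraction (P m.+1 : set {poly (tow k m)}) = P m.
Proof. exact: vanish_contraction. Qed.

Lemma graph_zeros y v : (phi @` X) y -> zeros (P w) (cfun C (y, v)).
Proof.
move=> [x Xx <-] p Pp.
rewrite -[RHS](Pp (cfun C (phi x, x))); last by exists (phi x, x) => //; exists x.
by apply: ev_ext => j ltj; rewrite /cfun /= !pair_cpol_lt.
Qed.

Lemma cfun_fst_ideal (p : tow k w) : P w p <-> ideal_of (phi @` X) (of_tow (std_coords W) w p).
Proof.
split=> [Pp _ [x Xx <-]|Pp _ [_ [x Xx ->] <-]].
  rewrite peval_of_tow -[RHS](Pp (cfun C (phi x, x))); last by exists (phi x, x) => //; exists x.
  by apply: ev_ext => j ltj; rewrite /cfun /= pair_cpol_lt.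
rewrite -[RHS](Pp (phi x)); last by exists x.
by rewrite peval_of_tow; apply: ev_ext => j ltj; rewrite /cfun /= pair_cpol_lt.
Qed.

(** The relative equations of the ideal of the graph over the coordinates of W.  They
    generate that ideal near a nondegenerate point, which is the definition of a
    smooth morphism. *)
Theorem generic_smoothness :
  exists h : polyfun WV, ~ ideal_of graph h /\
    forall x, X x -> peval h (phi x, x) != 0 -> smooth_at X (phi @` X) phi x.
Proof.
have [h [nh hP]] := nondegenerate_open char0 (pP N).
exists (of_tow C N h); split; first by move=> /cvanishE.
move=> x Xx; rewrite peval_of_tow => /hP gx; split=> //.
have Gx x' : X x' -> graph (phi x', x') by exists x'.
have [c [g [Pg gen indep]]] := nondegenerate_locally_generated pP coh gx.
exists c, (fun i => of_tow C N (g i)); split.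
- by move=> i x' Xx'; have /cvanishE := Pg i; apply; apply: Gx.
- move=> f Xf; have Pf : P N (ctow C f).
    by apply/cvanish_ctow => _ [x' Xx' ->]; apply: Xf.
  have [h' [q [h'x h'q]]] := gen _ Pf.
  exists (of_tow C N h'), (fun i => of_tow C N (q i)); rewrite peval_of_tow; split=> //.
  move=> y v Yy; rewrite peval_of_tow -[peval f _](ctowE C) h'q.
    by apply: eq_bigr => i _; rewrite !peval_of_tow.
  exact: graph_zeros.
- move=> a aP; apply: indep => v v0.
  rewrite -[RHS](aP (cinv C v).2); apply: eq_bigr => i _; congr (_ * _).
  rewrite pdiff_of_tow.
  suff -> : jet (cfun C (phi x, x)) (cfun C (0, (cinv C v).2)) N (g i) =
    jet (cfun C (phi x, x)) v N (g i) by [].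
  apply: jet_ext => // j ltj.
  have -> : (0, (cinv C v).2) = cinv C v.
    rewrite [RHS]surjective_pairing; congr (_, _); apply: std_cpol_inj => l ltl.
    rewrite std_cinvK // v0 //.
    have := std_cpol_lin (0 : W) 0 1 l; rewrite scaler0 addr0 mul1r.
    by move=> /esym/eqP; rewrite -subr_eq0 addrK => /eqP.
  by rewrite cfunK.
Qed.

(** Lift a point of the closure of the image to a zero of the ideal of the graph
    outside the zeros of D. *)
Theorem image_open_in_closure (D : polyfun WV) : ~ ideal_of graph D ->
    (forall z, closure_of graph z -> peval D z != 0 -> graph z) ->
  open_in_closure (phi @` X).
Proof.
move=> nD DP; have nD' : ~ P N (ctow C D) by move=> /cvanish_ctow.
have [h [nh hP]] := zeros_lift pP coh nD'.
exists (of_tow (std_coords W) w h); split; first by move=> /cfun_fst_ideal.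
move=> y cly; rewrite peval_of_tow => hy.
have [|z [zy zP Dz]] := hP (cfun (std_coords W) y) _ hy.
  by move=> p /cfun_fst_ideal /cly; rewrite peval_of_tow.
have zE p : ev z N p = ev (cfun C (cinv C z)) N p.
  by apply: ev_ext => j ltj; rewrite cfunK.
have [||x Xx eqx] := DP (cinv C z); last first.
- exists x => //; apply: std_cpol_inj => i lti.
  have -> : phi x = (cinv C z).1 by rewrite eqx.
  rewrite std_cinvK //; exact: zy.
- by rewrite -(ctowE C) -zE.
- by move=> p Pp; rewrite -(ctowE C) -zE; apply: zP; apply/cvanish_ctow.
Qed.

End Graph.
End ProductCoordinates.

Lemma irreducible_image (U U' : vectType k) (f : U -> U') (X : set U) :
  regular_map f -> irreducible X -> irreducible (f @` X).
Proof.
move=> rf /irreducible_vprime[[x Xx] prX]; apply/irreducible_vprime; split.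
  by exists (f x), x.
move=> p q Xpq; have [p' p'E] := regular_comp p rf; have [q' q'E] := regular_comp q rf.
have /prX : ideal_of X (p' * q').
  by move=> y Xy; rewrite pevalM p'E q'E -pevalM; apply: Xpq; exists y.
move=> [Xp|Xq]; [left|right] => _ [y Xy <-].
  by rewrite -p'E; apply: Xp.
by rewrite -q'E; apply: Xq.
Qed.

End Morphisms.

(** * Differentials, products and translations *)

Section Geometry.
Variable k : closedFieldType.

Definition mk_linear (U V : lmodType k) (f : U -> V) (lf : linear f) : {linear U -> V} :=
  HB.pack f (GRing.isLinear.Build _ _ _ _ f lf).

Section Differential.
Variable V : vectType k.
Implicit Types (p q : polyfun V) (x v : V).

Lemma pdiffDr p x v v' : pdiff p x (v + v') = pdiff p x v + pdiff p x v'.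
Proof.
by rewrite /pdiff -big_split; apply: eq_bigr => i _; rewrite linearD mxE mulrDl.
Qed.

Lemma pdiffZr p x a v : pdiff p x (a *: v) = a * pdiff p x v.
Proof.
by rewrite /pdiff mulr_sumr; apply: eq_bigr => i _; rewrite linearZ mxE mulrA.
Qed.

Lemma pdiff0r p x : pdiff p x 0 = 0.
Proof. by rewrite -(scale0r 0) pdiffZr mul0r. Qed.

Lemma pdiffM p q x v : pdiff (p * q) x v = peval p x * pdiff q x v + pdiff p x v * peval q x.
Proof.
rewrite -!line_pol1 -!(line_pol0 _ x v) -coef1M.
suff -> : line_pol (p * q) x v = line_pol p x v * line_pol q x v by [].
by rewrite /line_pol rmorphM.
Qed.

Lemma pdiffD p q x v : pdiff (p + q) x v = pdiff p x v + pdiff q x v.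
Proof. by rewrite -!line_pol1 -coefD /line_pol rmorphD. Qed.

Lemma pdiffN p x v : pdiff (- p) x v = - pdiff p x v.
Proof. by rewrite -!line_pol1 -coefN /line_pol rmorphN. Qed.

Lemma pdiff_sum (I : finType) (p : I -> polyfun V) x v :
  pdiff (\sum_i p i) x v = \sum_i pdiff (p i) x v.
Proof.
rewrite -line_pol1 /line_pol rmorph_sum coef_sum; apply: eq_bigr => i _.
by rewrite -line_pol1.
Qed.

Lemma pdiff_vanish p x v : (forall y, peval p y = 0) -> pdiff p x v = 0.
Proof.
by move=> p0; rewrite (@pdiffE _ _ p x v 0) ?coef0 // => t; rewrite p0 horner0.
Qed.

Lemma tangent0 X x : tangent X x (0 : V).
Proof. by move=> p _; apply: pdiff0r. Qed.

Lemma tangentD X x v v' : tangent X x v -> tangent X x v' -> tangent X x (v + v').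
Proof. by move=> tv tv' p Xp; rewrite pdiffDr tv // tv' // addr0. Qed.

Lemma tangentZ X x a v : tangent X x v -> tangent X x (a *: v).
Proof. by move=> tv p Xp; rewrite pdiffZr tv // mulr0. Qed.

(** A subspace of maximal dimension among those contained in P. *)
Lemma linear_set_vspace (P : set V) : P 0 -> (forall u v, P u -> P v -> P (u + v)) ->
  (forall a v, P v -> P (a *: v)) -> exists U : {vspace V}, forall v, P v <-> v \in U.
Proof.
move=> P0 PD PZ.
pose B n := `[< exists U : {vspace V}, (forall v, v \in U -> P v) /\ \dim U = n >].
have exB : exists n, B n.
  exists 0%N; apply/asboolP; exists 0%VS; rewrite dimv0; split=> // v.
  by rewrite memv0 => /eqP ->.
have ubB n : B n -> (n <= dim V)%N.
  by move=> /asboolP[U [_ <-]]; rewrite -[X in (_ <= X)%N]dimvf; apply/dimvS/subvf.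
case: (ex_maxnP exB ubB) => n /asboolP[U [UP dU]] maxn.
exists U => v; split=> [Pv|/UP//]; apply: contrapT => /negP nUv.
have /maxn : B (\dim (U + <[v]>)).
  apply/asboolP; exists (U + <[v]>)%VS; split=> // _ /memv_addP[u Uu [_ /vlineP[a ->] ->]].
  by apply: PD; [apply: UP | apply: PZ].
have v0 : v != 0 by apply: contraNneq nUv => ->; apply: mem0v.
rewrite dimv_disjoint_sum ?dim_vline ?v0 ?dU ?addn1 ?ltnn //.
apply/eqP; rewrite -subv0; apply/subvP => u /memv_capP[Uu /vlineP[a ua]].
rewrite memv0; apply: contraNT nUv => u0.
have a0 : a != 0 by apply: contraNneq u0 => a0; rewrite ua a0 scale0r.
by rewrite -[v]scale1r -(mulVf a0) -scalerA -ua memvZ.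
Qed.

Lemma tangent_vspace X x : exists U : {vspace V}, forall v, tangent X x v <-> v \in U.
Proof.
apply: linear_set_vspace; [exact: tangent0 | exact: tangentD | exact: tangentZ].
Qed.

(** Two nonzero functions are nonzero at some common point of the line joining points
    where each is nonzero. *)
Lemma irreducible_setT : irreducible [set: V].
Proof.
apply/irreducible_vprime; split; first by exists 0.
move=> p q pq0; apply: contrapT => /not_orP[/not_ideal[x [_ px]] /not_ideal[y [_ qy]]].
have p0 : line_pol p x (y - x) != 0.
  by apply: contraNneq px => /(congr1 (fun F : {poly k} => F`_0)); rewrite line_pol0 coef0 => ->.
have q0 : line_pol q x (y - x) != 0.
  apply: contraNneq qy => /(congr1 (fun F : {poly k} => F.[1])).
  by rewrite line_pol_horner horner0 scale1r addrC subrK => ->.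
have /closed_nonrootP[t] := mulf_neq0 p0 q0.
by rewrite rootE hornerM !line_pol_horner -pevalM pq0 ?eqxx.
Qed.

End Differential.

Lemma krull_dim_setT (V : vectType k) : [pchar k] =i pred0 -> krull_dim [set: V] = dim V.
Proof.
move=> char0.
have [|h [nh hP]] := generic_smooth_point char0 (@irreducible_setT V).
  apply: zclosed_open_in_closure; last by exists 0.
  by exists set0; apply/seteqP; split=> // x _ p [].
have [x [Tx hx]] := not_ideal nh; have [_ <-] := hP x Tx hx.
rewrite (@vdimE _ _ _ fullv) ?dimvf // => v; rewrite memvf; split=> // _ p p0.
by apply: pdiff_vanish => y; apply: p0.
Qed.

Section Slices.
Variables U V : vectType k.

Let inl_linear : linear (fun u : U => (u, 0 : V)).
Proof. by move=> a u u'; congr (_, _); rewrite /= scaler0 addr0. Qed.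

Let inr_linear : linear (fun v : V => (0 : U, v)).
Proof. by move=> a u u'; congr (_, _); rewrite /= scaler0 addr0. Qed.

Lemma slice_left (p : polyfun (U * V)%type) v : exists q : polyfun U,
  (forall u, peval q u = peval p (u, v)) /\ forall u u', pdiff q u u' = pdiff p (u, v) (u', 0).
Proof.
have [q [q1 q2]] := peval_linear (mk_linear inl_linear) (0, v) p.
exists q; split=> [u|u u']; rewrite ?q1 ?q2 /=; congr (_ _ _); try congr (_, _);
  by rewrite /= ?addr0 ?add0r //; congr (_, _); rewrite /= ?addr0 ?add0r.
Qed.

Lemma slice_right (p : polyfun (U * V)%type) u : exists q : polyfun V,
  (forall v, peval q v = peval p (u, v)) /\ forall v v', pdiff q v v' = pdiff p (u, v) (0, v').
Proof.
have [q [q1 q2]] := peval_linear (mk_linear inr_linear) (u, 0) p.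
have E v : (0, v) + (u, 0) = (u, v) :> (U * V)%type.
  by congr (_, _); rewrite /= ?addr0 ?add0r.
by exists q; split=> [v|v v']; rewrite ?q1 ?q2 /= E.
Qed.

(** Slice twice: a point of X where the two slices through given points of Y are
    nonzero, then a point of Y. *)
Lemma irreducible_prod (X : set U) (Y : set V) :
  irreducible X -> irreducible Y -> irreducible (X `*` Y).
Proof.
move=> irX irY; apply/irreducible_vprime; split.
  by case: irX irY => [[x Xx] _] [[y Yy] _]; exists (x, y).
move=> p q pq0; apply: contrapT => /not_orP[].
move=> /not_ideal[[x1 y1] [[Xx1 Yy1] p1]] /not_ideal[[x2 y2] [[Xx2 Yy2] q2]].
have [p' [p'E _]] := slice_left p y1; have [q' [q'E _]] := slice_left q y2.
have [x [Xx]] : exists x, X x /\ peval (p' * q') x != 0.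
  apply/not_ideal/ideal_prime_notin => // /(_ _ _)/eqP.
    by move=> /(_ x1 Xx1); rewrite p'E (negbTE p1).
  by move=> /(_ x2 Xx2); rewrite q'E (negbTE q2).
rewrite pevalM mulf_eq0 negb_or p'E q'E => /andP[px qx].
have [p'' [p''E _]] := slice_right p x; have [q'' [q''E _]] := slice_right q x.
have [y [Yy]] : exists y, Y y /\ peval (p'' * q'') y != 0.
  apply/not_ideal/ideal_prime_notin => // /(_ _ _)/eqP.
    by move=> /(_ y1 Yy1); rewrite p''E (negbTE px).
  by move=> /(_ y2 Yy2); rewrite q''E (negbTE qx).
by rewrite pevalM p''E q''E -pevalM pq0 ?eqxx.
Qed.

End Slices.

Section SmoothMorphisms.
Variables (V W : vectType k) (X : set V) (Y : set W) (phi : V -> W).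
Hypothesis XY : forall x, X x -> Y (phi x).

(** The relative differentials of the local equations are independent, so they take
    any prescribed values; choose v to cancel the contribution of t.  The remaining
    functions vanishing on the graph are combinations of the equations up to
    functions vanishing on Y x V, and up to a factor that is not zero at the
    point. *)
Lemma smooth_at_tangent x t : smooth_at X Y phi x -> tangent Y (phi x) t ->
  exists v, forall f : polyfun (W * V)%type,
    (forall x', X x' -> peval f (phi x', x') = 0) -> pdiff f (phi x, x) (t, v) = 0.
Proof.
move=> [Xx [c [g [g0 gen indep]]]] tY.
pose D i (v : V) := pdiff (g i) (phi x, x) (0, v).
have DD i v v' : D i (v + v') = D i v + D i v'.
  by rewrite /D -pdiffDr; congr (pdiff _ _ _); congr (_, _); rewrite /= addr0.
have DZ i a v : D i (a *: v) = a * D i v.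
  by rewrite /D -pdiffZr; congr (pdiff _ _ _); congr (_, _); rewrite /= scaler0.
have D0 i : D i 0 = 0 by exact: pdiff0r.
pose M : 'M[k]_(dim V, c) := \matrix_(j, i) D i (r2v (delta_mx 0 j)).
have MP (u : 'rV_(dim V)) i : (u *m M) 0 i = D i (r2v u).
  rewrite mxE [in RHS](row_sum_delta u) linear_sum (big_morph (D i) (DD i) (D0 i)).
  by apply: eq_bigr => j _; rewrite mxE linearZ DZ.
have /row_fullP[B BM] : row_full M.
  suff : row_free M^T by rewrite /row_free mxrank_tr.
  apply: inj_row_free => a aM.
  have a0 := indep (a 0); apply/rowP => i; rewrite mxE; apply: a0 => v.
  rewrite -[v]v2rK -[RHS](_ : (v2r v *m (a *m M^T)^T) 0 0 = 0); last first.
    by rewrite aM trmx0 mulmx0 mxE.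
  rewrite trmx_mul trmxK mulmxA mxE; apply: eq_bigr => l _.
  by rewrite MP mxE mulrC.
pose b : 'rV_c := \row_i - pdiff (g i) (phi x, x) (t, 0).
exists (r2v (b *m B)).
set v := r2v _.
have split_tv : (t, v) = (t, 0) + (0, v) by congr (_, _); rewrite /= ?addr0 ?add0r.
have gtv i : pdiff (g i) (phi x, x) (t, v) = 0.
  rewrite split_tv pdiffDr -/(D i v) /v -MP -mulmxA BM mulmx1 mxE.
  exact: subrr.
move=> f f0; have [h [q [hx hq]]] := gen f f0.
pose F := h * f - \sum_i q i * g i.
have F0 y v' : Y y -> peval F (y, v') = 0.
  move=> Yy; rewrite /peval rmorphB rmorph_sum /= -/(peval (h * f) _) pevalM hq //.
  by apply/eqP; rewrite subr_eq0; apply/eqP/eq_bigr => i _; rewrite -pevalM.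
have : pdiff F (phi x, x) (t, v) = 0.
  rewrite split_tv pdiffDr.
  have [q1 [q1E q1d]] := slice_left F x; rewrite -q1d tY ?add0r; last first.
    by move=> y Yy; rewrite q1E F0.
  have [q2 [q2E q2d]] := slice_right F (phi x); rewrite -q2d pdiff_vanish // => v'.
  by rewrite q2E F0 //; apply: XY.
rewrite /F pdiffD pdiffN pdiff_sum pdiffM f0 // mulr0 addr0 big1 => [|i _]; last first.
  by rewrite pdiffM gtv g0 // mulr0 mulr0 addr0.
by rewrite subr0 => /eqP; rewrite mulf_eq0 (negbTE hx) => /eqP.
Qed.

End SmoothMorphisms.

Section Transport.

Lemma prod_linear (U U' V V' : lmodType k) (f : {linear U -> U'}) (g : {linear V -> V'}) :
  linear (fun z : U * V => (f z.1, g z.2)).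
Proof. by move=> a z z'; congr (_, _); rewrite /= linearP. Qed.

Lemma smooth_at_transport (V W : vectType k) (X : set V) (Y : set W) (phi : V -> W)
    (sV sV' : {linear V -> V}) (sW sW' : {linear W -> W}) x :
    cancel sV' sV -> cancel sV sV' -> cancel sW' sW -> cancel sW sW' ->
    (forall x, X x -> X (sV x)) -> (forall x, X x -> X (sV' x)) ->
    (forall y, Y y -> Y (sW y)) ->
    (forall x, X x -> phi (sV x) = sW (phi x)) -> X x ->
  smooth_at X Y phi (sV x) -> smooth_at X Y phi x.
Proof.
move=> sVK' sVK sWK' sWK XsV XsV' YsW phis Xx [_ [c [g [g0 gen indep]]]].
split=> //.
have phis' y : X y -> phi (sV' y) = sW' (phi y).
  by move=> Xy; rewrite -[in RHS](sVK' y) phis ?sWK //; apply: XsV'.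
pose s := mk_linear (prod_linear sW sV); pose s' := mk_linear (prod_linear sW' sV').
have comp (f : polyfun (W * V)%type) : exists f' : polyfun (W * V)%type,
    (forall z, peval f' z = peval f (s z)) /\ (forall z v, pdiff f' z v = pdiff f (s z) (s v)).
  have [f' [f1 f2]] := peval_linear s 0 f; exists f'.
  by split=> [z|z v]; rewrite ?f1 ?f2 addr0.
have comp' (f : polyfun (W * V)%type) : exists f' : polyfun (W * V)%type,
    (forall z, peval f' z = peval f (s' z)).
  by have [f' [f1 f2]] := peval_linear s' 0 f; exists f' => z; rewrite f1 addr0.
have /choice[g' g'P] := fun i => comp (g i).
have sx : s (phi x, x) = (phi (sV x), sV x) by rewrite /= phis.
exists c, g'; split.
- move=> i y Xy; have [-> _] := g'P i; rewrite /= -phis //; apply: g0; exact: XsV.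
- move=> f f0; have [f' f'E] := comp' f.
  have [|h [q [hx hq]]] := gen f'.
    by move=> y Xy; rewrite f'E /= -phis' // f0 //; apply: XsV'.
  have [h' [h'E _]] := comp h; have /choice[q' q'P] := fun i => comp (q i).
  exists h', q'; rewrite h'E sx; split=> // y v Yy.
  rewrite h'E; have := hq (sW y) (sV v) (YsW y Yy).
  rewrite f'E /= sWK sVK => ->; apply: eq_bigr => i _.
  by have [-> _] := g'P i; have [-> _] := q'P i.
- move=> a a0; apply: indep => v; rewrite -[RHS](a0 (sV' v)); apply: eq_bigr => i _.
  by have [_ ->] := g'P i; rewrite sx /= linear0 sVK'.
Qed.

Section Point.
Variables (V : vectType k) (Y : set V) (s s' : {linear V -> V}).
Hypotheses (sK : cancel s s') (s'K : cancel s' s).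
Hypotheses (Ys : forall y, Y y -> Y (s y)) (Ys' : forall y, Y y -> Y (s' y)).

Lemma tangent_transport y v : tangent Y y v -> tangent Y (s y) (s v).
Proof.
move=> tv p Yp; have [p' [p1 p2]] := peval_linear s 0 p.
have := p2 y v; rewrite addr0 => <-; apply: tv => z Yz; rewrite p1 addr0.
by apply: Yp; apply: Ys.
Qed.

Lemma chain_transport y n :
  chain [set Z | [/\ zclosed_in Y Z, irreducible Z & Z (s y)]] n ->
  chain [set Z | [/\ zclosed_in Y Z, irreducible Z & Z y]] n.
Proof.
move=> [Z Zi ltZ]; exists (fun i => [set z | Z i (s z)]) => [i /Zi[[F [S SF] ZF] irZ Zy]|i /ltZ].
  split=> //.
  - exists [set z | F (s z)].
      exists [set p | exists2 q, S q & forall z, peval p z = peval q (s z)].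
      apply/seteqP; split=> z /=.
        by rewrite SF => Fz p [q Sq ->]; apply: Fz.
      move=> pz; rewrite SF => q Sq; have [p [p1 _]] := peval_linear s 0 q.
      rewrite -[s z]addr0 -p1; apply: pz; exists q => // z'; by rewrite p1 addr0.
    apply/seteqP; split=> z /=; rewrite ZF => -[Yz Fz]; split=> //; last exact: Ys.
    by rewrite -(sK z); apply: Ys'.
  - rewrite (_ : [set z | _] = s' @` Z i).
      by apply: irreducible_image => //; apply: linear_regular_map.
    apply/seteqP; split=> z /=; first by move=> Zz; exists (s z).
    by move=> [u Zu <-]; rewrite s'K.
move=> [sub nsub]; split=> [z|sub']; first exact: sub.
by apply: nsub => z Zz; rewrite -(s'K z); apply: sub'; rewrite /= s'K.
Qed.

End Point.

Lemma smooth_point_transport (V : vectType k) (Y : set V) (s s' : {linear V -> V}) y :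
    cancel s s' -> cancel s' s -> (forall y, Y y -> Y (s y)) -> (forall y, Y y -> Y (s' y)) ->
    smooth_point Y (s y) ->
  smooth_point Y y /\ vdim (tangent Y y) = vdim (tangent Y (s y)).
Proof.
move=> sK s'K Ys Ys' [Ysy dimY].
have dimT : vdim (tangent Y y) = vdim (tangent Y (s y)).
  have [U UP] := tangent_vspace Y y.
  rewrite (vdimE UP) (@vdimE _ _ _ (linfun s @: U)%VS) => [|v].
    symmetry; apply: limg_dim_eq; apply/eqP; rewrite -subv0; apply/subvP => v.
    rewrite memv_cap memv_ker lfunE memv0 => /andP[_ /eqP sv0].
    by rewrite -(sK v) sv0 linear0.
  split=> [tv|/memv_imgP[u /UP tu ->]]; last by rewrite lfunE; apply: tangent_transport.
  apply/memv_imgP; exists (s' v); last by rewrite lfunE /= s'K.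
  by apply/UP; rewrite -(sK y); apply: tangent_transport.
split=> //; split; first by rewrite -(sK y); apply: Ys'.
rewrite dimT dimY /local_dim; congr nat_max; apply/seteqP; split=> n.
  exact: chain_transport.
move=> cy; apply: (@chain_transport _ _ s' s) => //.
by rewrite sK.
Qed.

End Transport.
End Geometry.

(** * Extensions of representations *)

Section MatrixFamilyTheory.
Variables (k : fieldType) (J : finType) (m n : J -> nat).
Implicit Types x y : mxfam k m n.

Lemma mxfam_ofK (F : forall j, 'M[k]_(m j, n j)) j : mxf (mxfam_of F) j = F j.
Proof. by apply/matrixP => r s; rewrite mxE ffunE. Qed.

Lemma mxf_inj x y : (forall j, mxf x j = mxf y j) -> x = y.
Proof.
move=> xy; apply/ffunP => -[j [r s]].
by have /matrixP/(_ r s) := xy j; rewrite !mxE.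
Qed.

Lemma mxfD x y j : mxf (x + y) j = mxf x j + mxf y j.
Proof. by apply/matrixP => r s; rewrite !mxE ffunE. Qed.

Lemma mxfZ a x j : mxf (a *: x) j = a *: mxf x j.
Proof. by apply/matrixP => r s; rewrite !mxE ffunE. Qed.

Lemma mxf0 j : mxf (0 : mxfam k m n) j = 0.
Proof. by apply/matrixP => r s; rewrite !mxE ffunE. Qed.

Lemma mxfN x j : mxf (- x) j = - mxf x j.
Proof. by apply/matrixP => r s; rewrite !mxE ffunE. Qed.

Lemma dim_mxfam : dim (mxfam k m n) = (\sum_j m j * n j)%N.
Proof.
have -> : dim (mxfam k m n) = (#|{: {j : J & ('I_(m j) * 'I_(n j))%type}}| * 1)%N by [].
rewrite muln1 card_tagged sumnE big_map big_enum /=.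
by apply: eq_bigr => j _; rewrite card_prod !card_ord.
Qed.

End MatrixFamilyTheory.

Lemma invmx_mul (k : fieldType) p (A B : 'M[k]_p) : A \in unitmx -> B \in unitmx ->
  invmx (A *m B) = invmx B *m invmx A.
Proof.
move=> uA uB; have uAB : A *m B \in unitmx by rewrite unitmx_mul uA.
by apply: (can_inj (mulKmx uAB)); rewrite mulmxV // mulmxA mulmxK // mulmxV.
Qed.

Lemma inj_square_unitmx (k : fieldType) m (A : 'M[k]_m) :
  (forall v : 'cV_m, A *m v = 0 -> v = 0) -> A \in unitmx.
Proof.
move=> Ainj; rewrite -unitmx_tr -row_free_unit; apply: inj_row_free => v vA.
apply: trmx_inj; rewrite trmx0; apply: Ainj.
by apply: trmx_inj; rewrite trmx_mul trmxK vA trmx0.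
Qed.

(** Choose preimages of the standard basis vectors. *)
Lemma section_exists (k : fieldType) p q (A : 'M[k]_(p, q)) :
  (forall w : 'cV_p, exists v, A *m v = w) -> exists B, A *m B = 1%:M.
Proof.
move=> Asurj; have /choice[s sP] : forall j, exists v, A *m v = col j 1%:M by move=> j.
exists (\matrix_(i, j) s j i 0); apply/matrixP => i j.
have /matrixP/(_ i 0) := sP j; rewrite !mxE => <-.
by apply: eq_bigr => l _; rewrite mxE.
Qed.

Section Extensions.
Variables (k : fieldType) (Q : quiver).
Variables d e : dimvec Q.
Local Notation n := (dadd e d).

Definition vmul (c : dimvec Q) (g h : vertex_maps k c c) : vertex_maps k c c :=
  mxfam_of (fun i => mxf g i *m mxf h i).

Definition vinv (c : dimvec Q) (g : vertex_maps k c c) : vertex_maps k c c :=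
  mxfam_of (fun i => invmx (mxf g i)).

Lemma gl_vmul (c : dimvec Q) (g h : vertex_maps k c c) : gl k c g -> gl k c h -> gl k c (vmul g h).
Proof. by move=> gg gh i; rewrite mxfam_ofK unitmx_mul gg gh. Qed.

Lemma gl_vinv (c : dimvec Q) (g : vertex_maps k c c) : gl k c g -> gl k c (vinv g).
Proof. by move=> gg i; rewrite mxfam_ofK unitmx_inv. Qed.

Lemma gl_gl1 (c : dimvec Q) : gl k c (gl1 k c).
Proof. by move=> i; rewrite mxfam_ofK unitmx1. Qed.

Lemma gl_act_vmul (c : dimvec Q) (g h : vertex_maps k c c) x : gl k c g -> gl k c h ->
  gl_act (vmul g h) x = gl_act g (gl_act h x).
Proof.
move=> gg gh; apply: mxf_inj => a; rewrite !mxfam_ofK.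
by rewrite -!mulmxA invmx_mul.
Qed.

Definition act (c : dimvec Q) (gy : vertex_maps k c c * rep k c) : rep k c :=
  gl_act gy.1 gy.2.
Arguments act {c} gy.

Lemma gl_act1 (c : dimvec Q) (x : rep k c) : gl_act (gl1 k c) x = x.
Proof. by apply: mxf_inj => a; rewrite !mxfam_ofK invmx1 mul1mx mulmx1. Qed.

Lemma vmulA (c : dimvec Q) (f g h : vertex_maps k c c) : vmul f (vmul g h) = vmul (vmul f g) h.
Proof. by apply: mxf_inj => i; rewrite !mxfam_ofK mulmxA. Qed.

Lemma vmulVg (c : dimvec Q) (g : vertex_maps k c c) : gl k c g -> vmul (vinv g) g = gl1 k c.
Proof. by move=> gg; apply: mxf_inj => i; rewrite !mxfam_ofK mulVmx. Qed.

Lemma vmulgV (c : dimvec Q) (g : vertex_maps k c c) : gl k c g -> vmul g (vinv g) = gl1 k c.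
Proof. by move=> gg; apply: mxf_inj => i; rewrite !mxfam_ofK mulmxV. Qed.

Lemma vmul1g (c : dimvec Q) (g : vertex_maps k c c) : vmul (gl1 k c) g = g.
Proof. by apply: mxf_inj => i; rewrite !mxfam_ofK mul1mx. Qed.

Lemma gl_actK (c : dimvec Q) (g : vertex_maps k c c) x : gl k c g -> gl_act (vinv g) (gl_act g x) = x.
Proof. by move=> gg; rewrite -gl_act_vmul ?vmulVg ?gl_act1 //; apply: gl_vinv. Qed.

Lemma gl_actVK (c : dimvec Q) (g : vertex_maps k c c) x : gl k c g -> gl_act g (gl_act (vinv g) x) = x.
Proof. by move=> gg; rewrite -gl_act_vmul ?vmulgV ?gl_act1 //; apply: gl_vinv. Qed.

Lemma gl_act_linear (c : dimvec Q) (g : vertex_maps k c c) : linear (@gl_act k Q c g).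
Proof.
move=> a x y; apply: mxf_inj => b; rewrite mxfD mxfZ !mxfam_ofK mxfD mxfZ.
by rewrite mulmxDr mulmxDl -scalemxAr -scalemxAl.
Qed.

Definition blockB (y : rep k n) : rep k e :=
  mxfam_of (fun a : arrow Q => ulsubmx (mxf y a : 'M_(e (hd a) + d (hd a), e (tl a) + d (tl a)))).
Definition blockZ (y : rep k n) : arrow_maps k d e :=
  mxfam_of (fun a : arrow Q => ursubmx (mxf y a : 'M_(e (hd a) + d (hd a), e (tl a) + d (tl a)))).
Definition blockL (y : rep k n) : arrow_maps k e d :=
  mxfam_of (fun a : arrow Q => dlsubmx (mxf y a : 'M_(e (hd a) + d (hd a), e (tl a) + d (tl a)))).
Definition blockA (y : rep k n) : rep k d :=
  mxfam_of (fun a : arrow Q => drsubmx (mxf y a : 'M_(e (hd a) + d (hd a), e (tl a) + d (tl a)))).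

Lemma mxf_extension N zeta M a : mxf (@extension k Q d e N zeta M) a =
  block_mx (mxf N a) (mxf zeta a) 0 (mxf M a).
Proof. exact: mxfam_ofK. Qed.

Lemma blockB_ext N zeta M : blockB (extension N zeta M) = N.
Proof. by apply: mxf_inj => a; rewrite mxfam_ofK mxf_extension block_mxKul. Qed.
Lemma blockA_ext N zeta M : blockA (extension N zeta M) = M.
Proof. by apply: mxf_inj => a; rewrite mxfam_ofK mxf_extension block_mxKdr. Qed.
Lemma blockL_ext N zeta M : blockL (extension N zeta M) = 0.
Proof. by apply: mxf_inj => a; rewrite mxfam_ofK mxf_extension block_mxKdl mxf0. Qed.

Lemma extension_blocks y : blockL y = 0 -> extension (blockB y) (blockZ y) (blockA y) = y.
Proof.
move=> yL; apply: mxf_inj => a; rewrite mxf_extension !mxfam_ofK.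
rewrite -[RHS](@submxK _ (e (hd a)) (d (hd a)) (e (tl a)) (d (tl a))).
by have := congr1 (fun f => mxf f a) yL; rewrite mxfam_ofK mxf0 => <-.
Qed.

Lemma blockB_linear : linear blockB.
Proof.
by move=> a x y; apply: mxf_inj => b; rewrite mxfD mxfZ !mxfam_ofK mxfD mxfZ; apply/matrixP => r s; rewrite !mxE.
Qed.
Lemma blockL_linear : linear blockL.
Proof.
by move=> a x y; apply: mxf_inj => b; rewrite mxfD mxfZ !mxfam_ofK mxfD mxfZ; apply/matrixP => r s; rewrite !mxE.
Qed.
Lemma blockA_linear : linear blockA.
Proof.
by move=> a x y; apply: mxf_inj => b; rewrite mxfD mxfZ !mxfam_ofK mxfD mxfZ; apply/matrixP => r s; rewrite !mxE.
Qed.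

Definition extension_of (t : rep k d * (rep k e * arrow_maps k d e)) : rep k n :=
  extension t.2.1 t.2.2 t.1.

Lemma extension_linear : linear extension_of.
Proof.
move=> a x y; apply: mxf_inj => b; rewrite /extension_of mxfD mxfZ !mxf_extension /=.
by rewrite !(mxfD, mxfZ) scale_block_mx add_block_mx scaler0 addr0.
Qed.

(** If N is the kernel and M the cokernel, a section of X -> M at each vertex gives a
    basis of X in which the representation has block form. *)
Lemma starE (cA : set (rep k d)) (cB : set (rep k e)) :
  star cA cB = @act n @` (gl k n `*` extensions cA cB).
Proof.
apply/seteqP; split=> X; last first.
  move=> [[g y] [/= gg [M [N [zeta [AM BN ->]]]]] <-].
  rewrite /act /=; exists M, N.
  exists (mxfam_of (fun i => mxf g i *m (col_mx 1%:M 0 : 'M_(e i + d i, e i)))).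
  exists (mxfam_of (fun i => (row_mx 0 1%:M : 'M_(d i, e i + d i)) *m invmx (mxf g i))).
  split=> //; split.
  - move=> a; rewrite !mxfam_ofK -!mulmxA (mulKmx (gg _)); congr (_ *m _).
    by rewrite mul_block_col mul_col_mx !mulmx1 !mulmx0 mul1mx mul0mx !addr0.
  - move=> a; rewrite !mxfam_ofK !mulmxA (mulmxKV (gg _)); congr (_ *m _).
    by rewrite mul_row_block mul_mx_row !mul1mx !mul0mx mulmx0 mulmx1 !add0r.
  - move=> i u; rewrite mxfam_ofK -mulmxA => /(congr1 (mulmx (invmx (mxf g i)))).
    rewrite (mulKmx (gg _)) mulmx0 mul_col_mx mul1mx => /(congr1 usubmx).
    by rewrite col_mxKu linear0.
  - move=> i w; exists (mxf g i *m col_mx 0 w).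
    by rewrite mxfam_ofK -mulmxA (mulKmx (gg _)) mul_row_col mul0mx mul1mx add0r.
  - move=> i v; rewrite !mxfam_ofK; split=> [|[u ->]]; last first.
      have rc0 : (row_mx 0 1%:M : 'M[k]_(d i, e i + d i)) *m (col_mx 1%:M 0 : 'M_(e i + d i, e i)) = 0.
        by rewrite mul_row_col mul0mx mulmx0 addr0.
      by rewrite !mulmxA (mulmxKV (gg _)) rc0 mul0mx.
    set v' := invmx (mxf g i) *m v; rewrite -mulmxA -/v' => v0.
    exists (usubmx (v' : 'cV_(e i + d i))); rewrite -mulmxA.
    rewrite -[LHS](mulKVmx (gg i)) -/v'; congr (_ *m _).
    rewrite mul_col_mx mul1mx mul0mx -[LHS](@vsubmxK _ (e i) (d i)); congr col_mx.
    by move: v0; rewrite -[v' in LHS](@vsubmxK _ (e i) (d i)) mul_row_col mul0mx mul1mx add0r.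
move=> [M [N [f [g [AM BN [fN gM finj gsurj exact]]]]]].
have sec i : exists s, mxf g i *m s = 1%:M by apply: section_exists; apply: gsurj.
pose s i := sval (cid (sec i)); have sP i : mxf g i *m s i = 1%:M := svalP (cid (sec i)).
have gf i : mxf g i *m mxf f i = 0.
  apply/matrixP => r c; have /colP/(_ r) : mxf g i *m col c (mxf f i) = 0.
    by apply/exact; exists (delta_mx c 0); rewrite colE.
  by rewrite colE mulmxA -colE [LHS]mxE [RHS]mxE => ->; rewrite mxE.
pose h : vertex_maps k n n := mxfam_of (fun i => row_mx (mxf f i) (s i) : 'M_(e i + d i)).
have hE i : mxf h i = row_mx (mxf f i) (s i) by rewrite mxfam_ofK.
have hgl : gl k n h.
  move=> i; apply: inj_square_unitmx => v; rewrite hE.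
  rewrite -[v](@vsubmxK _ (e i) (d i)) mul_row_col => hv.
  have dv0 : dsubmx (v : 'cV_(e i + d i)) = 0.
    have := congr1 (mulmx (mxf g i)) hv.
    by rewrite mulmxDr !mulmxA gf sP mul0mx add0r mul1mx mulmx0.
  move: hv; rewrite dv0 mulmx0 addr0 => /finj ->.
  by rewrite col_mx0.
pose y := gl_act (vinv h) X.
have yE a : mxf y a = invmx (mxf h (hd a)) *m mxf X a *m mxf h (tl a).
  by rewrite /y !mxfam_ofK invmxK.
have yX : gl_act h y = X by exact: gl_actVK.
clearbody y.
have hy a : mxf h (hd a) *m mxf y a = mxf X a *m mxf h (tl a).
  by rewrite yE !mulmxA mulmxV // mul1mx.
have gh i : mxf g i *m mxf h i = row_mx 0 1%:M by rewrite hE mul_mx_row gf sP.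
have gX a : row_mx 0 1%:M *m mxf y a = mxf M a *m row_mx 0 (1%:M : 'M_(d (tl a))).
  by rewrite -gh -mulmxA hy mulmxA gM -mulmxA gh.
have fX a : mxf y a *m col_mx 1%:M 0 = (col_mx 1%:M 0 : 'M_(e (hd a) + d (hd a), _)) *m mxf N a.
  apply: (can_inj (mulKmx (hgl (hd a)))); rewrite mulmxA hy -mulmxA.
  have hcol i : mxf h i *m col_mx 1%:M 0 = mxf f i.
    by rewrite hE mul_row_col mulmx1 mulmx0 addr0.
  by rewrite hcol -fN mulmxA hcol.
exists (h, y) => //.
split=> //=; exists M, N, (blockZ y); split=> //.
apply: mxf_inj => a; rewrite mxf_extension mxfam_ofK.
rewrite -[LHS](@submxK _ (e (hd a)) (d (hd a)) (e (tl a)) (d (tl a))).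
have := gX a; rewrite -{1}[mxf y a](@submxK _ (e (hd a)) (d (hd a)) (e (tl a)) (d (tl a))).
rewrite mul_row_block !mul0mx !mul1mx !add0r mul_mx_row mulmx0 mulmx1.
move=> /eq_row_mx[eL eA].
have := fX a; rewrite -{1}[mxf y a](@submxK _ (e (hd a)) (d (hd a)) (e (tl a)) (d (tl a))).
rewrite mul_block_col !mulmx1 !mulmx0 !addr0 mul_col_mx mul1mx mul0mx.
move=> /eq_col_mx[eB _].
by congr (block_mx _ _ _ _).
Qed.

End Extensions.

Arguments act {k Q c} gy.

(** * Regular functions and the graph of a group action *)

Section RegularFunctions.
Variable k : closedFieldType.

Definition mxfam_delta (J : finType) (m n : J -> nat) u : mxfam k m n := [ffun v => (v == u)%:R].

Lemma mxfam_coord (J : finType) (m n : J -> nat) (x : mxfam k m n) i :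
  v2r x 0 i = \sum_u (x u : k) * v2r (mxfam_delta u : mxfam k m n) 0 i.
Proof.
have {1}-> : x = \sum_u (x u : k) *: (mxfam_delta u : mxfam k m n).
  apply/ffunP => v; rewrite sum_ffunE (bigD1 v) //= big1 ?addr0 => [|u uv].
    by rewrite !ffunE eqxx; exact: esym (mulr1 _).
  by rewrite !ffunE eq_sym (negbTE uv); exact: mulr0.
by rewrite linear_sum summxE; apply: eq_bigr => u _; rewrite linearZ mxE.
Qed.

Section Algebra.
Variable U : vectType k.
Implicit Types f g : U -> k.

Lemma regular_ext f g : f =1 g -> regular f -> regular g.
Proof. by move=> fg [p pP]; exists p => x; rewrite pP. Qed.

Lemma regular_const (c : k) : regular (fun _ : U => c).
Proof. by exists c%:MP => x; rewrite pevalC. Qed.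

Lemma regularD f g : regular f -> regular g -> regular (fun x => f x + g x).
Proof. by move=> [p pP] [q qP]; exists (p + q) => x; rewrite pevalD pP qP. Qed.

Lemma regularM f g : regular f -> regular g -> regular (fun x => f x * g x).
Proof. by move=> [p pP] [q qP]; exists (p * q) => x; rewrite pevalM pP qP. Qed.

Lemma regular_sum (I : Type) (s : seq I) (P : pred I) (F : I -> U -> k) :
  (forall i, regular (F i)) -> regular (fun x => \sum_(i <- s | P i) F i x).
Proof.
move=> rF; elim: s => [|i s IHs].
  by apply: (regular_ext _ (regular_const 0)) => x; rewrite big_nil.
have [Pi|nPi] := boolP (P i).
  by apply: (regular_ext _ (regularD (rF i) IHs)) => x; rewrite big_cons Pi.
by apply: (regular_ext _ IHs) => x; rewrite big_cons (negbTE nPi).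
Qed.

Lemma regular_prod (I : Type) (s : seq I) (P : pred I) (F : I -> U -> k) :
  (forall i, regular (F i)) -> regular (fun x => \prod_(i <- s | P i) F i x).
Proof.
move=> rF; elim: s => [|i s IHs].
  by apply: (regular_ext _ (regular_const 1)) => x; rewrite big_nil.
have [Pi|nPi] := boolP (P i).
  by apply: (regular_ext _ (regularM (rF i) IHs)) => x; rewrite big_cons Pi.
by apply: (regular_ext _ IHs) => x; rewrite big_cons (negbTE nPi).
Qed.

Definition regular_mx p q (A : U -> 'M[k]_(p, q)) := forall i j, regular (fun x => A x i j).

Lemma regular_mulmx p q r (A : U -> 'M_(p, q)) (B : U -> 'M_(q, r)) :
  regular_mx A -> regular_mx B -> regular_mx (fun x => A x *m B x).
Proof.
move=> rA rB i j; apply: (@regular_ext (fun x => \sum_l A x i l * B x l j)).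
  by move=> x; rewrite mxE.
by apply: regular_sum => l; apply: regularM.
Qed.

Lemma regular_det p (A : U -> 'M_p) : regular_mx A -> regular (fun x => \det (A x)).
Proof.
move=> rA; apply: regular_sum => s; apply: regularM; first exact: regular_const.
by apply: regular_prod => i; apply: rA.
Qed.

Lemma regular_adj p (A : U -> 'M_p) : regular_mx A -> regular_mx (fun x => \adj (A x)).
Proof.
move=> rA i j; apply: (@regular_ext (fun x => cofactor (A x) j i)) => [x|].
  by rewrite mxE.
apply: regularM; first exact: regular_const.
apply: regular_det => r s; apply: (@regular_ext (fun x => A x (lift j r) (lift i s))) => [x|].
  by rewrite !mxE.
exact: rA.
Qed.

Lemma regular_linear_comp (V : vectType k) (L : {linear U -> V}) (f : V -> k) :
  regular f -> regular (fun x => f (L x)).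
Proof.
move=> [p pP]; have [q qP] := regular_comp p (linear_regular_map L).
by exists q => x; rewrite qP pP.
Qed.

Lemma regular_mxf (J : finType) (m n : J -> nat) (L : {linear U -> mxfam k m n}) j :
  regular_mx (fun x => mxf (L x) j).
Proof.
move=> r s; pose l (x : U) : k^o := mxf (L x) j r s.
have ll : linear l by move=> a x y; rewrite /l linearP mxfD mxfZ 2!mxE.
exact: (linear_regular (mk_linear ll)).
Qed.

Lemma regular_map_linear (V V' : vectType k) (L : {linear V -> V'}) (f : U -> V) :
  regular_map f -> regular_map (fun x => L (f x)).
Proof.
move=> rf i; have [p pP] := linear_regular_map L i.
by have [q qP] := regular_comp p rf; exists q => x; rewrite qP pP.
Qed.

Lemma regular_mapD (V : vectType k) (f g : U -> V) :
  regular_map f -> regular_map g -> regular_map (fun x => f x + g x).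
Proof.
move=> rf rg i; apply: (regular_ext _ (regularD (rf i) (rg i))) => x.
by rewrite linearD mxE.
Qed.

Lemma regular_map_pair (V V' : vectType k) (f : U -> V) (g : U -> V') :
  regular_map f -> regular_map g -> regular_map (fun x => (f x, g x)).
Proof.
have l1 : linear (fun v : V => (v, 0 : V')).
  by move=> a u u'; congr (_, _); rewrite /= scaler0 addr0.
have l2 : linear (fun v : V' => (0 : V, v)).
  by move=> a u u'; congr (_, _); rewrite /= scaler0 addr0.
move=> rf rg i.
have := regular_mapD (regular_map_linear (mk_linear l1) rf) (regular_map_linear (mk_linear l2) rg).
move=> /(_ i); apply: regular_ext => x; congr (v2r _ _ _).
by congr (_, _); rewrite /= ?addr0 ?add0r.
Qed.

Lemma regular_mapZ (V : vectType k) (a : U -> k) (f : U -> V) :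
  regular a -> regular_map f -> regular_map (fun x => a x *: f x).
Proof.
move=> ra rf i; apply: (regular_ext _ (regularM ra (rf i))) => x.
by rewrite linearZ mxE.
Qed.

Lemma regular_map_mxfam (J : finType) (m n : J -> nat) (f : U -> mxfam k m n) :
  (forall j, regular_mx (fun x => mxf (f x) j)) -> regular_map f.
Proof.
move=> rf i.
apply: (regular_ext (fun x => esym (mxfam_coord (f x) i))).
apply: regular_sum => -[j [r s]]; apply: regularM; last exact: regular_const.
by apply: (regular_ext _ (rf j r s)) => x; rewrite mxE.
Qed.

End Algebra.
End RegularFunctions.

Section GroupAction.
Variables (k : closedFieldType) (Q : quiver) (c : dimvec Q).
Local Notation VM := (vertex_maps k c c).
Local Notation R := (rep k c).
Local Notation VR := (VM * R)%type.

Definition gdet (g : VM) : k := \prod_i \det (mxf g i).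

Lemma gdet_unit g : gl k c g <-> gdet g != 0.
Proof.
rewrite /gl /gdet /=; split=> [gg|/prodf_neq0 gg i].
  by apply/prodf_neq0 => i _; rewrite -unitfE -unitmxE.
by rewrite unitmxE unitfE gg.
Qed.

(** The action multiplied by the determinant, with adjugate matrices instead of
    inverses. *)
Definition act_num (gy : VR) : R := mxfam_of (fun a : arrow Q =>
  (\prod_(i | i != tl a) \det (mxf gy.1 i)) *:
    (mxf gy.1 (hd a) *m mxf gy.2 a *m \adj (mxf gy.1 (tl a)))).

Lemma act_numE gy : gl k c gy.1 -> act_num gy = gdet gy.1 *: act gy.
Proof.
move=> gg; apply: mxf_inj => a; rewrite mxfZ !mxfam_ofK.
have ut := gg (tl a); rewrite /invmx ut -scalemxAr scalerA /gdet [in RHS](bigD1 (tl a)) //=.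
congr (_ *: _); rewrite mulrAC mulfV ?mul1r //.
by rewrite -unitfE -unitmxE.
Qed.

Lemma regular_mxf1 i : regular_mx (fun gy : VR => mxf gy.1 i).
Proof. exact: (regular_mxf (fst : {linear VR -> VM})). Qed.

Lemma regular_mxf2 a : regular_mx (fun gy : VR => mxf gy.2 a).
Proof. exact: (regular_mxf (snd : {linear VR -> R})). Qed.

Lemma regular_gdet : regular (fun gy : VR => gdet gy.1).
Proof. by apply: regular_prod => i; apply: regular_det; apply: regular_mxf1. Qed.

Lemma regular_act_num_mx a : regular_mx (fun gy => mxf (act_num gy) a).
Proof.
move=> r s.
apply: (@regular_ext _ _ (fun gy : VR => (\prod_(i | i != tl a) \det (mxf gy.1 i)) *
   (mxf gy.1 (hd a) *m mxf gy.2 a *m \adj (mxf gy.1 (tl a))) r s)) => [gy|].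
  by rewrite mxfam_ofK [RHS]mxE.
apply: regularM.
  by apply: regular_prod => i; apply: regular_det; apply: regular_mxf1.
apply: (regular_mulmx (regular_mulmx _ _)); [exact: regular_mxf1 | exact: regular_mxf2 |].
by apply: regular_adj; apply: regular_mxf1.
Qed.

Lemma regular_act_num : regular_map act_num.
Proof. exact: (regular_map_mxfam regular_act_num_mx). Qed.

(** The coordinates of the action become polynomial after multiplication by the
    determinant, hence so do polynomial expressions in them after multiplication
    by a power of it. *)
Lemma clear_denominators (f : polyfun (R * VR)%type) : exists N (F : polyfun VR),
  forall gy, gl k c gy.1 -> peval F gy = gdet gy.1 ^+ N * peval f (act gy, gy).
Proof.
have [D DP] := regular_gdet.
elim/mpoly_gen_ind: f => [b|i|p q [N1 [F1 E1]] [N2 [F2 E2]]|p q [N1 [F1 E1]] [N2 [F2 E2]]].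
- by exists 0%N, b%:MP => gy _; rewrite !pevalC expr0 mul1r.
- have r : regular_map (fun gy : VR => (act_num gy, gdet gy.1 *: gy)).
    apply: regular_map_pair; first exact: regular_act_num.
    apply: regular_mapZ; first exact: regular_gdet.
    by move=> j; exists 'X_j => x; rewrite pevalX.
  have [F FP] := r i; exists 1%N, F => gy gg; rewrite FP act_numE // pevalX expr1.
  have -> : (gdet gy.1 *: act gy, gdet gy.1 *: gy) = gdet gy.1 *: (act gy, gy) by [].
  by rewrite linearZ mxE.
- exists (N1 + N2)%N, (D ^+ N2 * F1 + D ^+ N1 * F2) => gy gg.
  have DX N : peval (D ^+ N) gy = gdet gy.1 ^+ N by rewrite /peval rmorphXn -DP.
  by rewrite pevalD !pevalM !DX E1 // E2 // pevalD exprD; ring.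
- exists (N1 + N2)%N, (F1 * F2) => gy gg.
  by rewrite !pevalM E1 // E2 // exprD; ring.
Qed.

Lemma gdet1 : gdet (gl1 k c) = 1.
Proof. by rewrite /gdet big1 // => i _; rewrite mxfam_ofK det1. Qed.

(** Clear denominators, and use that all matrix families times E is irreducible while
    the determinant is not identically zero. *)
Lemma irreducible_graph_act (E : set R) : irreducible E ->
  irreducible (graph (gl k c `*` E) act).
Proof.
move=> irE; have irP := irreducible_prod (@irreducible_setT k VM) irE.
have [D DP] := regular_gdet.
apply/irreducible_vprime; split.
  case: irE => [[y Ey] _]; exists (act (gl1 k c, y), (gl1 k c, y)), (gl1 k c, y) => //.
  by split=> //; apply: gl_gl1.
move=> p q pq0.
have [N1 [F1 E1]] := clear_denominators p; have [N2 [F2 E2]] := clear_denominators q.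
have key (r : polyfun (R * VR)%type) N (F : polyfun VR) :
    (forall gy, gl k c gy.1 -> peval F gy = gdet gy.1 ^+ N * peval r (act gy, gy)) ->
    ideal_of (setT `*` E) F -> ideal_of (graph (gl k c `*` E) act) r.
  move=> EF F0 _ [gy [gg Ey] ->]; have /eqP := F0 gy (conj I Ey).
  rewrite EF // mulf_eq0 expf_eq0; have /gdet_unit/negbTE -> := gg.
  by rewrite andbF /= => /eqP.
have D0 : ~ ideal_of (setT `*` E) D.
  case: irE => [[y Ey] _] /(_ (gl1 k c, y) (conj I Ey))/eqP.
  by rewrite DP /= gdet1 oner_eq0.
have : ideal_of (setT `*` E) (D * (F1 * F2)).
  move=> gy [_ Ey]; rewrite !pevalM DP; have [->|gn0] := eqVneq (gdet gy.1) 0.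
    by rewrite mul0r.
  have gg : gl k c gy.1 by apply/gdet_unit.
  rewrite E1 // E2 // mulrACA -pevalM pq0 ?mulr0 ?mulr0 //.
  by exists gy.
move: irP => /irreducible_vprime[_ prP] /prP[//|/prP[F10|F20]].
  by left; exact: (key _ _ _ E1 F10).
by right; exact: (key _ _ _ E2 F20).
Qed.

End GroupAction.

(** * Tangent vectors along orbits *)

Section DirectionalDerivatives.
Variable k : closedFieldType.

Lemma pevalN (V : vectType k) (p : polyfun V) x : peval (- p) x = - peval p x.
Proof. exact: mevalN. Qed.

Lemma pdiffC (V : vectType k) (b : k) (x v : V) : pdiff (b%:MP : polyfun V) x v = 0.
Proof. by rewrite (@pdiffE _ _ _ _ _ b%:P) ?coefC // => t; rewrite pevalC hornerC. Qed.

Section Algebra.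
Variable U : vectType k.
Implicit Types (f g : U -> k) (x v : U).

Definition has_deriv f x v c := exists p : polyfun U, (forall y, peval p y = f y) /\ pdiff p x v = c.

Lemma has_deriv_unique f x v c c' : has_deriv f x v c -> has_deriv f x v c' -> c = c'.
Proof.
move=> [p [pf <-]] [q [qf <-]]; apply/eqP; rewrite -subr_eq0 -pdiffN -pdiffD.
by rewrite pdiff_vanish // => y; rewrite pevalD pevalN pf qf subrr.
Qed.

Lemma regular_has_deriv f x v : regular f -> exists c, has_deriv f x v c.
Proof. by move=> [p pP]; exists (pdiff p x v), p. Qed.

Lemma has_deriv_ext f g x v c : f =1 g -> has_deriv f x v c -> has_deriv g x v c.
Proof. by move=> fg [p [pP pc]]; exists p; split=> // y; rewrite pP. Qed.

Lemma has_derivC (a : k) x v : has_deriv (fun=> a) x v 0.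
Proof.
by exists a%:MP; split=> [y|]; [rewrite pevalC | exact: pdiffC].
Qed.

Lemma has_derivM f g x v c c' : has_deriv f x v c -> has_deriv g x v c' ->
  has_deriv (fun y => f y * g y) x v (f x * c' + c * g x).
Proof.
move=> [p [pf <-]] [q [qf <-]]; exists (p * q); split=> [y|].
  by rewrite pevalM pf qf.
by rewrite pdiffM pf qf.
Qed.

Lemma has_deriv_sum (I : finType) (F : I -> U -> k) (c : I -> k) x v :
  (forall i, has_deriv (F i) x v (c i)) ->
  has_deriv (fun y => \sum_i F i y) x v (\sum_i c i).
Proof.
move=> /choice[p pP]; exists (\sum_i p i); split=> [y|].
  by rewrite /peval rmorph_sum; apply: eq_bigr => i _; have [<- _] := pP i.
by rewrite pdiff_sum; apply: eq_bigr => i _; have [_ <-] := pP i.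
Qed.

Lemma has_deriv_coord i x v : has_deriv (fun y : U => v2r y 0 i) x v (v2r v 0 i).
Proof.
exists 'X_i; split=> [y|]; first by rewrite pevalX.
rewrite (@pdiffE _ _ _ _ _ ((v2r x 0 i)%:P + v2r v 0 i *: 'X)).
  by rewrite coefD coefC coefZ coefX add0r mulr1.
by move=> t; rewrite pevalX linearD linearZ !mxE hornerD hornerC hornerZ hornerX mulrC.
Qed.

Definition has_deriv_mx p q (A : U -> 'M[k]_(p, q)) x v (dA : 'M[k]_(p, q)) :=
  forall i j, has_deriv (fun y => A y i j) x v (dA i j).

Lemma has_deriv_mulmx p q r (A : U -> 'M_(p, q)) (B : U -> 'M_(q, r)) x v dA dB :
  has_deriv_mx A x v dA -> has_deriv_mx B x v dB ->
  has_deriv_mx (fun y => A y *m B y) x v (A x *m dB + dA *m B x).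
Proof.
move=> hA hB i j; rewrite !mxE -big_split.
apply: (@has_deriv_ext (fun y => \sum_l A y i l * B y l j)) => [y|]; first by rewrite mxE.
by apply: has_deriv_sum => l; apply: has_derivM.
Qed.

Lemma has_deriv_scalemx p q (a : U -> k) (A : U -> 'M_(p, q)) x v da dA :
  has_deriv a x v da -> has_deriv_mx A x v dA ->
  has_deriv_mx (fun y => a y *: A y) x v (a x *: dA + da *: A x).
Proof.
move=> ha hA i j; rewrite !mxE.
apply: (@has_deriv_ext (fun y => a y * A y i j)) => [y|]; first by rewrite mxE.
exact: has_derivM.
Qed.

Lemma has_deriv_mx_unique p q (A : U -> 'M_(p, q)) x v dA dA' :
  has_deriv_mx A x v dA -> has_deriv_mx A x v dA' -> dA = dA'.
Proof. by move=> hA hA'; apply/matrixP => i j; apply: has_deriv_unique (hA i j) (hA' i j). Qed.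

Lemma has_deriv_mx_ext p q (A B : U -> 'M_(p, q)) x v dA :
  A =1 B -> has_deriv_mx A x v dA -> has_deriv_mx B x v dA.
Proof. by move=> AB hA i j; apply: has_deriv_ext (hA i j) => y; rewrite AB. Qed.

Lemma has_deriv_mxf (J : finType) (m n : J -> nat) (L : {linear U -> mxfam k m n}) j x v :
  has_deriv_mx (fun y => mxf (L y) j) x v (mxf (L v) j).
Proof.
move=> r s; pose l (x : U) : k^o := mxf (L x) j r s.
have ll : linear l by move=> a y z; rewrite /l linearP mxfD mxfZ 2!mxE.
have [p pP] := linear_regular (mk_linear ll).
exists p; split=> //.
rewrite (@pdiffE _ _ _ _ _ ((mxf (L x) j r s)%:P + mxf (L v) j r s *: 'X)).
  by rewrite coefD coefC coefZ coefX add0r mulr1.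
move=> t; rewrite pP /= /l linearD linearZ mxfD mxfZ !mxE.
by rewrite hornerD hornerC hornerZ hornerX [X in _ + X]mulrC.
Qed.

End Algebra.
End DirectionalDerivatives.

Section OrbitTangent.
Variables (k : closedFieldType) (Q : quiver) (c : dimvec Q).
Local Notation VM := (vertex_maps k c c).
Local Notation R := (rep k c).
Local Notation VR := (VM * R)%type.

Definition inf_act (xi : VM) (x : R) : R :=
  mxfam_of (fun a : arrow Q => mxf xi (hd a) *m mxf x a - mxf x a *m mxf xi (tl a)).

(** Differentiating act_num(g, y) g = det(g) g y avoids the differential of the
    adjugate matrix. *)
Lemma act_num_deriv y xi delta :
  has_deriv (fun gy : VR => gdet gy.1) (gl1 k c, y) (xi, 0) delta ->
  forall i, has_deriv (fun gy : VR => v2r (act_num gy) 0 i) (gl1 k c, y) (xi, 0)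
     (v2r (delta *: y + inf_act xi y) 0 i).
Proof.
move=> hd_delta i.
have /choice[D' hD'] : forall u, exists b, has_deriv (fun gy : VR => act_num gy u) (gl1 k c, y) (xi, 0) b.
  move=> [a [r s]]; apply: regular_has_deriv.
  by apply: (regular_ext _ (@regular_act_num_mx k Q c a r s)) => gy; rewrite mxE.
pose D : R := [ffun u => D' u].
have hD a : has_deriv_mx (fun gy : VR => mxf (act_num gy) a) (gl1 k c, y) (xi, 0) (mxf D a).
  move=> r s; rewrite mxE ffunE; apply: has_deriv_ext (hD' _) => gy; by rewrite mxE.
have num1 : act_num (gl1 k c, y) = y.
  by rewrite act_numE ?gdet1 ?scale1r ?/act ?gl_act1 //; apply: gl_gl1.
have -> : delta *: y + inf_act xi y = D.
  apply: mxf_inj => a; rewrite mxfD mxfZ mxfam_ofK.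
  have h1 : has_deriv_mx (fun gy : VR => mxf gy.1 (tl a)) (gl1 k c, y) (xi, 0) (mxf xi (tl a)).
    exact: (@has_deriv_mxf k VR _ _ _ (fst : {linear VR -> VM}) (tl a) (gl1 k c, y) (xi, 0)).
  have h2 : has_deriv_mx (fun gy : VR => mxf gy.1 (hd a)) (gl1 k c, y) (xi, 0) (mxf xi (hd a)).
    exact: (@has_deriv_mxf k VR _ _ _ (fst : {linear VR -> VM}) (hd a) (gl1 k c, y) (xi, 0)).
  have h3 : has_deriv_mx (fun gy : VR => mxf gy.2 a) (gl1 k c, y) (xi, 0) (mxf (0 : R) a).
    exact: (@has_deriv_mxf k VR _ _ _ (snd : {linear VR -> R}) a (gl1 k c, y) (xi, 0)).
  have eqAB : (fun gy : VR => mxf (act_num gy) a *m mxf gy.1 (tl a)) =1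
      (fun gy => gdet gy.1 *: (mxf gy.1 (hd a) *m mxf gy.2 a)).
    move=> gy; rewrite mxfam_ofK -scalemxAl -!mulmxA mul_adj_mx mul_mx_scalar -scalemxAr scalerA.
    by rewrite /gdet [in RHS](bigD1 (tl a)) //= mulrC.
  have hA := has_deriv_mulmx (hD a) h1.
  have hB := has_deriv_scalemx hd_delta (has_deriv_mulmx h2 h3).
  have := has_deriv_mx_unique (has_deriv_mx_ext eqAB hA) hB.
  rewrite num1 /= gdet1 mxf0 mulmx0 add0r scale1r !mxfam_ofK mulmx1 mul1mx => E.
  by rewrite addrA [X in X - _]addrC -E addrAC subrr add0r.
apply: (has_deriv_ext (fun gy => esym (mxfam_coord (act_num gy) i))).
rewrite (mxfam_coord D i); apply: has_deriv_sum => u.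
have := has_derivM (hD' u) (has_derivC (v2r (mxfam_delta k u : R) 0 i) (gl1 k c, y) (xi, 0)).
by rewrite mulr0 add0r ffunE.
Qed.

(** A version of [clear_denominators] for functions of the product only, which keeps
    track of the derivative at the identity: the quotient rule, proved along the
    generation of polynomials. *)
Lemma orbit_clear (p : polyfun R) : exists N (F : polyfun VR),
  (forall gy, gl k c gy.1 -> peval F gy = gdet gy.1 ^+ N * peval p (act gy)) /\
  forall y xi delta, has_deriv (fun gy : VR => gdet gy.1) (gl1 k c, y) (xi, 0) delta ->
    pdiff F (gl1 k c, y) (xi, 0) = N%:R * delta * peval p y + pdiff p y (inf_act xi y).
Proof.
have [D DP] := regular_gdet k c.
have act1 y : act (gl1 k c, y) = y by rewrite /act gl_act1.
have DX N gy : peval (D ^+ N) gy = gdet gy.1 ^+ N by rewrite /peval rmorphXn -DP.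
have Ddiff y xi delta : has_deriv (fun gy : VR => gdet gy.1) (gl1 k c, y) (xi, 0) delta ->
    forall N, pdiff (D ^+ N) (gl1 k c, y) (xi, 0) = N%:R * delta.
  move=> hdel; have D1 : pdiff D (gl1 k c, y) (xi, 0) = delta.
    by apply: has_deriv_unique hdel; exists D.
  elim=> [|N IHN].
    by rewrite expr0 mul0r -(mpolyC1 _ k) pdiffC.
  rewrite exprS pdiffM IHN D1 DX DP /= gdet1 expr1n mul1r mulr1.
  by rewrite -natr1 mulrDl mul1r.
elim/mpoly_gen_ind: p => [b|i|p q [N1 [F1 [E1 T1]]] [N2 [F2 [E2 T2]]]|p q [N1 [F1 [E1 T1]]] [N2 [F2 [E2 T2]]]].
- exists 0%N, b%:MP; split=> [gy _|y xi delta _]; first by rewrite !pevalC expr0 mul1r.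
  by rewrite !mul0r add0r !pdiffC.
- have [F FP] := @regular_act_num k Q c i; exists 1%N, F; split=> [gy gg|y xi delta hdel].
    by rewrite FP act_numE // expr1 linearZ mxE pevalX.
  have FD : has_deriv (fun gy : VR => v2r (act_num gy) 0 i) (gl1 k c, y) (xi, 0)
      (pdiff F (gl1 k c, y) (xi, 0)) by exists F.
  rewrite (has_deriv_unique FD (act_num_deriv hdel i)) linearD linearZ !mxE mul1r pevalX.
  congr (_ + _); apply: (has_deriv_unique (has_deriv_coord i y (inf_act xi y))).
  by exists 'X_i; split=> // z; rewrite pevalX.
- exists (N1 + N2)%N, (D ^+ N2 * F1 + D ^+ N1 * F2); split=> [gy gg|y xi delta hdel].
    by rewrite pevalD !pevalM !DX E1 // E2 // pevalD exprD; ring.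
  have F1y : peval F1 (gl1 k c, y) = peval p y.
    by rewrite E1 /= ?gdet1 ?expr1n ?mul1r ?act1 //; apply: gl_gl1.
  have F2y : peval F2 (gl1 k c, y) = peval q y.
    by rewrite E2 /= ?gdet1 ?expr1n ?mul1r ?act1 //; apply: gl_gl1.
  rewrite !(pdiffD, pdiffM) pevalD !(Ddiff _ _ _ hdel) (T1 _ _ _ hdel) (T2 _ _ _ hdel).
  by rewrite !DX F1y F2y /= gdet1 !expr1n natrD; ring.
- exists (N1 + N2)%N, (F1 * F2); split=> [gy gg|y xi delta hdel].
    by rewrite !pevalM E1 // E2 // exprD; ring.
  have F1y : peval F1 (gl1 k c, y) = peval p y.
    by rewrite E1 /= ?gdet1 ?expr1n ?mul1r ?act1 //; apply: gl_gl1.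
  have F2y : peval F2 (gl1 k c, y) = peval q y.
    by rewrite E2 /= ?gdet1 ?expr1n ?mul1r ?act1 //; apply: gl_gl1.
  rewrite !pdiffM pevalM (T1 _ _ _ hdel) (T2 _ _ _ hdel) F1y F2y natrD; ring.
Qed.

(** The function g |-> p(g x), cleared of denominators, vanishes on the invertible
    families, hence everywhere after multiplication by the determinant; its
    derivative at the identity is that of p along the infinitesimal action. *)
Lemma orbit_tangent (X : set R) x xi : (forall g y, gl k c g -> X y -> X (gl_act g y)) ->
  X x -> tangent X x (inf_act xi x).
Proof.
move=> gX Xx p Xp; have [N [F [E T]]] := orbit_clear p.
have [D DP] := regular_gdet k c.
have [delta hdel] := regular_has_deriv (gl1 k c, x) (xi, 0) (regular_gdet k c).
have := T x xi delta hdel; rewrite Xp // mulr0 add0r => <-.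
have F1 : peval F (gl1 k c, x) = 0.
  by rewrite E ?[act _]gl_act1 ?Xp ?mulr0 //; apply: gl_gl1.
have [q [q1 q2]] := slice_left (D * F) x.
have : pdiff q (gl1 k c) xi = 0.
  apply: pdiff_vanish => g; rewrite q1 pevalM DP /=.
  have [->|/gdet_unit gg] := eqVneq (gdet g) 0; first by rewrite mul0r.
  by rewrite E // Xp ?mulr0 //; apply: gX.
by rewrite q2 pdiffM DP /= gdet1 F1 mulr0 addr0 mul1r.
Qed.

End OrbitTangent.

(** * The tangent space of the star *)

Lemma has_deriv_linear (k : closedFieldType) (U V : vectType k) (L : {linear U -> V})
    (f : V -> k) x v c :
  has_deriv f (L x) (L v) c -> has_deriv (fun y => f (L y)) x v c.
Proof.
move=> [p [pf pc]]; have [q [q1 q2]] := peval_linear L 0 p.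
by exists q; split=> [y|]; rewrite ?q1 ?q2 addr0.
Qed.

Lemma has_derivB (k : closedFieldType) (U : vectType k) (f g : U -> k) x v c c' :
  has_deriv f x v c -> has_deriv g x v c' -> has_deriv (fun y => f y - g y) x v (c - c').
Proof.
move=> [p [pf <-]] [q [qf <-]]; exists (p - q); split=> [y|].
  by rewrite pevalD pevalN pf qf.
by rewrite pdiffD pdiffN.
Qed.

Section Star.
Variables (k : closedFieldType) (Q : quiver) (d e : dimvec Q).
Local Notation n := (dadd e d).
Local Notation VM := (vertex_maps k n n).
Local Notation R := (rep k n).
Local Notation VR := (VM * R)%type.
Local Notation RVR := (R * VR)%type.
Variables (cA : set (rep k d)) (cB : set (rep k e)).
Hypotheses (cA_MQ : in_MQ cA) (cB_MQ : in_MQ cB).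

Let E := extensions cA cB.
Let G := graph (gl k n `*` E) (@act k Q n).

Lemma extensionsE : E = @extension_of k Q d e @` (cA `*` (cB `*` setT)).
Proof.
apply/seteqP; split=> y.
  by move=> [M [N [zeta [AM BN ->]]]]; exists (M, (N, zeta)).
by move=> [[M [N zeta]] [/= AM [BN _]] <-]; exists M, N, zeta.
Qed.

Lemma irreducible_extensions : irreducible E.
Proof.
have [_ irA _] := cA_MQ; have [_ irB _] := cB_MQ.
rewrite extensionsE; apply: irreducible_image.
  exact: (linear_regular_map (mk_linear (@extension_linear k Q d e))).
apply: (irreducible_prod irA (irreducible_prod irB _)); exact: irreducible_setT.
Qed.

Lemma irreducible_ext_graph : irreducible G.
Proof. exact: (irreducible_graph_act irreducible_extensions). Qed.

Definition act_entry a r s (z : RVR) : k :=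
  (mxf z.1 a *m mxf z.2.1 (tl a)) r s - (mxf z.2.1 (hd a) *m mxf z.2.2 a) r s.

Arguments act_entry : clear implicits.

Lemma act_entry_graph a r s z : G z -> act_entry a r s z = 0.
Proof.
move=> [[g y] [/= gg _] ->]; rewrite /act_entry /act /= mxfam_ofK.
by rewrite mulmxKV ?subrr // gg.
Qed.

Lemma act_entry_deriv a r s (z t : RVR) :
  has_deriv (act_entry a r s) z t
    ((mxf z.1 a *m mxf t.2.1 (tl a) + mxf t.1 a *m mxf z.2.1 (tl a)) r s -
     (mxf z.2.1 (hd a) *m mxf t.2.2 a + mxf t.2.1 (hd a) *m mxf z.2.2 a) r s).
Proof.
have h1 := @has_deriv_mxf k RVR _ _ _ (fst : {linear RVR -> R}) a z t.
have h2 i := @has_deriv_mxf k RVR _ _ _ (fst \o snd : {linear RVR -> VM}) i z t.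
have h3 := @has_deriv_mxf k RVR _ _ _ (snd \o snd : {linear RVR -> R}) a z t.
apply: has_derivB.
  exact: (has_deriv_mulmx h1 (h2 (tl a)) r s).
exact: (has_deriv_mulmx (h2 (hd a)) h3 r s).
Qed.

Let lin3 (V : vectType k) (f : R -> V) (lf : linear f) : {linear RVR -> V} :=
  (mk_linear lf \o (snd \o snd : {linear RVR -> R})).

(** The graph is defined, among pairs with invertible g, by polynomial equations: the
    diagonal blocks lie in closed sets, the lower left block is zero, and w g = g y. *)
Lemma graph_closure z : closure_of G z -> gdet z.2.1 != 0 -> G z.
Proof.
case: z => [w [g y]] cl /= gn0; have gg : gl k n g by apply/gdet_unit.
have cl0 (f : RVR -> k) : regular f -> (forall z, G z -> f z = 0) -> f (w, (g, y)) = 0.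
  by move=> [p pP] f0; rewrite -pP; apply: cl => z Gz; rewrite pP f0.
have GE z : G z -> exists M N zeta, [/\ cA M, cB N & z.2.2 = extension N zeta M].
  by move=> [[g' y'] [_ [M [N [zeta [AM BN /= yE]]]]] ->]; exists M, N, zeta.
have [[SA EA] _ _] := cA_MQ; have [[SB EB] _ _] := cB_MQ.
have yA : cA (blockA y).
  rewrite EA => p Sp.
  have rp : regular (peval p) by exists p.
  apply: (cl0 _ (regular_linear_comp (lin3 (@blockA_linear k Q d e)) rp)) => z.
  move=> /GE[M [N [zeta [AM _ /= ->]]]]; rewrite blockA_ext.
  by move: AM; rewrite EA; apply.
have yB : cB (blockB y).
  rewrite EB => p Sp.
  have rp : regular (peval p) by exists p.
  apply: (cl0 _ (regular_linear_comp (lin3 (@blockB_linear k Q d e)) rp)) => z.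
  move=> /GE[M [N [zeta [_ BN /= ->]]]]; rewrite blockB_ext.
  by move: BN; rewrite EB; apply.
have yL : blockL y = 0.
  apply: v2r_inj; apply/rowP => i; rewrite linear0 [RHS]mxE.
  apply: (cl0 (fun z => v2r (blockL z.2.2) 0 i)).
    exact: (linear_regular_map (lin3 (@blockL_linear k Q d e)) i).
  by move=> z /GE[M [N [zeta [_ _ ->]]]]; rewrite blockL_ext linear0 mxE.
exists (g, y).
  split=> //; exists (blockA y), (blockB y), (blockZ y); split=> //.
  by rewrite extension_blocks.
congr (_, _); apply: mxf_inj => a; rewrite /act mxfam_ofK /=.
apply: (can_inj (mulmxK (gg (tl a)))); rewrite mulmxKV ?gg //.
apply/matrixP => r s; apply/eqP; rewrite -subr_eq0; apply/eqP.
apply: (cl0 (act_entry a r s)); last by move=> z; apply: act_entry_graph.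
by have [p [pP _]] := @act_entry_deriv a r s 0 0; exists p.
Qed.

(** The same equations, differentiated at (1, z). *)
Lemma graph_tangent A B zeta t xi w : let z := extension B zeta A in
    (forall f : polyfun RVR, ideal_of G f ->
      pdiff f (act (gl1 k n, z), (gl1 k n, z)) (t, (xi, w)) = 0) ->
  [/\ tangent cA A (blockA w), tangent cB B (blockB w), blockL w = 0 & t = w + inf_act xi z].
Proof.
move=> z tG; have act1 : act (gl1 k n, z) = z by rewrite /act gl_act1.
rewrite act1 in tG.
have tG0 (f : RVR -> k) c : has_deriv f (z, (gl1 k n, z)) (t, (xi, w)) c ->
    (forall u, G u -> f u = 0) -> c = 0.
  by move=> [p [pP <-]] f0; apply: tG => u Gu; rewrite pP f0.
have GE u : G u -> exists M N zeta, [/\ cA M, cB N & u.2.2 = extension N zeta M].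
  by move=> [[g' y'] [_ [M [N [zeta' [AM BN /= yE]]]]] ->]; exists M, N, zeta'.
split.
- move=> p Ap; apply: (tG0 (fun u => peval p (blockA u.2.2))).
    apply: (has_deriv_linear (L := lin3 (@blockA_linear k Q d e)) (f := peval p)).
    by exists p; split=> //=; rewrite blockA_ext.
  by move=> u /GE[M [N [zeta' [AM _ ->]]]]; rewrite blockA_ext Ap.
- move=> p Bp; apply: (tG0 (fun u => peval p (blockB u.2.2))).
    apply: (has_deriv_linear (L := lin3 (@blockB_linear k Q d e)) (f := peval p)).
    by exists p; split=> //=; rewrite blockB_ext.
  by move=> u /GE[M [N [zeta' [_ BN ->]]]]; rewrite blockB_ext Bp.
- apply: v2r_inj; apply/rowP => i; rewrite linear0 [RHS]mxE.
  apply: (tG0 (fun u => v2r (blockL u.2.2) 0 i)).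
    apply: (has_deriv_linear (L := lin3 (@blockL_linear k Q d e)) (f := fun x => v2r x 0 i)).
    exact: has_deriv_coord.
  by move=> u /GE[M [N [zeta' [_ _ ->]]]]; rewrite blockL_ext linear0 mxE.
- apply: mxf_inj => a; rewrite mxfD mxfam_ofK; apply/matrixP => r s.
  have /eqP := tG0 _ _ (@act_entry_deriv a r s _ _) (fun u => @act_entry_graph a r s u).
  rewrite /= !mxfam_ofK mulmx1 mul1mx subr_eq0 => /eqP.
  rewrite !mxE => E0; rewrite addrA -E0.
  by rewrite [X in X - _]addrC addrK.
Qed.

Lemma star_stable g y : gl k n g -> star cA cB y -> star cA cB (gl_act g y).
Proof.
move=> gg; rewrite starE => -[[h x] [/= gh Ex] <-]; exists (vmul g h, x).
  by split=> //; apply: gl_vmul.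
by rewrite /act /= gl_act_vmul.
Qed.

Lemma extension_star A B zeta : cA A -> cB B -> star cA cB (extension B zeta A).
Proof.
move=> AA BB; rewrite starE; exists (gl1 k n, extension B zeta A).
  by split; [apply: gl_gl1 | exists A, B, zeta].
by rewrite /act gl_act1.
Qed.

Definition lower_block (f : vertex_maps k e d) : VM :=
  mxfam_of (fun i => block_mx 0 0 (mxf f i) 0 : 'M_(e i + d i)).

Definition lower_act A B zeta (f : vertex_maps k e d) : R :=
  inf_act (lower_block f) (@extension k Q d e B zeta A).

Lemma mxf_lower_act A B zeta f a : mxf (lower_act A B zeta f) a =
  block_mx (- (mxf zeta a *m mxf f (tl a))) 0
    (mxf f (hd a) *m mxf B a - mxf A a *m mxf f (tl a)) (mxf f (hd a) *m mxf zeta a).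
Proof.
rewrite !mxfam_ofK !mulmx_block opp_block_mx add_block_mx.
by rewrite !mul0mx !mulmx0 !(addr0, add0r, oppr0, subr0).
Qed.

(** A tangent vector of the star lifts to the graph as (t, (xi, w)) with
    t = w + [xi, z].  The diagonal and upper right blocks of xi contribute tangent
    vectors of E, because the given sets are stable under the groups. *)
Lemma tangent_star A B zeta t : let z := extension B zeta A in
    cA A -> cB B -> smooth_at (gl k n `*` E) (star cA cB) (@act k Q n) (gl1 k n, z) ->
  tangent (star cA cB) z t <->
  exists b eta a f, [/\ tangent cB B b, tangent cA A a & t = extension b eta a + lower_act A B zeta f].
Proof.
move=> z AA BB sm; have [_ _ stA] := cA_MQ; have [_ _ stB] := cB_MQ; split=> [tz|]; last first.
  move=> [b [eta [a [f [tb ta ->]]]]]; apply: tangentD; last first.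
    by apply: orbit_tangent => [g y|]; [apply: star_stable | apply: extension_star].
  have -> : extension b eta a = extension_of (a, (0, 0)) + extension_of (0, (b, 0)) + extension_of (0, (0, eta)).
    apply: mxf_inj => c; rewrite !mxfD !mxf_extension /= !add_block_mx !mxf0.
    by rewrite !(addr0, add0r).
  have zE : z = extension_of (A, (B, zeta)) by [].
  have tL (u v : rep k d * (rep k e * arrow_maps k d e)) :
      (forall p, (forall s, cA s.1 /\ cB s.2.1 -> peval p s = 0) -> pdiff p (A, (B, zeta)) v = 0) ->
      tangent (star cA cB) z (extension_of v).
    move=> tv p Xp; have [q [q1 q2]] := peval_linear (mk_linear (@extension_linear k Q d e)) 0 p.
    have := q2 (A, (B, zeta)) v; rewrite addr0 /= => <-; apply: tv => s [As Bs].
    by rewrite q1 addr0 /=; apply: Xp; apply: extension_star.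
  apply: tangentD; first apply: tangentD; apply: tL => //.
  - move=> p p0; have [q [q1 q2]] := slice_left p (B, zeta); rewrite -q2.
    by apply: ta => M AM; rewrite q1 p0.
  - move=> p p0; have [q [q1 q2]] := slice_right p A; rewrite -(q2 (B, zeta) (b, 0)).
    have [q' [q1' q2']] := slice_left q zeta; rewrite -q2'.
    by apply: tb => N BN; rewrite q1' q1 p0.
  - move=> p p0; have [q [q1 q2]] := slice_right p A; rewrite -(q2 (B, zeta) (0, eta)).
    have [q' [q1' q2']] := slice_right q B; rewrite -q2'.
    by apply: pdiff_vanish => x; rewrite q1' q1 p0.
have act1 : act (gl1 k n, z) = z by rewrite /act gl_act1.
have XY gy : (gl k n `*` E) gy -> star cA cB (act gy).
  by move=> Xgy; rewrite starE; exists gy.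
have tz' : tangent (star cA cB) (act (gl1 k n, z)) t by rewrite act1.
have [[xi w] tv] := smooth_at_tangent XY sm tz'.
have [|ta tb wL tE] := @graph_tangent A B zeta t xi w.
  by move=> f Gf; apply: tv => x Xx; apply: Gf; exists x.
pose xB : vertex_maps k e e := mxfam_of (fun i => ulsubmx (mxf xi i : 'M_(e i + d i))).
pose xZ : vertex_maps k d e := mxfam_of (fun i => ursubmx (mxf xi i : 'M_(e i + d i))).
pose xL : vertex_maps k e d := mxfam_of (fun i => dlsubmx (mxf xi i : 'M_(e i + d i))).
pose xA : vertex_maps k d d := mxfam_of (fun i => drsubmx (mxf xi i : 'M_(e i + d i))).
have xiE i : mxf xi i = block_mx (mxf xB i) (mxf xZ i) (mxf xL i) (mxf xA i).
  by rewrite !mxfam_ofK submxK.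
exists (blockB w + inf_act xB B).
exists (mxfam_of (fun a : arrow Q => mxf (blockZ w) a + (mxf xB (hd a) *m mxf zeta a
   + mxf xZ (hd a) *m mxf A a - mxf B a *m mxf xZ (tl a) - mxf zeta a *m mxf xA (tl a)))).
exists (blockA w + inf_act xA A), xL; split.
+ by apply: tangentD => //; apply: orbit_tangent => // g y; apply: stB.
+ by apply: tangentD => //; apply: orbit_tangent => // g y; apply: stA.
have actE a : mxf (inf_act xi z) a = block_mx
    (mxf (inf_act xB B) a - mxf zeta a *m mxf xL (tl a))
    (mxf xB (hd a) *m mxf zeta a + mxf xZ (hd a) *m mxf A a -
       (mxf B a *m mxf xZ (tl a) + mxf zeta a *m mxf xA (tl a)))
    (mxf xL (hd a) *m mxf B a - mxf A a *m mxf xL (tl a))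
    (mxf xL (hd a) *m mxf zeta a + mxf (inf_act xA A) a).
  rewrite [in LHS]mxfam_ofK !xiE mxf_extension !mulmx_block opp_block_mx add_block_mx.
  rewrite [mxf (inf_act xB B) a]mxfam_ofK [mxf (inf_act xA A) a]mxfam_ofK.
  rewrite !mul0mx !mulmx0 !(addr0, add0r) !opprD !addrA; congr block_mx.
rewrite tE -{1}(extension_blocks wL); apply: mxf_inj => a.
rewrite !mxfD mxf_lower_act actE !mxf_extension [in RHS]mxfam_ofK !mxfD !add_block_mx.
rewrite !(addr0, add0r); congr block_mx; rewrite ?addrA //.
  by rewrite opprD !addrA.
by rewrite addrAC.
Qed.

End Star.

(** * Dimension count and generic morphisms *)

Section Dimension.
Variables (k : closedFieldType) (Q : quiver) (d e : dimvec Q).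
Local Notation n := (dadd e d).
Variables (A : rep k d) (B : rep k e) (zeta : arrow_maps k d e).
Variables (UA : {vspace rep k d}) (UB : {vspace rep k e}).

Let Dom := (subvs_of UB * (arrow_maps k d e * (subvs_of UA * vertex_maps k e d)))%type.

Lemma extensionP a (N N' : rep k e) (z z' : arrow_maps k d e) (M M' : rep k d) :
  extension (a *: N + N') (a *: z + z') (a *: M + M') = a *: extension N z M + extension N' z' M'.
Proof. exact: (extension_linear a (M, (N, z)) (M', (N', z'))). Qed.

Lemma lower_act_linear : linear (lower_act A B zeta).
Proof.
move=> a x y; apply: mxf_inj => c; rewrite [RHS]mxfD [X in _ = X + _]mxfZ.
rewrite (mxf_lower_act _ _ _ (a *: x + y)) (mxf_lower_act _ _ _ x) (mxf_lower_act _ _ _ y).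
rewrite ![mxf (a *: x + y) _]mxfD ![mxf (a *: x) _]mxfZ.
rewrite scale_block_mx add_block_mx !(mulmxDl, mulmxDr) -!(scalemxAl, scalemxAr).
rewrite scaler0 addr0; congr block_mx; first by rewrite opprD scalerN.
by rewrite scalerBr opprD addrACA.
Qed.

Let Phi_fun (x : Dom) : rep k n :=
  extension (vsval x.1) x.2.1 (vsval x.2.2.1) + lower_act A B zeta x.2.2.2.

Let Phi_linear : linear Phi_fun.
Proof.
move=> a x y; rewrite /Phi_fun lower_act_linear scalerDr addrACA; congr (_ + _).
have -> : vsval (a *: x + y).1 = a *: vsval x.1 + vsval y.1 by exact: (linearP (@vsval _ _ UB)).
have -> : vsval (a *: x + y).2.2.1 = a *: vsval x.2.2.1 + vsval y.2.2.1 by exact: (linearP (@vsval _ _ UA)).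
have -> : (a *: x + y).2.1 = a *: x.2.1 + y.2.1 by [].
exact: extensionP.
Qed.

Let Phi : 'Hom(Dom, rep k n) := linfun (mk_linear Phi_linear).

Let PhiE x : Phi x = Phi_fun x.
Proof. by rewrite lfunE. Qed.

Let pr : 'Hom(Dom, vertex_maps k e d) :=
  linfun (snd \o (snd \o snd) : {linear Dom -> vertex_maps k e d}).

Lemma Phi_ker x : Phi x = 0 <-> [/\ HomQ B A x.2.2.2, vsval x.1 = pre zeta x.2.2.2,
  x.2.1 = 0 & vsval x.2.2.1 = - post x.2.2.2 zeta].
Proof.
case: x => [b [eta [a f]]]; rewrite PhiE /Phi_fun /=.
have E c : mxf (extension (vsval b) eta (vsval a) + lower_act A B zeta f) c =
  block_mx (mxf (vsval b) c - mxf zeta c *m mxf f (tl c)) (mxf eta c)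
    (mxf f (hd c) *m mxf B c - mxf A c *m mxf f (tl c))
    (mxf (vsval a) c + mxf f (hd c) *m mxf zeta c).
  by rewrite mxfD mxf_lower_act mxf_extension add_block_mx add0r addr0.
split=> [x0|[fBA bE eta0 aE]].
  have x0' c : [/\ mxf (vsval b) c = mxf zeta c *m mxf f (tl c), mxf eta c = 0,
      mxf f (hd c) *m mxf B c = mxf A c *m mxf f (tl c) &
      mxf (vsval a) c = - (mxf f (hd c) *m mxf zeta c)].
    have := E c; rewrite x0 mxf0 -[0 in LHS]block_mx0 => /eq_block_mx[e1 e2 e3 e4].
    split; first by apply/eqP; rewrite -subr_eq0 -e1.
    - by rewrite -e2.
    - by apply/eqP; rewrite -subr_eq0 -e3.
    - by apply/eqP; rewrite -subr_eq0 opprK -e4.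
  split.
  - by move=> c; case: (x0' c).
  - by apply: mxf_inj => c; rewrite mxfam_ofK; case: (x0' c).
  - by apply: mxf_inj => c; rewrite mxf0; case: (x0' c).
  - apply: mxf_inj => c; rewrite mxfN mxfam_ofK.
    by case: (x0' c).
apply: mxf_inj => c; rewrite E bE eta0 aE fBA mxfN !mxfam_ofK !mxf0.
by rewrite !subrr addNr block_mx0.
Qed.

(** The rank formula for (b, eta, a, f) |-> (b, eta, a) + [f, z].  The kernel is
    isomorphic to F by its last component, since the diagonal blocks force
    b = zeta f and a = - f zeta. *)
Lemma dim_extension_tangent (T : set (rep k n)) (F : set (vertex_maps k e d)) :
    (forall t, T t <-> exists b eta a f,
       [/\ b \in UB, a \in UA & t = extension b eta a + lower_act A B zeta f]) ->
    (forall f, F f <-> [/\ HomQ B A f, post f zeta \in UA & pre zeta f \in UB]) ->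
  (vdim T + vdim F = \dim UB + dim (arrow_maps k d e) + \dim UA + dim (vertex_maps k e d))%N.
Proof.
move=> TP FP.
have dT : vdim T = \dim (limg Phi).
  apply: vdimE => t; rewrite TP; split=> [[b [eta [a [f [Ub Ua ->]]]]]|].
    apply/memv_imgP; exists (vsproj UB b, (eta, (vsproj UA a, f))); first exact: memvf.
    by rewrite PhiE /Phi_fun /= !vsprojK.
  move=> /memv_imgP[[b [eta [a f]]] _ ->]; exists (vsval b), eta, (vsval a), f.
  by rewrite !subvsP PhiE.
have dF : vdim F = \dim (lker Phi).
  have inj : (lker Phi :&: lker pr = 0)%VS.
    apply/eqP; rewrite -subv0; apply/subvP => x; rewrite memv_cap !memv_ker memv0.
    move=> /andP[/eqP/Phi_ker[_ b0 eta0 a0] /eqP]; rewrite lfunE /= => f0.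
    move: b0 eta0 a0 f0; case: x => [b [eta [a f]]] /= b0 -> a0 f0.
    have b00 : b = 0.
      apply: subvs_inj; rewrite b0 f0 linear0; apply: mxf_inj => c.
      by rewrite mxfam_ofK !mxf0 mulmx0.
    have a00 : a = 0.
      apply: subvs_inj; rewrite a0 f0 linear0; apply/eqP; rewrite oppr_eq0; apply/eqP.
      by apply: mxf_inj => c; rewrite mxfam_ofK !mxf0 mul0mx.
    by rewrite b00 a00 f0.
  rewrite -(limg_dim_eq inj); apply: vdimE => f; rewrite FP; split.
    move=> [fBA fz zf]; apply/memv_imgP.
    exists (vsproj UB (pre zeta f), (0, (vsproj UA (- post f zeta), f))); last by rewrite lfunE.
    by rewrite memv_ker; apply/eqP/Phi_ker; split=> //=; rewrite vsprojK ?memvN.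
  move=> /memv_imgP[x]; rewrite memv_ker => /eqP/Phi_ker[fBA bE _ aE] ->.
  rewrite lfunE /=; split=> //; first by rewrite -memvN -aE subvsP.
  by rewrite -bE subvsP.
have := limg_ker_dim Phi fullv; rewrite capfv -dT -dF dimvf addnC => ->.
by rewrite -!addnA.
Qed.

End Dimension.

Lemma nat_minE (S : set nat) d : S d -> (forall m, S m -> (d <= m)%N) -> nat_min S = d.
Proof.
move=> Sd mind; rewrite /nat_min; case: xgetP => [m _ [Sm minm]|/(_ d)[]//].
by apply/eqP; rewrite eqn_leq mind // minm.
Qed.

Section GenericHom.
Variables (k : closedFieldType) (Q : quiver) (d e : dimvec Q).
Local Notation P := (rep k e * rep k d)%type.
Local Notation F := (vertex_maps k e d).
Local Notation T := (arrow_maps k e d).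

Definition commutator (p : P) (f : F) : T :=
  mxfam_of (fun a : arrow Q => mxf f (hd a) *m mxf p.1 a - mxf p.2 a *m mxf f (tl a)).

Lemma commutator_linear1 f : linear (commutator^~ f).
Proof.
move=> a x y; apply: mxf_inj => c; rewrite mxfD mxfZ !mxfam_ofK /= !(mxfD, mxfZ).
by rewrite mulmxDl mulmxDr -scalemxAl -scalemxAr scalerBr opprD addrACA.
Qed.

Lemma commutator_linear2 p : linear (commutator p).
Proof.
move=> a x y; apply: mxf_inj => c; rewrite mxfD mxfZ !mxfam_ofK /= !(mxfD, mxfZ).
by rewrite mulmxDl mulmxDr -scalemxAl -scalemxAr scalerBr opprD addrACA.
Qed.

Let L p : 'Hom(F, T) := linfun (mk_linear (commutator_linear2 p)).

Lemma vdim_HomQ p : (vdim (HomQ p.1 p.2) + \dim (limg (L p)) = dim F)%N.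
Proof.
rewrite (@vdimE _ _ _ (lker (L p))) => [|f].
  by have := limg_ker_dim (L p) fullv; rewrite capfv dimvf.
rewrite memv_ker lfunE /=; split=> [fh|/eqP f0].
  by apply/eqP/mxf_inj => a; rewrite mxfam_ofK mxf0 fh subrr.
move=> a; apply/eqP; rewrite -subr_eq0; apply/eqP.
by have := congr1 (fun g => mxf g a) f0; rewrite /= mxfam_ofK mxf0.
Qed.

(** The commutator at a point where its kernel is smallest has rank r; express it on r
    vectors with independent images and in a basis of its image.  The determinant
    of this square matrix is not zero there, and wherever it is not zero the rank
    is at least r. *)
Lemma generic_hom (cA : set (rep k d)) (cB : set (rep k e)) : cA !=set0 -> cB !=set0 ->
  exists h : polyfun P, ~ ideal_of (cB `*` cA) h /\
    forall B A, cB B -> cA A -> peval h (B, A) != 0 -> vdim (HomQ B A) = homQ cB cA.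
Proof.
move=> [A1 AA1] [B1 BB1].
pose S m := `[< exists M N, [/\ cB M, cA N & m = vdim (HomQ M N)] >].
have exS : exists m, S m by exists (vdim (HomQ B1 A1)); apply/asboolP; exists B1, A1.
case: (ex_minnP exS) => m /asboolP[B0 [A0 [BB0 AA0 mE]]] minm.
have homE : homQ cB cA = m.
  apply: nat_minE; first by exists B0, A0.
  by move=> m' Sm'; apply: minm; apply/asboolP.
pose r := \dim (limg (L (B0, A0))).
pose X := vbasis (limg (L (B0, A0))).
have /basis_free fX := vbasisP (limg (L (B0, A0))).
have /choice[u uP] : forall i : 'I_r, exists u, commutator (B0, A0) u = X`_i.
  move=> i; have : X`_i \in limg (L (B0, A0)).
    by apply: vbasis_mem; apply: mem_nth; rewrite size_tuple.
  by move=> /memv_imgP[u _ ->]; exists u; rewrite lfunE.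
pose N p : 'M[k]_r := \matrix_(i, j) coord X j (commutator p (u i)).
have rN : regular_mx N.
  move=> i j; have cl : linear (fun p => coord X j (commutator p (u i)) : k^o).
    by move=> a x y; rewrite commutator_linear1 linearP.
  by apply: (regular_ext _ (linear_regular (mk_linear cl))) => p; rewrite mxE.
have [h hP] := regular_det rN.
exists h; split=> [|B A BB AA].
  move=> /(_ (B0, A0) (conj BB0 AA0)); rewrite hP (_ : N _ = 1%:M) ?det1.
    by apply/eqP; exact: oner_neq0.
  by apply/matrixP => i j; rewrite !mxE uP coord_free.
rewrite hP => hN; rewrite homE; apply/eqP; rewrite eqn_leq minm ?andbT; last first.
  by apply/asboolP; exists B, A.
have ler : (r <= \dim (limg (L (B, A))))%N.
  pose s := [tuple commutator (B, A) (u i) | i < r].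
  have fs : free s.
    apply/freeP => c c0 i.
    have cN : \row_j c j *m N (B, A) = 0.
      apply/rowP => j; rewrite !mxE -[RHS](linear0 (coord X j)) -[in RHS]c0 linear_sum.
      apply: eq_bigr => l _; rewrite !mxE linearZ.
      by rewrite -tnth_nth tnth_mktuple.
    have uN : N (B, A) \in unitmx by rewrite unitmxE unitfE.
    have /rowP/(_ i) := congr1 (mulmxr (invmx (N (B, A)))) cN.
    by rewrite /= mulmxK // mul0mx !mxE.
  have /eqP <- : size s == r by rewrite size_tuple.
  move: fs; rewrite /free => /eqP <-; apply/dimvS/span_subvP => _ /mapP[i _ ->].
  by apply/memv_imgP; exists (u i); rewrite ?memvf ?lfunE.
rewrite -(leq_add2r r) mE (vdim_HomQ (B0, A0)) -(vdim_HomQ (B, A)).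
by rewrite leq_add2l.
Qed.

End GenericHom.

(** * A point with all the generic properties *)

Section NonzeroFunctions.
Variables (k : closedFieldType) (U : vectType k) (X : set U).
Hypothesis irX : irreducible X.

Definition nonzero_on (f : U -> k) := regular f /\ exists x, X x /\ f x != 0.

Lemma nonzero_onM f g : nonzero_on f -> nonzero_on g -> nonzero_on (fun x => f x * g x).
Proof.
move=> [[p pP] [x [Xx fx]]] [[q qP] [y [Xy gy]]]; split; first by apply: regularM; [exists p | exists q].
have np : ~ ideal_of X p by move=> /(_ x Xx)/eqP; rewrite pP (negbTE fx).
have nq : ~ ideal_of X q by move=> /(_ y Xy)/eqP; rewrite qP (negbTE gy).
have [z [Xz]] := not_ideal (ideal_prime_notin irX np nq).
by rewrite pevalM pP qP; exists z.
Qed.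

End NonzeroFunctions.

Section GenericPoint.
Variables (k : closedFieldType) (Q : quiver) (d e : dimvec Q).
Hypothesis char0 : [pchar k] =i pred0.
Local Notation n := (dadd e d).
Local Notation VM := (vertex_maps k n n).
Local Notation R := (rep k n).
Local Notation VR := (VM * R)%type.
Local Notation RVR := (R * VR)%type.
Local Notation S := (rep k d * (rep k e * arrow_maps k d e))%type.
Variables (cA : set (rep k d)) (cB : set (rep k e)).
Hypotheses (cA_MQ : in_MQ cA) (cB_MQ : in_MQ cB).

Let E := extensions cA cB.
Let G := graph (gl k n `*` E) (@act k Q n).
Let Xs : set S := cA `*` (cB `*` setT).

Lemma vmul_linear (g : VM) : linear (vmul g).
Proof.
move=> a x y; apply: mxf_inj => i; rewrite mxfD mxfZ !mxfam_ofK mxfD mxfZ.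
by rewrite mulmxDr -scalemxAr.
Qed.

(** Translation by g carries (1, z) to (g, z) and preserves both sides of the action. *)
Lemma translate_smooth_at g z : gl k n g -> E z ->
    smooth_at (gl k n `*` E) (star cA cB) (@act k Q n) (g, z) ->
  smooth_at (gl k n `*` E) (star cA cB) (@act k Q n) (gl1 k n, z).
Proof.
move=> gg Ez sm.
pose idl := mk_linear (fun a (x y : R) => erefl (a *: x + y)).
pose sV h : {linear VR -> VR} := mk_linear (prod_linear (mk_linear (vmul_linear h)) idl).
pose sW h : {linear R -> R} := mk_linear (gl_act_linear h).
have gV := gl_vinv gg.
apply: (@smooth_at_transport k _ _ _ _ _ (sV g) (sV (vinv g)) (sW g) (sW (vinv g))).
- by move=> [h y]; congr (_, _); rewrite /= vmulA vmulgV // vmul1g.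
- by move=> [h y]; congr (_, _); rewrite /= vmulA vmulVg // vmul1g.
- by move=> y; apply: gl_actVK.
- by move=> y; apply: gl_actK.
- by move=> [h y] [gh Ey]; split=> //; apply: gl_vmul.
- by move=> [h y] [gh Ey]; split=> //; apply: gl_vmul.
- by move=> y; apply: star_stable.
- by move=> [h y] [gh Ey]; apply: gl_act_vmul.
- by split=> //; apply: gl_gl1.
have -> : sV g (gl1 k n, z) = (g, z) => //.
congr (_, _); apply: mxf_inj => i; by rewrite !mxfam_ofK mulmx1.
Qed.

Lemma translate_smooth_point g z : gl k n g -> smooth_point (star cA cB) (gl_act g z) ->
  smooth_point (star cA cB) z /\
  vdim (tangent (star cA cB) z) = vdim (tangent (star cA cB) (gl_act g z)).
Proof.
move=> gg sm; have gV := gl_vinv gg.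
apply: (@smooth_point_transport k _ _ (mk_linear (gl_act_linear g))
  (mk_linear (gl_act_linear (vinv g)))) => //.
- by move=> y; apply: gl_actK.
- by move=> y; apply: gl_actVK.
- by move=> y; apply: star_stable.
- by move=> y; apply: star_stable.
Qed.

(** The conditions on the star and on the graph are first met at some (g, y), where g
    is then fixed; the conditions on y become polynomial conditions on (A, B, zeta),
    none of which is identically zero. *)
Lemma generic_point : exists A B zeta, let z := extension B zeta A in
  [/\ cA A /\ cB B,
      [/\ smooth_point cA A, smooth_point cB B & smooth_point (star cA cB) z],
      smooth_at (gl k n `*` E) (star cA cB) (@act k Q n) (gl1 k n, z),
      vdim (HomQ B A) = homQ cB cA
    & [/\ vdim (tangent cA A) = krull_dim cA, vdim (tangent cB B) = krull_dim cB
        & vdim (tangent (star cA cB) z) = krull_dim (star cA cB)]].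
Proof.
have [clA irA _] := cA_MQ; have [clB irB _] := cB_MQ.
have irG : irreducible G by exact: irreducible_ext_graph.
have starG : star cA cB = @act k Q n @` (gl k n `*` E) by rewrite starE.
have irS : irreducible (star cA cB).
  have := irreducible_image (linear_regular_map (fst : {linear RVR -> R})) irG.
  rewrite (_ : _ @` G = star cA cB) // starG; apply/seteqP; split=> y.
    by move=> [_ [gy Xgy ->] <-]; exists gy.
  by move=> [gy Xgy <-]; exists (act gy, gy) => //; exists gy.
have irXs : irreducible Xs.
  by apply: (irreducible_prod irA (irreducible_prod irB _)); apply: irreducible_setT.
have [hA [nhA hAP]] := generic_smooth_point char0 irA (zclosed_open_in_closure clA irA.1).
have [hB [nhB hBP]] := generic_smooth_point char0 irB (zclosed_open_in_closure clB irB.1).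
have openS : open_in_closure (star cA cB).
  have [D DP] : regular (fun z : RVR => gdet z.2.1).
    exact: (regular_linear_comp (snd : {linear RVR -> VR}) (@regular_gdet k Q n)).
  rewrite starG; apply: (image_open_in_closure irG (D := D)).
    have [[x0 [gy [gg Ey] _]] _] := irG; move=> /(_ (act gy, gy)).
    rewrite DP => D0; have /gdet_unit/eqP := gg; apply; apply: D0.
    by exists gy.
  by move=> z cl; rewrite DP; apply: graph_closure.
have [hS [nhS hSP]] := generic_smooth_point char0 irS openS.
have [hG [nhG hGP]] := generic_smoothness char0 irG.
have [hh [nhh hhP]] := generic_hom irA.1 irB.1.
(* One g serves both the star and the orbit map. *)
have [z0 [[[g y0] [/= gg Ey0] z0E] [hS0 hG0]]] : exists z, G z /\ peval hS z.1 != 0 /\ peval hG z != 0.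
  have nzS : nonzero_on G (fun z => peval hS z.1).
    split; first by apply: (regular_linear_comp (fst : {linear RVR -> R})); exists hS.
    have [y [Sy hy]] := not_ideal nhS; move: Sy; rewrite starG => -[gy Xgy yE].
    by move: hy; rewrite -yE => hy; exists (act gy, gy); split=> //; exists gy.
  have nzG : nonzero_on G (peval hG).
    by split; [exists hG | apply: not_ideal].
  have [_ [z [Gz]]] := nonzero_onM irG nzS nzG; rewrite mulf_eq0 negb_or => /andP[? ?].
  by exists z.
rewrite z0E in hS0 hG0.
have [s0 Xs0 s0E] : exists2 s, Xs s & extension_of s = y0.
  by move: Ey0; rewrite /E extensionsE => -[s ? ?]; exists s.
pose ext := mk_linear (@extension_linear k Q d e).
pose actg := mk_linear (gl_act_linear g).
have nz1 : nonzero_on Xs (fun s => peval hA s.1).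
  split; first by apply: (regular_linear_comp (fst : {linear S -> rep k d})); exists hA.
  have [A [AA hAA]] := not_ideal nhA; case: irB => [[B BB] _].
  by exists (A, (B, 0)).
have nz2 : nonzero_on Xs (fun s => peval hB s.2.1).
  split; first by apply: (regular_linear_comp (fst \o snd : {linear S -> rep k e})); exists hB.
  have [B [BB hBB]] := not_ideal nhB; case: irA => [[A AA] _].
  by exists (A, (B, 0)).
have nz3 : nonzero_on Xs (fun s => peval hh (s.2.1, s.1)).
  split.
    apply: regular_comp; apply: regular_map_pair.
      exact: (linear_regular_map (fst \o snd : {linear S -> rep k e})).
    exact: (linear_regular_map (fst : {linear S -> rep k d})).
  by have [[B A] [[BB AA] hBA]] := not_ideal nhh; exists (A, (B, 0)).
have nz4 : nonzero_on Xs (fun s => peval hS (gl_act g (extension_of s))).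
  split; last by exists s0; rewrite s0E.
  by apply: (regular_linear_comp (actg \o ext : {linear S -> R})); exists hS.
have nz5 : nonzero_on Xs (fun s => peval hG (gl_act g (extension_of s), (g, extension_of s))).
  split; last by exists s0; rewrite s0E.
  apply: regular_comp; apply: regular_map_pair.
    exact: (linear_regular_map (actg \o ext : {linear S -> R})).
  apply: regular_map_pair; last exact: (linear_regular_map ext).
  by move=> i; apply: regular_const.
have [_ [[A [B zeta]] [[/= AA [BB _]]]]] := nonzero_onM irXs nz1
  (nonzero_onM irXs nz2 (nonzero_onM irXs nz3 (nonzero_onM irXs nz4 nz5))).
rewrite /extension_of /= !mulf_eq0 !negb_or => /and5P[hA1 hB1 hh1 hS1 hG1].
pose z := extension B zeta A; exists A, B, zeta; rewrite -/z.
have Ez : E z by exists A, B, zeta.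
have [smA dimA] := hAP A AA hA1; have [smB dimB] := hBP B BB hB1.
have stz : star cA cB (gl_act g z) by apply: star_stable => //; apply: extension_star.
have [smS dimS] := hSP _ stz hS1.
have [smz dimz] := translate_smooth_point gg smS.
split; [by [] | by [] | | exact: hhP | by rewrite dimz].
by apply: (translate_smooth_at gg Ez); rewrite starG; apply: (hGP (g, z)).
Qed.

End GenericPoint.

Theorem corollary2p6 (k : closedFieldType) (char0 : [pchar k] =i pred0)
    (Q : quiver) (acyclicQ : acyclic Q) (d e : dimvec Q)
    (cA : set (rep k d)) (cB : set (rep k e))
    (cA_MQ : in_MQ cA) (cB_MQ : in_MQ cB)
    (r : int)
    (r_def : codim (star cA cB) = codim cA + codim cB - euler e d + r) :
  exists (A : rep k d) (B : rep k e) (zeta : arrow_maps k d e),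
    let z := extension B zeta A in
    [/\ cA A /\ cB B,
        [/\ smooth_point cA A, smooth_point cB B & smooth_point (star cA cB) z],
        smooth_at (gl k (dadd e d) `*` extensions cA cB) (star cA cB)
          (fun gy => gl_act gy.1 gy.2) (gl1 k (dadd e d), z),
        vdim (HomQ B A) = homQ cB cA
      & r = (vdim [set f | [/\ HomQ B A f, tangent cA A (post f zeta)
                             & tangent cB B (pre zeta f)]])%:Z].
Proof.
have [A [B [zeta [[AA BB] smooth sm hom [dimA dimB dimS]]]]] := generic_point char0 cA_MQ cB_MQ.
exists A, B, zeta; split=> //.
have [UA UAP] := tangent_vspace cA A; have [UB UBP] := tangent_vspace cB B.
pose T := tangent (star cA cB) (extension B zeta A).
pose F := [set f | [/\ HomQ B A f, tangent cA A (post f zeta) & tangent cB B (pre zeta f)]].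
rewrite -/F.
have TP t : T t <-> exists b eta a f,
    [/\ b \in UB, a \in UA & t = extension b eta a + lower_act A B zeta f].
  rewrite /T (tangent_star cA_MQ cB_MQ t AA BB sm).
  by split=> -[b [eta [a [f [/UBP tb /UAP ta ->]]]]]; exists b, eta, a, f.
have FP f : F f <-> [/\ HomQ B A f, post f zeta \in UA & pre zeta f \in UB].
  by split=> -[fh /UAP ta /UBP tb].
have := dim_extension_tangent TP FP.
rewrite dimS -(vdimE UAP) -(vdimE UBP) dimA dimB !dim_mxfam.
move: r_def; rewrite /codim /euler !krull_dim_setT // !dim_mxfam.
have -> : (\sum_j ((dadd e d \o @hd Q) j * (dadd e d \o @tl Q) j) =
   \sum_j ((d \o @hd Q) j * (d \o @tl Q) j) + \sum_j ((e \o @hd Q) j * (e \o @tl Q) j) +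
   (\sum_j ((e \o @hd Q) j * (d \o @tl Q) j) + \sum_a (e (tl a) * d (hd a))))%N.
  by rewrite -!big_split; apply: eq_bigr => j _; rewrite /dadd /=; ring.
have -> : (\sum_j d j * e j = \sum_i e i * d i)%N.
  by apply: eq_bigr => j _; rewrite mulnC.
move: (krull_dim _) (krull_dim _) (krull_dim _) (vdim F).
move: (\sum_j _)%N (\sum_j _)%N (\sum_j _)%N (\sum_a _)%N (\sum_i _)%N.
by move=> *; lia.
Qed.
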